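(* Let $(R,\mathfrak m)$ be a regular local ring with quotient field $F$ and $\dim R\ge 2$, let $\{(R_i,\mathfrak m_i)\}_{i\ge 0}$ be an infinite sequence of local quadratic transforms with $R_0=R$, let $S=\bigcup_{i\ge0}R_i$ with maximal ideal $N=\bigcup_i\mathfrak m_i$, let $x\in S$ be such that $xS$ is $N$-primary, let $T$ be the Noetherian hull of $S$ and assume $T$ is a localization of $R$. Let $S^*$ be the complete integral closure of $S$, $V$ the boundary valuation ring of $S$, and $W$ the rank one valuation overring of $V$. Assume $S$ is archimedean and not a DVR. If there exists $\theta\in S^*\setminus S$ such that $S[\theta]_N=W$, then (1) $S^*=S[\theta]$; (2) $\theta^{-1}S[\theta^{-1}]$ is a maximal ideal of $S[\theta^{-1}]$; and (3) $V=S[\theta^{-1}]_{\theta^{-1}S[\theta^{-1}]}$.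
   Context: A local quadratic transform of a regular local ring $(A,\mathfrak n)$ is a local ring $A[\mathfrak n/y]_{\mathfrak q}$ with $y\in\mathfrak n\setminus\mathfrak n^2$ and $\mathfrak q$ a prime ideal of $A[\mathfrak n/y]$ containing $\mathfrak n$. The sequence satisfies: for each $i\ge 0$, $R_{i+1}$ is a local quadratic transform of $R_i$, $R_i\subsetneq R_{i+1}$, and each $R_i$ is a regular local ring of dimension at least $2$ with maximal ideal $\mathfrak m_i$. $\mathrm{ord}_i$ is the order valuation of $R_i$ ($\mathrm{ord}_i(a)=\max\{n:a\in\mathfrak m_i^n\}$ for $0\ne a\in R_i$, extended to $F$ by $\mathrm{ord}_i(a/b)=\mathrm{ord}_i(a)-\mathrm{ord}_i(b)$), with valuation ring $V_i$. The boundary valuation ring of $S$ is the unique valuation ring $V$ with $R\subseteq V\subseteq F$ that is a limit point of $\{V_i\}$ in the patch topology (basic open sets $\{U: G\subseteq U, H\subseteq\mathfrak M_U\}$, $G,H\subseteq F$ finite); equivalently $V=\{q\in F:\mathrm{ord}_i(q)\ge 0\text{ for } i\gg0\}$. $W$ is the localization of $V$ at its height one prime ideal. The Noetherian hull $T$ is the intersection of all DVRs with quotient field $F$ properly containing $S$ (empty intersection $=F$). A domain $A$ is archimedean if $\bigcap_{n>0}a^nA=0$ for every nonunit $a\in A$. The complete integral closure of $S$ is the ring of $\theta\in F$ with $S[\theta]$ a fractional ideal of $S$. For $\theta\in S^*$ as in the claim, $N$ is an ideal of $S[\theta]$ and $S[\theta]_N$ denotes the localization of $S[\theta]$ at the multiplicative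 set $S[\theta]\setminus N$. *)

(* Defs.v *)
From HB Require Import structures.
From mathcomp Require Import all_boot all_algebra.
Set Implicit Arguments. Unset Strict Implicit. Unset Printing Implicit Defensive.
Import GRing.Theory.
Local Open Scope ring_scope.

Section Defs.
Variable F : fieldType.
Implicit Types (A B G I J P Q U S D : F -> Prop).

Definition subset_of A B := forall q, A q -> B q.
Definition set_eq A B := forall q, A q <-> B q.
Definition strict_subset A B := subset_of A B /\ exists q, B q /\ ~ A q.

Definition subring A :=
  [/\ A 0, A 1, (forall a b, A a -> A b -> A (a - b)) & (forall a b, A a -> A b -> A (a * b))].

Definition gen_ring G : F -> Prop := fun q => forall B, subring B -> subset_of G B -> B q.
Definition adjoin A (t : F) : F -> Prop := gen_ring (fun q => A q \/ q = t).

Definition ideal A I :=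
  [/\ subset_of I A, I 0, (forall a b, I a -> I b -> I (a - b)) & (forall r a, A r -> I a -> I (r * a))].
Definition proper_ideal A I := ideal A I /\ ~ I 1.
Definition prime_ideal A I :=
  proper_ideal A I /\ forall a b, A a -> A b -> I (a * b) -> I a \/ I b.
Definition maximal_ideal A I :=
  proper_ideal A I /\ forall J, ideal A J -> subset_of I J -> set_eq J I \/ set_eq J A.

(* nonunits of A; for a local ring this is its maximal ideal *)
Definition nonunits A : F -> Prop := fun a => A a /\ (a = 0 \/ ~ A a^-1).
Definition local_ring A := subring A /\ ideal A (nonunits A).

Definition ideal_gen A (gs : seq F) : F -> Prop := fun q =>
  exists cs : seq F, [/\ size cs = size gs, (forall c, c \in cs -> A c) &
     q = \sum_(i < size gs) cs`_i * gs`_i].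
Definition noetherian A := forall I, ideal A I ->
  exists gs : seq F, (forall g, g \in gs -> I g) /\ set_eq I (ideal_gen A gs).
Definition gen_ideal A G : F -> Prop := fun q => forall I, ideal A I -> subset_of G I -> I q.
Definition ideal_pow A I (n : nat) : F -> Prop := gen_ideal A (fun q =>
  exists s : seq F, [/\ size s = n, (forall z, z \in s -> I z) & q = \prod_(z <- s) z]).

Definition prime_chain A (n : nat) := exists P : nat -> F -> Prop,
  (forall k, (k <= n)%N -> prime_ideal A (P k)) /\
  (forall k, (k < n)%N -> strict_subset (P k) (P k.+1)).
Definition krull_dim A (d : nat) := prime_chain A d /\ ~ prime_chain A d.+1.
Definition dim_ge A (n : nat) := prime_chain A n.

Definition regular_local A := [/\ local_ring A, noetherian A &
  exists d, krull_dim A d /\ exists gs : seq F,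
    [/\ size gs = d, (forall g, g \in gs -> nonunits A g) & set_eq (nonunits A) (ideal_gen A gs)]].

Definition quotient_field_is_F A := forall q, exists a b, [/\ A a, A b, b != 0 & q = a / b].

Definition localization A U : F -> Prop := fun q =>
  exists a s, [/\ A a, U s, s != 0 & q = a / s].
Definition loc_at A P : F -> Prop := localization A (fun s => A s /\ ~ P s).

Definition blowup A (y : F) : F -> Prop :=
  gen_ring (fun q => A q \/ exists z, nonunits A z /\ q = z / y).
Definition local_quadratic_transform A B := exists y,
  [/\ nonunits A y, ~ ideal_pow A (nonunits A) 2 y &
    exists Q, [/\ prime_ideal (blowup A y) Q, subset_of (nonunits A) Q &
                  set_eq B (loc_at (blowup A y) Q)]].

Definition mult_subset A U :=
  [/\ subset_of U A, U 1, ~ U 0 & forall a b, U a -> U b -> U (a * b)].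
Definition is_localization_of A B := exists U, mult_subset A U /\ set_eq B (localization A U).

Definition valuation_ring A := subring A /\ forall q, q != 0 -> A q \/ A q^-1.
Definition DVR A := [/\ valuation_ring A, noetherian A & exists a, nonunits A a /\ a != 0].

Definition noetherian_hull S : F -> Prop := fun q =>
  forall D, DVR D -> strict_subset S D -> D q.

Definition archimedean A := forall a, nonunits A a ->
  forall q, (forall n : nat, exists s, A s /\ q = a ^+ n * s) -> q = 0.

Definition complete_int_closure S : F -> Prop := fun t =>
  exists d, [/\ S d, d != 0 & forall q, adjoin S t q -> S (d * q)].

Definition primary_ideal A I := proper_ideal A I /\
  forall a b, A a -> A b -> I (a * b) -> I a \/ exists n : nat, I (b ^+ n).
Definition radical A I : F -> Prop := fun q => A q /\ exists n : nat, I (q ^+ n).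
Definition primary_to A I P := primary_ideal A I /\ set_eq (radical A I) P.
Definition principal A (x : F) : F -> Prop := fun q => exists s, A s /\ q = x * s.

(* ord_A(q) >= 0, i.e. q = a/b with ord_A(a) >= ord_A(b) *)
Definition ord_nonneg A (q : F) := exists a b, [/\ A a, A b, b != 0, q = a / b &
  forall n, ideal_pow A (nonunits A) n b -> ideal_pow A (nonunits A) n a].

Definition union_rings (Rs : nat -> F -> Prop) : F -> Prop := fun q => exists i, Rs i q.
Definition union_max (Rs : nat -> F -> Prop) : F -> Prop := fun q => exists i, nonunits (Rs i) q.
Definition boundary_val (Rs : nat -> F -> Prop) : F -> Prop := fun q =>
  exists i0, forall i, (i0 <= i)%N -> ord_nonneg (Rs i) q.

Definition height_one_prime A P := [/\ prime_ideal A P, (exists p, P p /\ p != 0) &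
  forall Q, prime_ideal A Q -> subset_of Q P -> set_eq Q (fun q => q = 0) \/ set_eq Q P].

End Defs.

(* Main.v *)
(** The order function of a regular local ring [A] is a valuation, and [A] is completely
    integrally closed: both rest on the independence of the monomials in a regular system of
    parameters modulo higher monomials, which holds because a relation would make the lengths
    of [A / m^n] grow too slowly for a chain of [dim A + 1] primes (Artin-Rees).

    Along the sequence, the order [ord_i] of a strict transform never increases, so the sign of
    [ord_i q] is eventually constant for every [q]; hence the boundary ring [V] is a valuation
    ring. As [xS] is [N]-primary, every exceptional parameter, and then [x] itself, becomes a
    product of later exceptional parameters, which yields [S = V /\ S[1/x]]; normality of the
    [R_i] gives [S^* <= S[1/x]], and the archimedean property gives [N S^* <= N].
    Therefore [theta] is eventually negative, elements of [S[theta]] are polynomials in [theta]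
    over the field [S/N] modulo [N], and the values of such polynomials are read off their
    degrees: [V] consists of the fractions of [W = S[theta]_N] of degree at most zero, and
    Euclidean division writes an element of [S^*] as a polynomial in [theta] plus an element
    of [V /\ S^* = S]. *)

(* Regularity is available only as an equality between a number of generators and the length of a
   prime chain, whereas the later steps need the associated graded ring to be a polynomial ring.
   Lengths are therefore counted by hand: a relation led by one monomial makes all its multiples
   redundant, which leaves $O(M^{d-1})$ monomials of degree below $M$; passing to the next prime of
   the chain lowers the exponent by one, and $d$ such steps from $d-1$ are impossible. The order
   cannot increase because a form of degree $r$ does not vanish to order $r+1$ at a point of the
   exceptional fibre: moving the point to the origin keeps the coefficients of top degree. No limit
   of $\mathrm{ord}_j(q)/\mathrm{ord}_j(x)$ is formed: every comparison is an inequality between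
   integers valid for all large $j$. This suffices because $\mathrm{ord}_j(\theta)<0$ eventually, so
   degrees decide the sign of a quotient of polynomials in $\theta$ with unit leading
   coefficients. *)
Require Import Defs.
From HB Require Import structures.
From mathcomp Require Import all_boot all_order all_algebra.
From mathcomp Require Import boolp mpoly zify ring.
Set Implicit Arguments. Unset Strict Implicit. Unset Printing Implicit Defensive.
Import Order.TTheory GRing.Theory Num.Theory.
Local Open Scope ring_scope.

(** * Subrings and ideals given by predicates *)

Section SubringLemmas.
Variables (F : fieldType) (A : F -> Prop) (hA : subring A).

Lemma sr0 : A 0. Proof. by case: hA. Qed.
Lemma sr1 : A 1. Proof. by case: hA. Qed.
Lemma srB a b : A a -> A b -> A (a - b). Proof. by case: hA => _ _ h _; apply: h. Qed.
Lemma srM a b : A a -> A b -> A (a * b). Proof. by case: hA => _ _ _ h; apply: h. Qed.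
Lemma srN a : A a -> A (- a). Proof. by move=> ha; rewrite -sub0r; apply: srB (sr0) ha. Qed.
Lemma srD a b : A a -> A b -> A (a + b).
Proof. by move=> ha hb; rewrite -(opprK b); apply: srB => //; apply: srN. Qed.
Lemma srX a n : A a -> A (a ^+ n).
Proof. by move=> ha; elim: n => [|n IH]; rewrite ?expr0 ?exprS; [exact: sr1|exact: srM]. Qed.
Lemma sr_sum (I : Type) (r : seq I) (P : pred I) (f : I -> F) :
  (forall i, P i -> A (f i)) -> A (\sum_(i <- r | P i) f i).
Proof. by move=> h; elim/big_ind: _ => //; [exact: sr0|exact: srD]. Qed.
Lemma sr_prod (I : Type) (r : seq I) (P : pred I) (f : I -> F) :
  (forall i, P i -> A (f i)) -> A (\prod_(i <- r | P i) f i).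
Proof. by move=> h; elim/big_ind: _ => //; [exact: sr1|exact: srM]. Qed.

Section OneIdeal.
Variables (I : F -> Prop) (hI : ideal A I).
Lemma idA a : I a -> A a. Proof. by case: hI => h _ _ _; apply: h. Qed.
Lemma id0 : I 0. Proof. by case: hI. Qed.
Lemma idB a b : I a -> I b -> I (a - b). Proof. by case: hI => _ _ h _; apply: h. Qed.
Lemma idM r a : A r -> I a -> I (r * a). Proof. by case: hI => _ _ _ h; apply: h. Qed.
Lemma idMr r a : A r -> I a -> I (a * r). Proof. by rewrite mulrC; apply: idM. Qed.
Lemma idN a : I a -> I (- a). Proof. by move=> ha; rewrite -sub0r; apply: idB => //; apply: id0. Qed.
Lemma idD a b : I a -> I b -> I (a + b).
Proof. by move=> ha hb; rewrite -(opprK b); apply: idB => //; apply: idN. Qed.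
Lemma id_sum (T : Type) (r : seq T) (P : pred T) (f : T -> F) :
  (forall i, P i -> I (f i)) -> I (\sum_(i <- r | P i) f i).
Proof. by move=> h; elim/big_ind: _ => //; [exact: id0|exact: idD]. Qed.
End OneIdeal.

Lemma ideal_self : ideal A A.
Proof. by split=> //; [exact: sr0|exact: srB|exact: srM]. Qed.

Lemma ideal_zero : ideal A (fun q => q = 0).
Proof.
split=> // [q ->|a b -> ->|r a _ ->]; [exact: sr0|exact: subr0|exact: mulr0].
Qed.

Lemma gen_ideal_ideal G : subset_of G A -> ideal A (gen_ideal A G).
Proof.
move=> hG; split.
- by move=> q /(_ _ ideal_self hG).
- by move=> I hI _; apply: id0 hI.
- by move=> a b ha hb I hI hGI; apply: (idB hI); [apply: ha|apply: hb].
- by move=> r a hr ha I hI hGI; apply: (idM hI) => //; apply: ha.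
Qed.

Lemma gen_ideal_in (G : F -> Prop) q : G q -> gen_ideal A G q.
Proof. by move=> hq I _ hGI; apply: hGI. Qed.

Definition adjoin_elt (I : F -> Prop) (z : F) : F -> Prop :=
  fun q => exists i a, [/\ I i, A a & q = i + a * z].

Definition ideal_sum (I J : F -> Prop) : F -> Prop :=
  fun q => exists i j, [/\ I i, J j & q = i + j].

Definition colon (I : F -> Prop) (x : F) : F -> Prop := fun z => A z /\ I (x * z).

Lemma adjoin_elt_ideal I z : ideal A I -> A z -> ideal A (adjoin_elt I z).
Proof.
move=> hI hz; split.
- by move=> q [i [a [hi ha ->]]]; apply: srD; [apply: (idA hI)|apply: srM].
- by exists 0, 0; rewrite mul0r addr0; split=> //; [apply: (id0 hI)|apply: sr0].
- move=> _ _ [i [a [hi ha ->]]] [j [b [hj hb ->]]]; exists (i - j), (a - b).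
  by split; [apply: (idB hI)|apply: srB|ring].
- move=> r _ hr [i [a [hi ha ->]]]; exists (r * i), (r * a).
  by split; [apply: (idM hI)|apply: srM|ring].
Qed.

Lemma adjoin_eltl I z q : I q -> adjoin_elt I z q.
Proof. by move=> hq; exists q, 0; split=> //; [apply: sr0|rewrite mul0r addr0]. Qed.

Lemma ideal_sum_ideal I J : ideal A I -> ideal A J -> ideal A (ideal_sum I J).
Proof.
move=> hI hJ; split.
- by move=> q [i [a [hi ha ->]]]; apply: srD; [apply: (idA hI)|apply: (idA hJ)].
- by exists 0, 0; rewrite addr0; split=> //; [apply: (id0 hI)|apply: (id0 hJ)].
- move=> _ _ [i [a [hi ha ->]]] [j [b [hj hb ->]]]; exists (i - j), (a - b).
  by split; [apply: (idB hI)|apply: (idB hJ)|ring].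
- move=> r _ hr [i [a [hi ha ->]]]; exists (r * i), (r * a).
  by split; [apply: (idM hI)|apply: (idM hJ)|ring].
Qed.

Lemma colon_ideal I x : ideal A I -> A x -> ideal A (colon I x).
Proof.
move=> hI hx; split.
- by move=> q [].
- by split; [apply: sr0|rewrite mulr0; apply: id0 hI].
- by move=> a b [ha ia] [hb ib]; split; [apply: srB|rewrite mulrBr; apply: (idB hI)].
- move=> r a hr [ha ia]; split; first exact: srM.
  by rewrite mulrCA; apply: (idM hI).
Qed.

Lemma noetherian_acc (J : nat -> F -> Prop) : noetherian A ->
  (forall n, ideal A (J n)) -> (forall n, subset_of (J n) (J n.+1)) ->
  exists n, forall k, subset_of (J k) (J n).
Proof.
move=> hN hJ hinc.
have hmono n k : (n <= k)%N -> subset_of (J n) (J k).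
  move/subnK <-; elim: (k - n)%N => [|j IH] q hq //; rewrite addSn.
  by apply: hinc; apply: IH.
have hU : ideal A (fun q => exists n, J n q).
  split.
  - by move=> q [n hq]; apply: (idA (hJ n)).
  - by exists 0%N; apply: (id0 (hJ _)).
  - move=> a b [n ha] [k hb]; exists (maxn n k); apply: (idB (hJ _)).
      by apply: hmono ha; rewrite leq_maxl.
    by apply: hmono hb; rewrite leq_maxr.
  - by move=> r a hr [n ha]; exists n; apply: (idM (hJ n)).
have [gs [hgs hgen]] := hN _ hU.
have [n hn] : exists n, forall g, g \in gs -> J n g.
  elim: gs hgs {hgen} => [|g gs IH] hgs; first by exists 0%N.
  have [n hn] : exists n, forall g, g \in gs -> J n g.
    by apply: IH => h hh; apply: hgs; rewrite inE hh orbT.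
  have [k hk] := hgs g (mem_head _ _).
  exists (maxn n k) => h; rewrite inE => /orP[/eqP->|hh].
    by apply: hmono hk; rewrite leq_maxr.
  by apply: hmono (hn _ hh); rewrite leq_maxl.
exists n => k q hq.
have /hgen [cs [hs hc ->]] : exists n, J n q by exists k.
apply: (id_sum (hJ n)) => i _; apply: (idM (hJ n)); first by apply: hc; rewrite mem_nth ?hs.
by apply: hn; rewrite mem_nth.
Qed.

(* [z_1, ..., z_n] is an element chain over [I] when each [z_k] avoids the ideal
   generated by [I] and its predecessors: a handy form of a strict chain of ideals. *)
Fixpoint elt_chain (I : F -> Prop) (zs : seq F) : Prop :=
  if zs is z :: zs' then [/\ A z, ~ I z & elt_chain (adjoin_elt I z) zs'] else True.

Lemma elt_chain_mono (I I' : F -> Prop) zs :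
  subset_of I I' -> elt_chain I' zs -> elt_chain I zs.
Proof.
elim: zs I I' => [|z zs IH] I I' hII' //= [hz hIz hc]; split=> //; first by move/hII'.
apply: IH hc => q [i [a [hi ha ->]]]; exists i, a; split=> //; exact: hII'.
Qed.

(** Lengths add up along $0\to A/(I:x)\to A/I\to A/(I+xA)\to 0$: multiplication by [x] carries the
    first chain into $A/I$, and its members all lie in $I+xA$, over which the second chain
    starts. *)
Lemma elt_chain_cat I x ws zs : ideal A I -> A x ->
  elt_chain (colon I x) ws -> elt_chain (adjoin_elt I x) zs ->
  elt_chain I ([seq x * w | w <- ws] ++ zs).
Proof.
move=> hI hx; elim: ws I hI => [|w ws IH] I hI /=.
  by move=> _; apply: elt_chain_mono => q; apply: adjoin_eltl.
move=> [hw hIw hc] hzs; split; first exact: srM.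
  by move=> h; apply: hIw.
have hxw : A (x * w) by exact: srM.
apply: IH; first exact: adjoin_elt_ideal.
- apply: elt_chain_mono hc => z [hz [i [a [hi ha e]]]].
  exists (z - a * w), a; split=> //; last by rewrite subrK.
  split; first by apply: srB => //; apply: srM.
  by have -> : x * (z - a * w) = i by rewrite mulrBr e; ring.
- apply: elt_chain_mono hzs => z [_ [b [[i [a [hi ha ->]]] hb ->]]].
  exists i, (a * w + b); split=> //; last by ring.
  by apply: srD => //; apply: srM.
Qed.

Lemma unit_of_notin u : A u -> ~ nonunits A u -> u != 0 /\ A u^-1.
Proof.
move=> hu hn; split; last by apply: contrapT => h; apply: hn; split; [|right].
by apply/eqP => e; apply: hn; split; [|left].
Qed.

Lemma notin_m1 : ~ nonunits A 1.
Proof.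
by case=> _ [/eqP|]; [rewrite oner_eq0|rewrite invr1; case; apply: sr1].
Qed.

End SubringLemmas.

(** * Monomials and their rank in the graded order *)

Section Rank.
Variable d : nat.
Implicit Types a b c : 'X_{1..d}.

(** The order compares total degrees first, so a monomial has only finitely many predecessors; its
    position [rank] turns the graded order into induction on natural numbers. *)
Definition below a : seq 'X_{1..d} :=
  [seq bmnm w | w <- enum {: 'X_{1..d < (mdeg a).+1}} & (bmnm w < a)%O].

Lemma mem_below a b : (b \in below a) = (b < a)%O.
Proof.
apply/mapP/idP => [[c]|hba]; first by rewrite mem_filter => /andP[h _] ->.
have hb : (mdeg b < (mdeg a).+1)%N by rewrite ltnS lemc_mdeg // ltW.
by exists (BMultinom hb) => //; rewrite mem_filter /= hba mem_enum.
Qed.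

Lemma below_uniq a : uniq (below a).
Proof.
rewrite map_inj_in_uniq; first by do 2!apply: filter_uniq; rewrite -enumT enum_uniq.
by move=> b c _ _ h; apply/val_inj.
Qed.

Definition rank a := size (below a).

Lemma rank_ltW a b : (a < b)%O -> (rank a < rank b)%N.
Proof.
move=> hab; rewrite -[X in (X <= _)%N]/(size (a :: below a)).
apply: uniq_leq_size; first by rewrite /= below_uniq mem_below ltxx.
move=> c; rewrite inE !mem_below => /orP[/eqP->//|h].
exact: lt_trans h hab.
Qed.

Lemma rank_lt a b : (rank a < rank b)%N = (a < b)%O.
Proof.
case: (ltgtP a b) => [/rank_ltW //|/rank_ltW h|->]; last by rewrite ltnn.
by rewrite ltnNge ltnW.
Qed.

Lemma rank_le a b : (rank a <= rank b)%N = (a <= b)%O.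
Proof. by rewrite leqNgt rank_lt leNgt. Qed.

Lemma rank_inj a b : rank a = rank b -> a = b.
Proof. by move=> h; apply/eqP; rewrite eq_le -!rank_le h leqnn. Qed.

Lemma rank_ltD a b c : (rank a < rank b)%N -> (rank (a + c)%MM < rank (b + c)%MM)%N.
Proof. by rewrite !rank_lt ltmc_add2l. Qed.

Lemma rank_mdeg_lt a b : (mdeg a < mdeg b)%N -> (rank a < rank b)%N.
Proof. by rewrite rank_lt; apply: lt_mdeg_ltmc. Qed.

Lemma rank_mdeg_le a b : (rank a <= rank b)%N -> (mdeg a <= mdeg b)%N.
Proof. by rewrite rank_le; apply: lemc_mdeg. Qed.

Lemma rank_bound M : exists K, forall a, (mdeg a < M)%N -> (rank a < K)%N.
Proof.
exists (\max_(w : 'X_{1..d < M}) rank w).+1 => a ha; rewrite ltnS.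
exact: (@leq_bigmax _ (fun w : 'X_{1..d < M} => rank w) (BMultinom ha)).
Qed.

Lemma mnm_sub_mdeg a n : (n <= mdeg a)%N -> exists b, (b <= a)%MM /\ mdeg b = n.
Proof.
elim: n => [|n IH] h; first by exists 0%MM; rewrite mdeg0; split=> //; apply/mnm_lepP=> i; rewrite mnm0E.
have [b [hb eb]] := IH (ltnW h).
have [i hi] : exists i, (b i < a i)%N.
  apply: contrapT => hn; suff /eqP e : b == a by rewrite -eb e ltnn in h.
  apply/eqP/mnmP => i; apply/eqP; rewrite eqn_leq (mnm_lepP hb i) /= leqNgt.
  by apply/negP => hi; apply: hn; exists i.
exists (b + U_(i))%MM; rewrite mdegD mdeg1 eb addn1; split=> //.
apply/mnm_lepP => j; rewrite mnmDE mnm1E.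
by case: eqP => [<-|_]; rewrite ?addn1 // addn0 (mnm_lepP hb j).
Qed.

Lemma nondecreasing_subseq (f : nat -> nat) :
  exists e : nat -> nat, (forall n, (e n < e n.+1)%N) /\ (forall n, (f (e n) <= f (e n.+1))%N).
Proof.
have hmin n : exists m, (n <= m)%N /\ forall l, (n <= l)%N -> (f m <= f l)%N.
  have [k] : exists k, exists2 m, (n <= m)%N & f m = k by exists (f n), n.
  elim/ltn_ind: k => k IH [m hm e].
  case: (EM (exists2 l, (n <= l)%N & (f l < k)%N)) => [[l hl hk]|hn].
    by apply: (IH (f l) hk); exists l.
  exists m; split=> // l hl; rewrite e leqNgt; apply/negP => h; apply: hn; by exists l.
have [h hh] := choice hmin.
pose e n := iter n (fun k => h k.+1) (h 0%N).
have hs n : (e n < e n.+1)%N by rewrite /e iterS; apply: (hh _).1.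
exists e; split=> // -[|n]; first by apply: (hh 0%N).2.
rewrite /e iterS; apply: (hh _).2; exact: leq_trans (hs n) (ltnW (hs n.+1)).
Qed.

Lemma strict_homo (e : nat -> nat) : (forall n, (e n < e n.+1)%N) ->
  forall i j, (i < j)%N -> (e i < e j)%N.
Proof.
move=> h i j; apply: (@homo_ltn _ e (fun x y => (x < y)%N)) => //.
by move=> ? ? ?; apply: ltn_trans.
Qed.

(** Nondecreasing subsequences are extracted one coordinate at a time; a later extraction preserves
    the coordinates already treated. *)
Lemma dickson (s : nat -> 'X_{1..d}) :
  exists e : nat -> nat, (forall n, (e n < e n.+1)%N) /\ (forall n, (s (e n) <= s (e n.+1))%MM).
Proof.
suff [e [he hm]] : exists e : nat -> nat, (forall n, (e n < e n.+1)%N) /\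
    forall i : 'I_d, i \in enum 'I_d -> forall n, (s (e n) i <= s (e n.+1) i)%N.
  by exists e; split=> // n; apply/mnm_lepP => i; apply: hm; rewrite mem_enum.
elim: (enum 'I_d) => [|i r [e [he hm]]]; first by exists id.
have [e' [he' hm']] := nondecreasing_subseq (fun n => s (e n) i).
exists (e \o e'); split=> [n|j]; first by apply: (strict_homo he); apply: he'.
rewrite inE => /orP[/eqP->|hj] n; first exact: hm'.
have hmono : {homo (fun n => s (e n) j) : x y / (x <= y)%N}.
  apply: (@homo_leq _ (fun n => s (e n) j) leq leqnn); last exact: (hm j hj).
  by move=> ? ? ?; apply: leq_trans.
by apply: hmono; apply: ltnW.
Qed.

End Rank.

(** * The filtration of a local ring by monomials in generators of its maximal ideal *)

Section MonomialFiltration.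
Variables (F : fieldType) (A : F -> Prop) (d : nat) (g : 'I_d -> F).
Hypotheses (hA : subring A) (hm : ideal A (nonunits A)) (hN : noetherian A).
Hypothesis hg : forall i, nonunits A (g i).
Hypothesis hgen : forall z, nonunits A z ->
  exists a : 'I_d -> F, (forall i, A (a i)) /\ z = \sum_i a i * g i.

Local Notation m := (nonunits A).
Implicit Types (P Q : 'X_{1..d} -> Prop) (a b c : 'X_{1..d}) (I J : F -> Prop).

Lemma unit_one_sub t : m t -> 1 - t != 0 /\ A (1 - t)^-1.
Proof.
move=> ht; apply: unit_of_notin; first by apply: (srB hA); [apply: sr1|case: ht].
by move=> h; apply: (notin_m1 hA); rewrite -(subrK t 1); apply: (idD hm).
Qed.

Lemma proper_ideal_sub_m I z : ideal A I -> ~ I 1 -> I z -> m z.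
Proof.
move=> hI h1 hz; apply: contrapT => hn.
have hAz := idA hI hz.
have [z0 hzV] := unit_of_notin hAz hn.
by apply: h1; rewrite -(mulVf z0); apply: (idM hI).
Qed.

Definition mon a : F := \prod_i g i ^+ a i.

Lemma monD a b : mon (a + b)%MM = mon a * mon b.
Proof. by rewrite /mon -big_split /=; apply: eq_bigr => i _; rewrite mnmDE exprD. Qed.

Lemma mon0 : mon 0%MM = 1.
Proof. by rewrite /mon big1 // => i _; rewrite mnm0E expr0. Qed.

Lemma mon1 i : mon U_(i)%MM = g i.
Proof.
rewrite /mon (bigD1 i) //= mnm1E eqxx expr1 big1 ?mulr1 // => j hj.
by rewrite mnm1E eq_sym (negPf hj) expr0.
Qed.

Lemma monA a : A (mon a).
Proof. by apply: (sr_prod hA) => i _; apply: (srX hA); case: (hg i). Qed.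

Definition monideal P : F -> Prop := gen_ideal A (fun q => exists b, P b /\ q = mon b).

Lemma monideal_ideal P : ideal A (monideal P).
Proof. by apply: (gen_ideal_ideal hA) => q [b [_ ->]]; apply: monA. Qed.

Lemma monideal_ind P I z : ideal A I -> (forall b, P b -> I (mon b)) -> monideal P z -> I z.
Proof. by move=> hI h; apply=> // q [b [hb ->]]; apply: h. Qed.

Lemma monideal_mon P b : P b -> monideal P (mon b).
Proof. by move=> hb; apply: gen_ideal_in; exists b. Qed.

Lemma monideal_mono P Q z : (forall b, P b -> Q b) -> monideal P z -> monideal Q z.
Proof. by move=> h; apply: monideal_ind; [apply: monideal_ideal|move=> b /h; apply: monideal_mon]. Qed.

Lemma monideal_mulmon P Q c z : (forall b, P b -> Q (b + c)%MM) -> monideal P z -> monideal Q (mon c * z).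
Proof.
move=> h hz; suff [] : colon A (monideal Q) (mon c) z by [].
apply: monideal_ind hz; first by apply: (colon_ideal hA); [apply: monideal_ideal|apply: monA].
move=> b hb; split; first exact: monA.
by rewrite mulrC -monD; apply: monideal_mon; apply: h.
Qed.

Lemma monideal_m_mon Q t b : m t -> (forall i, Q (b + U_(i))%MM) -> monideal Q (t * mon b).
Proof.
move=> /hgen [r [hr ->]] h; rewrite mulr_suml.
apply: (id_sum (monideal_ideal Q)) => i _; rewrite -mulrA; apply: (idM (monideal_ideal Q)) => //.
by rewrite mulrC -mon1 -monD; apply: monideal_mon.
Qed.

Definition monideal_ge P k : F -> Prop := monideal (fun b => P b /\ (k <= rank b)%N).

(** At most one monomial has a given rank, so the filtration loses one monomial at a time. This is
    the step of all inductions along the graded order. *)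
Lemma monideal_ge_step P k z : monideal_ge P k z ->
  (exists a u, [/\ P a, rank a = k, A u & monideal_ge P k.+1 (z - u * mon a)]) \/ monideal_ge P k.+1 z.
Proof.
move=> hz; case: (EM (exists a, P a /\ rank a = k)) => [[a [ha ea]]|hn].
  left; have [] : adjoin_elt A (monideal_ge P k.+1) (mon a) z.
    apply: monideal_ind hz; first by apply: (adjoin_elt_ideal hA); [apply: monideal_ideal|apply: monA].
    move=> b [hb]; rewrite leq_eqVlt => /orP[/eqP e|hk].
      have -> : b = a by apply: rank_inj; rewrite ea.
      by exists 0, 1; rewrite add0r mul1r; split=> //; [apply: (id0 (monideal_ideal _))|apply: sr1].
    by apply: (adjoin_eltl hA); apply: monideal_mon.
  move=> i [u [hi hu ->]]; exists a, u; split=> //; by rewrite addrK.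
right; apply: monideal_mono hz => b [hb]; rewrite leq_eqVlt => /orP[/eqP e|] //.
by case: hn; exists b.
Qed.

Definition monfil k : F -> Prop := monideal_ge (fun=> True) k.
Definition mpow n : F -> Prop := monideal (fun b => (n <= mdeg b)%N).

Lemma monfil_ideal k : ideal A (monfil k). Proof. exact: monideal_ideal. Qed.
Lemma mpow_ideal n : ideal A (mpow n). Proof. exact: monideal_ideal. Qed.

Lemma monfil_mono k l z : (l <= k)%N -> monfil k z -> monfil l z.
Proof. by move=> h; apply: monideal_mono => b [_ hb]; split=> //; apply: leq_trans hb. Qed.

Lemma mpow_mono k l z : (l <= k)%N -> mpow k z -> mpow l z.
Proof. by move=> h; apply: monideal_mono => b; apply: leq_trans. Qed.

Lemma monfil0 z : A z -> monfil 0 z.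
Proof.
by move=> hz; rewrite -(mulr1 z) -mon0; apply: (idM (monfil_ideal 0)) => //; apply: monideal_mon.
Qed.

Lemma mpow0 z : A z -> mpow 0 z.
Proof.
by move=> hz; rewrite -(mulr1 z) -mon0; apply: (idM (mpow_ideal 0)) => //; apply: monideal_mon.
Qed.

Lemma mpow_monfil n a z : (mdeg a < n)%N -> mpow n z -> monfil (rank a).+1 z.
Proof.
move=> h; apply: monideal_mono => b hb; split=> //.
by apply: rank_mdeg_lt; apply: leq_trans hb.
Qed.

Lemma monfil_mpow n : exists k, forall z, monfil k z -> mpow n z.
Proof.
have [K hK] := rank_bound d n; exists K => z; apply: monideal_mono => b [_ hb].
by rewrite leqNgt; apply/negP => /hK; rewrite ltnNge hb.
Qed.

Lemma monfil_rank_mpow a z : monfil (rank a) z -> mpow (mdeg a) z.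
Proof. by apply: monideal_mono => b [_]; apply: rank_mdeg_le. Qed.

Lemma m_mon_monfil t a : m t -> monfil (rank a).+1 (t * mon a).
Proof.
move=> ht; apply: monideal_m_mon ht _ => i; split=> //.
by apply: rank_mdeg_lt; rewrite mdegD mdeg1 addn1.
Qed.

Lemma monfil_mulmon a c z : monfil (rank a).+1 z -> monfil (rank (a + c)%MM).+1 (mon c * z).
Proof. by apply: monideal_mulmon => b [_ hb]; split=> //; apply: rank_ltD. Qed.

Lemma mpowM n k y z : mpow n y -> mpow k z -> mpow (n + k) (y * z).
Proof.
move=> hy hz.
have hAz := idA (mpow_ideal k) hz.
suff [] : colon A (mpow (n + k)) z y by rewrite mulrC.
apply: monideal_ind hy; first by apply: (colon_ideal hA); [apply: mpow_ideal|].
move=> b hb; split; first exact: monA.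
rewrite mulrC; apply: monideal_mulmon hz => c hc; rewrite mdegD addnC; exact: leq_add.
Qed.

Lemma mpow1 z : m z <-> mpow 1 z.
Proof.
split=> [|hz].
  by move=> hz; rewrite -(mulr1 z) -mon0; apply: monideal_m_mon hz _ => i; rewrite mdegD mdeg1 addn1.
apply: monideal_ind hz => // b hb.
have [c [hc ec]] := mnm_sub_mdeg hb.
move/eqP/mdeg1P: ec => [i /eqP ei]; rewrite -(submK hc) monD ei mon1.
by apply: (idM hm) => //; apply: monA.
Qed.

Lemma mpow_exact n z : mpow n z -> monideal (fun b => mdeg b = n) z.
Proof.
apply: monideal_ind; first exact: monideal_ideal.
move=> b hb; have [c [hc ec]] := mnm_sub_mdeg hb.
by rewrite -(submK hc) monD; apply: (idM (monideal_ideal _)); [apply: monA|apply: monideal_mon].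
Qed.

Lemma ideal_pow_mpow n z : ideal_pow A m n z <-> mpow n z.
Proof.
split.
  apply; first exact: mpow_ideal.
  move=> _ [s [<- hs ->]]; elim: s hs => [|y s IH] hs.
    by rewrite big_nil; apply: mpow0; apply: sr1.
  rewrite big_cons -[size _]add1n; apply: mpowM.
    by apply/mpow1; apply: hs; rewrite mem_head.
  by apply: IH => t ht; apply: hs; rewrite inE ht orbT.
move/mpow_exact => hz J hJ hGJ; apply: monideal_ind hz => // b hb; apply: hGJ.
exists (flatten [seq nseq (b i) (g i) | i <- enum 'I_d]); split.
- rewrite size_flatten /shape -map_comp sumnE big_map -hb mdegE big_enum /=.
  by apply: eq_bigr => i _; rewrite size_nseq.
- move=> t /flattenP [s /mapP [i _ ->]]; rewrite mem_nseq => /andP[_ /eqP->]; exact: hg.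
- rewrite big_flatten big_map big_enum /=; apply: eq_bigr => i _.
  by rewrite big_nseq iter_mulr_1.
Qed.

(** * Artin-Rees and Krull's intersection theorem *)

Lemma monotone_ideals_finite (J : 'X_{1..d} -> F -> Prop) :
  (forall a, ideal A (J a)) -> (forall a c, subset_of (J a) (J (a + c)%MM)) ->
  exists K, forall a, exists b, [/\ (b <= a)%MM, (mdeg b <= K)%N & subset_of (J a) (J b)].
Proof.
move=> hJ hinc; apply: contrapT => hn.
have hs K : exists a, forall b, (b <= a)%MM -> (mdeg b <= K)%N -> ~ subset_of (J a) (J b).
  apply: contrapT => hK; apply: hn; exists K => a; apply: contrapT => ha.
  by apply: hK; exists a => b hb hbK hs; apply: ha; exists b.
have [s {}hs] := choice hs.
(* A running maximum of degrees: for $i<j$ the monomial [s (K i)] has degree at most [K j], so it is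
   an admissible divisor for [s (K j)]. Along Dickson's subsequence the ideals increase, hence
   become stationary, against the choice of [s]. *)
pose K n := iter n (fun k => maxn k (mdeg (s k))) 0%N.
have hK i j : (i < j)%N -> (mdeg (s (K i)) <= K j)%N.
  elim: j => // j IH; rewrite ltnS leq_eqVlt => /orP[/eqP->|/IH h].
    by rewrite /= leq_maxr.
  by apply: leq_trans h _; rewrite /= leq_maxl.
have [e [he hle]] := dickson (fun n => s (K n)).
have [|n hn'] := @noetherian_acc _ _ (fun n => J (s (K (e n)))) hN (fun n => hJ _).
  by move=> n /= q hq; rewrite -(submK (hle n)) addmC; apply: hinc.
apply: (hs (K (e n.+1)) (s (K (e n)))) => //; first exact: hK.
Qed.

(* Artin-Rees, uniformly in [K]: the ideals of leading coefficients of the forms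
   whose value lies in [I] grow with the monomial, so finitely many of them suffice. *)
Lemma artin_rees I : ideal A I -> exists c : nat, forall M K, ideal A K ->
  (forall u i, mpow M u -> I i -> K (u * i)) ->
  forall z, I z -> mpow (M + c) z -> K z.
Proof.
move=> hI.
pose H a := monideal (fun b => mdeg b = mdeg a /\ (rank a < rank b)%N).
pose lc a : F -> Prop := fun u => A u /\ exists h, H a h /\ I (u * mon a + h).
have hH a : ideal A (H a) by exact: monideal_ideal.
have hlc a : ideal A (lc a).
  split.
  - by move=> q [].
  - split; first exact: sr0.
    by exists 0; rewrite mul0r addr0; split; [apply: (id0 (hH a))|apply: (id0 hI)].
  - move=> u v [hu [h [hh hi]]] [hv [h' [hh' hi']]]; split; first exact: srB.
    exists (h - h'); split; first exact: (idB (hH a)).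
    have -> : (u - v) * mon a + (h - h') = (u * mon a + h) - (v * mon a + h') by ring.
    exact: (idB hI).
  - move=> r u hr [hu [h [hh hi]]]; split; first exact: srM.
    exists (r * h); split; first exact: (idM (hH a)).
    by rewrite -mulrA -mulrDr; apply: (idM hI).
have hinc a c : subset_of (lc a) (lc (a + c)%MM).
  move=> u [hu [h [hh hi]]]; split=> //; exists (mon c * h); split.
    by apply: monideal_mulmon hh => b [e hb]; rewrite !mdegD e; split=> //; apply: rank_ltD.
  have -> : u * mon (a + c) + mon c * h = mon c * (u * mon a + h) by rewrite monD; ring.
  by apply: (idM hI) => //; apply: monA.
have [c0 hc0] := monotone_ideals_finite hlc hinc.
exists c0 => M K hK hKI z hz hzM.
(* All monomials of degree $M+c_0$ have rank below [R]; their terms are removed in increasing rank,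
   and [j] counts the ranks left. *)
have [R hR] := rank_bound d (M + c0).+1.
have hz0 : monideal_ge (fun b => mdeg b = (M + c0)%N) 0 z.
  by apply: monideal_mono (mpow_exact hzM).
move: {hzM} z hz hz0.
suff H1 j : forall k z, (R - k = j)%N -> I z -> monideal_ge (fun b => mdeg b = (M + c0)%N) k z -> K z.
  by move=> z; apply: (H1 R); rewrite subn0.
elim: j => [|j IH] k z hj hz hzk.
  suff -> : z = 0 by apply: id0 hK.
  apply: (monideal_ind (ideal_zero hA) _ hzk).
  by move=> b [eb hb]; have := hR b; rewrite eb ltnS leqnn => /(_ isT); lia.
have [[a [u [ha ea hu hzu]]]|] := monideal_ge_step hzk; last by apply: IH => //; lia.
have [b [hba hbc /(_ u) hb]] := hc0 a.
have hlu : lc a u.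
  split=> //; exists (z - u * mon a); rewrite (addrC (u * mon a)) subrK; split=> //.
  by apply: monideal_mono hzu => b' [-> h]; rewrite ha ea.
have [_ [h [hh hi]]] := hb hlu.
(* The leading coefficient at [a] already occurs at a divisor [b] of degree at most [c0], so the
   cofactor [c] has degree at least [M], which puts [w] in [K]. *)
pose c := (a - b)%MM; have ec : a = (b + c)%MM by rewrite addmC submK.
pose w := mon c * (u * mon b + h).
have hKw : K w.
  apply: hKI => //; apply: monideal_mon.
  by have := congr1 mdeg ec; rewrite mdegD ha; lia.
have hcA := monA c.
rewrite -(subrK w z); apply: (idD hK) => //.
apply: (IH k.+1); first by lia.
  by apply: (idB hI) => //; apply: (idM hI).
have -> : z - w = (z - u * mon a) - mon c * h by rewrite /w ec monD; ring.
apply: (idB (monideal_ideal _)) => //; rewrite -ea.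
apply: monideal_mulmon hh => b' [e hb']; rewrite ec; split; last exact: rank_ltD.
by rewrite mdegD e -mdegD -ec.
Qed.

(** Artin-Rees with $M=1$ for $I=J+Az$ and $K=J+\mathfrak m z$ gives $z\in J+\mathfrak m z$, and
    $1-t$ is a unit for $t\in\mathfrak m$. *)
Lemma krull_closed J z : ideal A J -> A z ->
  (forall M, ideal_sum J (mpow M) z) -> J z.
Proof.
move=> hJ hz hM.
have hI := adjoin_elt_ideal hA hJ hz.
have [c hc] := artin_rees hI.
pose K : F -> Prop := fun q => exists j t, [/\ J j, m t & q = j + t * z].
have hK : ideal A K.
  split.
  - move=> q [j [t [hj [ht _] ->]]]; apply: (srD hA); [exact: (idA hJ)|exact: srM].
  - by exists 0, 0; rewrite mul0r addr0; split=> //; [apply: (id0 hJ)|apply: (id0 hm)].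
  - move=> _ _ [j [t [hj ht ->]]] [j' [t' [hj' ht' ->]]]; exists (j - j'), (t - t').
    by split; [apply: (idB hJ)|apply: (idB hm)|ring].
  - move=> r _ hr [j [t [hj ht ->]]]; exists (r * j), (r * t).
    by split; [apply: (idM hJ)|apply: (idM hm)|ring].
have [j [w [hj hw e]]] := hM (1 + c)%N.
have [] : K w.
  apply: (hc 1%N K) hw => //.
    move=> u _ /mpow1 hu [i [a [hi ha ->]]]; exists (u * i), (u * a); split; last by ring.
      by apply: (idM hJ) => //; case: hu.
    by rewrite mulrC; apply: (idM hm).
  exists (- j), 1; split; [exact: (idN hJ)|exact: sr1|by rewrite e; ring].
move=> j' [t [hj' ht ew]].
have [t0 htV] := unit_one_sub ht.
have -> : z = (1 - t)^-1 * (j + j').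
  have -> : j + j' = (1 - t) * z by rewrite mulrBl mul1r {1}e ew; ring.
  by rewrite mulKf.
by apply: (idM hJ) => //; apply: (idD hJ).
Qed.

Lemma mpow_inter0 z : A z -> (forall M, mpow M z) -> z = 0.
Proof.
move=> hz h; apply: (krull_closed (ideal_zero hA) hz) => M.
exists 0, z; by rewrite add0r.
Qed.

(** * Growth of lengths and independence of the monomials *)

Lemma card_ffun_lt (M c : nat) (i : 'I_d) :
  (#|[set f : {ffun 'I_d -> 'I_M} | (f i < c)%N]| <= c * M ^ d.-1)%N.
Proof.
pose D (j : 'I_d) : pred 'I_M := if j == i then [pred x : 'I_M | (x < c)%N] else predT.
have -> : #|[set f : {ffun 'I_d -> 'I_M} | (f i < c)%N]| = #|family D|.
  apply: eq_card => f; rewrite inE; apply/idP/familyP => [h j|/(_ i)].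
    by rewrite /D; case: eqP => [->|_].
  by rewrite /D eqxx.
rewrite card_family foldrE big_map big_enum /= (bigD1 i) //=.
apply: leq_mul.
  rewrite /D eqxx.
  pose h (x : 'I_M) : 'I_c.+1 := inord x.
  have hinj : {in [pred x : 'I_M | (x < c)%N] &, injective h}.
    move=> x y; rewrite !inE => hx hy /(congr1 val).
    by rewrite /h /= (inordK (ltnW hx)) (inordK (ltnW hy)); apply: val_inj.
  rewrite -(card_in_image hinj).
  apply: (@leq_trans #|[pred x : 'I_c.+1 | (x != ord_max)]|).
    apply/subset_leq_card/subsetP => y /imageP [x]; rewrite !inE => hx ->.
    by apply/eqP => /(congr1 val); rewrite /= (inordK (ltnW hx)) => e; rewrite e ltnn in hx.
  by rewrite cardC1 card_ord.
rewrite (eq_bigr (fun=> M)).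
  by rewrite prod_nat_const leq_eqVlt (_ : #|_| = d.-1) ?eqxx // cardC1 card_ord.
by move=> j hj; rewrite /D (negPf hj) card_ord.
Qed.

(** Some exponent of a nonmultiple is below that of [a0]. If it is the $i$-th, there are at most
    $a_0(i)$ values for it and $M$ for each of the other $d-1$; summing over $i$ gives [mdeg a0]. *)
Lemma card_nonmultiples a0 M :
  (#|[set b : 'X_{1..d < M} | ~~ (a0 <= b)%MM]| <= mdeg a0 * M ^ d.-1)%N.
Proof.
case: M => [|M]; first by rewrite eq_card0 // => b; have := bmdeg b.
pose f (b : 'X_{1..d < M.+1}) : {ffun 'I_d -> 'I_M.+1} := [ffun i => inord (b i)].
have hlt (b : 'X_{1..d < M.+1}) i : (b i < M.+1)%N.
  by apply: leq_ltn_trans (bmdeg b); rewrite mdegE (bigD1 i) //= leq_addr.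
have hinj : injective f.
  move=> b c e; apply/val_inj/mnmP => i /=.
  by move/ffunP: e => /(_ i) /(congr1 val); rewrite !ffunE /= !inordK.
rewrite -(card_imset _ hinj).
apply: (@leq_trans #|\bigcup_i [set h : {ffun 'I_d -> 'I_M.+1} | (h i < a0 i)%N]|).
  apply/subset_leq_card/subsetP => _ /imsetP [b hb ->]; rewrite inE in hb.
  apply/bigcupP; case: (pickP [pred i | (b i < a0 i)%N]) => [i hi|hn].
    by exists i => //; rewrite inE ffunE inordK.
  by case/negP: hb; apply/mnm_lepP => i; rewrite leqNgt; have /= -> := hn i.
have hU : (#|\bigcup_i [set h : {ffun 'I_d -> 'I_M.+1} | (h i < a0 i)%N]| <=
    \sum_i #|[set h : {ffun 'I_d -> 'I_M.+1} | (h i < a0 i)%N]|)%N.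
  elim/big_rec2: _ => [|i n B _ h]; first by rewrite cards0.
  by apply: leq_trans (leq_add (leqnn _) h); rewrite cardsU leq_subr.
apply: leq_trans hU _.
rewrite mdegE big_distrl /=; apply: leq_sum => i _; exact: card_ffun_lt.
Qed.

Section Relation.
Variable a0 : 'X_{1..d}.
Hypothesis ha0 : monfil (rank a0).+1 (mon a0).

Lemma mon_multiple b : (a0 <= b)%MM -> monfil (rank b).+1 (mon b).
Proof.
by move=> h; rewrite -(submK h) addmC monD mulrC; apply: monfil_mulmon.
Qed.

Variable M : nat.

(** Initial monomials of [J], multiples of [a0] left out. Under the relation [ha0] they determine an
    ideal containing $\mathfrak m^M$, so strict growth of such an ideal is strict growth of a finite
    set. *)
Definition leading_set J : {set 'X_{1..d < M}} :=
  [set b : 'X_{1..d < M} |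
     ~~ (a0 <= b)%MM && `[< ideal_sum J (monfil (rank b).+1) (mon b) >]].

Lemma leading_set_sub J J' : subset_of J J' -> leading_set J \subset leading_set J'.
Proof.
move=> h; apply/subsetP => b; rewrite !inE => /andP[-> /asboolP [i [j [hi hj e]]]] /=.
by apply/asboolP; exists i, j; split=> //; apply: h.
Qed.

(** The term of least rank can always be moved to higher rank: a coefficient in the maximal ideal
    raises the degree, a multiple of [a0] is rewritten by the relation, and another monomial of
    degree below [M] is the initial monomial of an element of [J]. In degree at least [M] the whole
    element is already in [J]. *)
Lemma leading_set_eq J J' : ideal A J -> ideal A J' -> subset_of J J' ->
  (forall z, mpow M z -> J z) -> leading_set J' \subset leading_set J -> subset_of J' J.
Proof.
move=> hJ hJ' hsub hM hlead.
have [R hR] := monfil_mpow M.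
suff H j : forall k z, (R - k = j)%N -> J' z -> monfil k z -> J z.
  move=> z hz; apply: (H R 0%N) => //; first by rewrite subn0.
  by apply: monfil0; apply: (idA hJ').
elim: j => [|j IH] k z hj hz hzk.
  by apply: hM; apply: hR; apply: (@monfil_mono k R z _ hzk); lia.
have [[b [u [_ eb hu hzu]]]|] := monideal_ge_step hzk; last by apply: IH => //; lia.
have hnext : monfil k.+1 z -> J z by apply: IH => //; lia.
case: (EM (m u)) => [hmu|hnu].
  apply: hnext; rewrite -(subrK (u * mon b) z).
  by apply: (idD (monfil_ideal _)) => //; rewrite -eb; apply: m_mon_monfil.
have [u0 huV] := unit_of_notin hu hnu.
case hmult: (a0 <= b)%MM.
  apply: hnext; rewrite -(subrK (u * mon b) z).
  apply: (idD (monfil_ideal _)) => //; rewrite -eb; apply: (idM (monfil_ideal _)) => //.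
  exact: mon_multiple.
case: (ltnP (mdeg b) M) => hbM; last first.
  apply: hM; apply: (mpow_mono hbM); apply: monfil_rank_mpow; by rewrite eb.
have : BMultinom hbM \in leading_set J'.
  rewrite inE hmult /=; apply/asboolP.
  exists (u^-1 * z), (- (u^-1 * (z - u * mon b))); split.
  - exact: (idM hJ').
  - by rewrite eb; apply: (idN (monfil_ideal _)); apply: (idM (monfil_ideal _)).
  - by rewrite mulrBr mulKf // opprB addrC subrK.
move/(subsetP hlead); rewrite inE hmult /= => /asboolP [i [e [hi he em]]].
rewrite -(subrK (u * i) z); apply: (idD hJ); last exact: (idM hJ).
apply: (IH k.+1); first by lia.
  by apply: (idB hJ') => //; apply: (idM hJ') => //; apply: hsub.
have -> : z - u * i = (z - u * mon b) + u * e by rewrite em; ring.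
by apply: (idD (monfil_ideal _)) => //; apply: (idM (monfil_ideal _)) => //; rewrite -eb.
Qed.

Lemma elt_chain_bound J zs : ideal A J -> (forall z, mpow M z -> J z) ->
  elt_chain A J zs -> (size zs <= mdeg a0 * M ^ d.-1)%N.
Proof.
move=> hJ hM hc; apply: leq_trans (card_nonmultiples a0 M).
suff h : (size zs + #|leading_set J| <= #|[set b : 'X_{1..d < M} | ~~ (a0 <= b)%MM]|)%N.
  by apply: leq_trans h; apply: leq_addr.
elim: zs J hJ hM hc => [|z zs IH] J hJ hM /=.
  by move=> _; apply/subset_leq_card/subsetP => b; rewrite !inE => /andP[].
move=> [hz hJz hc].
have hJ' := adjoin_elt_ideal hA hJ hz.
have hsub : subset_of J (adjoin_elt A J z) by move=> q; apply: adjoin_eltl.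
apply: leq_trans (IH _ hJ' (fun q hq => hsub _ (hM q hq)) hc).
rewrite addSn -addnS leq_add2l; apply: proper_card.
rewrite properE leading_set_sub //=; apply/negP => hle.
apply: hJz; apply: (leading_set_eq hJ hJ' hsub hM hle).
by exists 0, 1; rewrite add0r mul1r; split=> //; [apply: (id0 hJ)|apply: sr1].
Qed.

End Relation.

(** Stands for the Hilbert-Samuel polynomial of $A/P$ having degree at most [k]: element chains
    measure the length of $A/(P+\mathfrak m^M)$. *)
Definition growth_le (P : F -> Prop) (C k : nat) := forall M zs, (0 < M)%N ->
  elt_chain A (ideal_sum P (mpow M)) zs -> (size zs <= C * M ^ k)%N.

(** Since [x] is a nonzerodivisor modulo [P], Artin-Rees gives $(P+\mathfrak m^{M+c}):x\subseteq
    P+\mathfrak m^M$. Each multiplication by [x] thus adds one more copy of [zs] at a bounded cost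
    in the exponent. *)
Lemma growth_chain (P : F -> Prop) x : prime_ideal A P -> A x -> ~ P x ->
  exists c : nat, (0 < c)%N /\ forall M zs, elt_chain A (ideal_sum (adjoin_elt A P x) (mpow M)) zs ->
    forall i, exists ws, elt_chain A (ideal_sum P (mpow (c * (M + i)))) ws /\
                         size ws = (i * size zs)%N.
Proof.
move=> [[hP _] hprime] hx hPx.
have hPxI := adjoin_elt_ideal hA hP hx.
have [c hc] := artin_rees hPxI.
have hcolon M z : colon A (ideal_sum P (mpow (M + c))) x z -> ideal_sum P (mpow M) z.
  move=> [hz [p [w [hp hw e]]]].
  have [|||] := hc M (fun q => exists p' w', [/\ P p', mpow M w' & q = p' + x * w']) _ _ w _ hw.
  - split.
    + move=> _ [p' [w' [hp' hw' ->]]]; apply: (srD hA); first exact: (idA hP).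
      by apply: (srM hA) => //; apply: (idA (mpow_ideal M)).
    + by exists 0, 0; rewrite mulr0 addr0; split=> //; [apply: (id0 hP)|apply: (id0 (mpow_ideal M))].
    + move=> _ _ [p1 [w1 [hp1 hw1 ->]]] [p2 [w2 [hp2 hw2 ->]]]; exists (p1 - p2), (w1 - w2).
      by split; [apply: (idB hP)|apply: (idB (mpow_ideal M))|ring].
    + move=> r _ hr [p1 [w1 [hp1 hw1 ->]]]; exists (r * p1), (r * w1).
      by split; [apply: (idM hP)|apply: (idM (mpow_ideal M))|ring].
  - move=> u _ hu [i [b [hi hb ->]]]; exists (u * i), (b * u); split; last by ring.
      by apply: (idM hP) => //; apply: (idA (mpow_ideal M)).
    exact: (idM (mpow_ideal M)).
  - by exists (- p), z; split=> //; [apply: (idN hP)|rewrite mulrC e; ring].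
  move=> p' [w' [hp' hw' ew]].
  have hAw := idA (mpow_ideal M) hw'.
  have : P (x * (z - w')).
    have -> : x * (z - w') = p + p' by rewrite mulrBr e ew; ring.
    exact: (idD hP).
  case/hprime => // [|h]; first exact: srB.
  by exists (z - w'), w'; rewrite subrK.
exists c.+1; split=> // M zs hzs; elim=> [|i [ws [hws es]]].
  by exists [::]; rewrite mul0n.
exists ([seq x * w | w <- ws] ++ zs); split; last by rewrite size_cat size_map es mulSn addnC.
apply: (elt_chain_cat hA) => //; first by apply: (ideal_sum_ideal hA) => //; apply: mpow_ideal.
  apply: elt_chain_mono hws => z [hz [p [w [hp hw e]]]]; apply: hcolon; split=> //.
  exists p, w; split=> //; apply: (mpow_mono _ hw); lia.
apply: elt_chain_mono hzs => _ [_ [b [[p [w [hp hw ->]]] hb ->]]].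
exists (p + b * x), w; split; last by ring.
  by exists p, b.
apply: (mpow_mono _ hw); lia.
Qed.

(** With $i=M$ copies, [growth_chain] bounds $M$ times the length by $C(2cM)^k$; dividing by $M$
    lowers the exponent. Exponent $0$ is excluded because the chain $[1]$ over the proper ideal
    $P'+\mathfrak m$ can be repeated $C+1$ times. *)
Lemma growth_descent (P P' : F -> Prop) C k : prime_ideal A P -> prime_ideal A P' ->
  strict_subset P P' -> growth_le P C k -> exists C', (0 < k)%N /\ growth_le P' C' k.-1.
Proof.
move=> hP [[hP' hP'1] _] [hsub [x [hx hPx]]] hgr.
have hAx := idA hP' hx.
have [c [c0 hc]] := growth_chain hP hAx hPx.
have hch M zs : elt_chain A (ideal_sum P' (mpow M)) zs -> forall i,
    (0 < M)%N -> (i * size zs <= C * (c * (M + i)) ^ k)%N.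
  move=> hzs i hM; have [|ws [hws <-]] := hc M zs _ i.
    apply: elt_chain_mono hzs => _ [_ [w [[p [b [hp hb ->]]] hw ->]]].
    exists (p + b * x), w; split=> //.
    by apply: (idD hP'); [apply: hsub|apply: (idM hP')].
  by apply: hgr hws; rewrite muln_gt0 c0 addn_gt0 hM.
have k0 : (0 < k)%N.
  case: k hgr hch => // hgr hch; have [] : elt_chain A (ideal_sum P' (mpow 1)) [:: 1].
    split=> //; first exact: sr1.
    move=> [p [w [hp /mpow1 hw e]]]; apply: (notin_m1 hA); rewrite e.
    by apply: (idD hm) => //; apply: proper_ideal_sub_m hp.
  move=> h1 h2 _; have := hch 1%N [:: 1] (And3 h1 h2 I) C.+1 isT; rewrite expn0 /=; lia.
exists (C * (2 * c) ^ k)%N; split=> // M zs hM hzs.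
have := hch M zs hzs M hM.
rewrite addnn -mul2n mulnCA mulnA expnMn.
case: k k0 {hgr hch} => // k _; rewrite [(M ^ _)%N]expnS /= => h.
rewrite -(leq_pmul2l hM); apply: leq_trans h _; rewrite leq_eqVlt; apply/orP; left; apply/eqP.
by rewrite [(_ * c)%N]mulnC; ring.
Qed.

Lemma monomial_independent (hd : (0 < d)%N) : prime_chain A d ->
  forall a, ~ monfil (rank a).+1 (mon a).
Proof.
move=> [P [hP hstrict]] a0 ha0.
(* At $k=d-1$ the exponent is $0$, which leaves no room for the last prime [P d]. *)
have h k : (k < d)%N -> exists C, growth_le (P k) C (d.-1 - k).
  elim: k => [|k IH] hk.
    exists (mdeg a0) => M zs hM hzs; rewrite subn0.
    have [[hP0 _] _] := hP 0%N isT.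
    apply: elt_chain_bound hzs => //; first by apply: (ideal_sum_ideal hA) => //; apply: mpow_ideal.
    by move=> z hz; exists 0, z; rewrite add0r; split=> //; apply: (id0 hP0).
  have [C hC] := IH (ltnW hk).
  have [C' [_ hC']] := growth_descent (hP k (ltnW (ltnW hk))) (hP k.+1 (ltnW hk))
    (hstrict k (ltnW hk)) hC.
  by exists C'; rewrite subnS.
have hd1 : (d.-1 < d)%N by rewrite prednK.
have [C hC] := h d.-1 hd1.
have [C' [hk _]] := growth_descent (hP _ (ltnW hd1)) (hP _ hd1) (hstrict _ hd1) hC.
by rewrite subnn in hk.
Qed.

Lemma nat_switch (P : nat -> Prop) : P 0%N -> ~ (forall k, P k) -> exists k, P k /\ ~ P k.+1.
Proof.
move=> h0 hn; apply: contrapT => h; apply: hn; elim=> // k IH.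
by apply: contrapT => h'; apply: h; exists k.
Qed.

(** * Trailing monomials, the order, and prime ideals generated by parameters *)

Section Independent.
Hypothesis hG : forall a, ~ monfil (rank a).+1 (mon a).

(* The trailing monomial [a] of [z] behaves like the value of a valuation. *)
Definition trail z a := exists u, [/\ A u, ~ m u & monfil (rank a).+1 (z - u * mon a)].

Lemma trail_notin z a : trail z a -> ~ monfil (rank a).+1 z.
Proof.
move=> [u [hu hn hz]] hz'; have [u0 huV] := unit_of_notin hu hn.
apply: (hG (a := a)); have -> : mon a = u^-1 * (z - (z - u * mon a)).
  by rewrite opprB addrC subrK mulKf.
by apply: (idM (monfil_ideal _)) => //; apply: (idB (monfil_ideal _)).
Qed.

Lemma trail_in z a : trail z a -> monfil (rank a) z.
Proof.
move=> [u [hu hn hz]]; rewrite -(subrK (u * mon a) z).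
apply: (idD (monfil_ideal _)); first by apply: (monfil_mono _ hz).
by apply: (idM (monfil_ideal _)) => //; apply: monideal_mon.
Qed.

Lemma trail_exists z : A z -> z != 0 -> exists a, trail z a.
Proof.
move=> hz /eqP z0; have [||k [hk hk1]] := @nat_switch (fun k => monfil k z).
- exact: monfil0.
- move=> h; apply: z0; apply: mpow_inter0 => // M.
  by have [k hk] := monfil_mpow M; apply: hk.
have [[a [u [_ ea hu hzu]]]|//] := monideal_ge_step hk.
exists a, u; rewrite ea; split=> // hmu; apply: hk1.
rewrite -(subrK (u * mon a) z); apply: (idD (monfil_ideal _)) => //.
by rewrite -ea; apply: m_mon_monfil.
Qed.

Lemma monfil_mul_gt a b y z : monfil (rank a).+1 y -> monfil (rank b) z ->
  monfil (rank (a + b)%MM).+1 (y * z).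
Proof.
move=> hy hz; have hAz := idA (monfil_ideal _) hz.
suff [] : colon A (monfil (rank (a + b)%MM).+1) z y by rewrite mulrC.
apply: monideal_ind hy; first by apply: (colon_ideal hA); [apply: monfil_ideal|].
move=> c [_ hc]; split; first exact: monA.
rewrite mulrC; apply: monideal_mulmon hz => e [_ he]; split=> //.
apply: (leq_trans (rank_ltD b hc)).
by rewrite (addmC e c) rank_le lemc_add2r -rank_le.
Qed.

Lemma trailM y z a b : trail y a -> trail z b -> trail (y * z) (a + b)%MM.
Proof.
move=> hy hz; have hzb := trail_in hz.
move: hy hz => [u [hu hn hy]] [v [hv hnv hz]].
have [u0 huV] := unit_of_notin hu hn; have [v0 hvV] := unit_of_notin hv hnv.
exists (u * v); split; first exact: srM.
  case=> _ [/eqP|]; first by rewrite mulf_eq0 (negPf u0) (negPf v0).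
  by rewrite invfM; case; apply: srM.
have -> : y * z - u * v * mon (a + b) =
    (y - u * mon a) * z + u * (mon a * (z - v * mon b)) by rewrite monD; ring.
apply: (idD (monfil_ideal _)); first exact: monfil_mul_gt.
by apply: (idM (monfil_ideal _)) => //; rewrite addmC; apply: monfil_mulmon.
Qed.

Lemma trail_mdeg z a : trail z a -> mpow (mdeg a) z /\ ~ mpow (mdeg a).+1 z.
Proof.
move=> h; split; first by apply: monfil_rank_mpow; apply: trail_in.
by move=> hz; apply: (trail_notin h); apply: mpow_monfil hz.
Qed.

Lemma order_exists z : A z -> z != 0 -> exists r, mpow r z /\ ~ mpow r.+1 z.
Proof. by move=> hz z0; have [a /trail_mdeg] := trail_exists hz z0; exists (mdeg a). Qed.

Lemma order_unique z r s : mpow r z -> ~ mpow r.+1 z -> mpow s z -> ~ mpow s.+1 z -> r = s.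
Proof.
move=> h1 h2 h3 h4; case: (ltngtP r s) => // h.
- by case: h2; apply: (mpow_mono h).
- by case: h4; apply: (mpow_mono h).
Qed.

Lemma orderM y z r s : A y -> A z -> mpow r y -> ~ mpow r.+1 y -> mpow s z -> ~ mpow s.+1 z ->
  ~ mpow (r + s).+1 (y * z).
Proof.
move=> hy hz h1 h2 h3 h4.
have y0 : y != 0 by apply/eqP => e; apply: h2; rewrite e; apply: (id0 (mpow_ideal _)).
have z0 : z != 0 by apply/eqP => e; apply: h4; rewrite e; apply: (id0 (mpow_ideal _)).
have [a ha] := trail_exists hy y0; have [b hb] := trail_exists hz z0.
have [k1 k2] := trail_mdeg ha; have [k3 k4] := trail_mdeg hb.
rewrite (order_unique h1 h2 k1 k2) (order_unique h3 h4 k3 k4) -mdegD.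
by have [] := trail_mdeg (trailM ha hb).
Qed.

(** Terms of rank below [rank a] can be removed inside [D]: their coefficients lie in the maximal
    ideal, as a unit would give an earlier trailing term, and such a term only involves later
    monomials of [D]. *)
Lemma trail_monideal (D : 'X_{1..d} -> Prop) z a : (forall b c, D b -> D (b + c)%MM) ->
  monideal D z -> trail z a -> D a.
Proof.
move=> hD hz ha; apply: contrapT => hDa.
have sub k w : monideal_ge D k w -> monfil k w by apply: monideal_mono => b [].
have H k : (k <= rank a)%N -> monideal_ge D k z.
  elim: k => [|k IH] hk; first by apply: monideal_mono hz.
  have [[b [u [hb eb hu hzu]]]|//] := monideal_ge_step (IH (ltnW hk)).
  case: (EM (m u)) => [hmu|hn].
    rewrite -(subrK (u * mon b) z); apply: (idD (monideal_ideal _)) => //.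
    apply: monideal_m_mon hmu _ => i; split; first exact: hD.
    by rewrite -eb; apply: rank_mdeg_lt; rewrite mdegD mdeg1 addn1.
  have htb : trail z b by exists u; split=> //; rewrite eb; apply: sub.
  by case: (trail_notin htb); rewrite eb; apply: (monfil_mono hk (trail_in ha)).
apply: (trail_notin ha); have [[b [u [hb eb _ _]]]|] := monideal_ge_step (H _ (leqnn _)).
  by case: hDa; rewrite -(rank_inj eb).
exact: sub.
Qed.

(** By Krull's theorem there is a last [k] such that [z] is congruent to an element of [monfil k];
    the trailing monomial at that stage is outside [D], as it could otherwise be absorbed. *)
Lemma trail_mod (D : 'X_{1..d} -> Prop) z : A z -> ~ monideal D z ->
  exists w a, [/\ A w, monideal D (z - w), trail w a & ~ D a].
Proof.
move=> hz hn; have hI := monideal_ideal D.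
have [||k [[i [w [hi hw e]]] hk1]] := @nat_switch (fun k => ideal_sum (monideal D) (monfil k) z).
- by exists 0, z; rewrite add0r; split=> //; [apply: (id0 hI)|apply: monfil0].
- move=> h; apply: hn; apply: (krull_closed hI hz) => M.
  have [k hk] := monfil_mpow M; have [i [j [hi hj e]]] := h k.
  by exists i, j; split=> //; apply: hk.
have hAw := idA (monfil_ideal _) hw.
have [[a [u [_ ea hu hwu]]]|h] := monideal_ge_step hw; last first.
  by case: hk1; exists i, w.
exists w, a; split=> //; first by rewrite e addrK.
- exists u; rewrite ea; split=> // hmu; apply: hk1; exists i, w; split=> //.
  rewrite -(subrK (u * mon a) w); apply: (idD (monfil_ideal _)) => //.
  by rewrite -ea; apply: m_mon_monfil.
- move=> hDa; apply: hk1; exists (i + u * mon a), (w - u * mon a); split=> //.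
    by apply: (idD hI) => //; apply: (idM hI) => //; apply: monideal_mon.
  by rewrite e; ring.
Qed.

(** The complement of [D] is closed under addition, so the product of two reduced representatives
    has its trailing monomial outside [D]. *)
Lemma monideal_prime (D : 'X_{1..d} -> Prop) y z :
  (forall b c, D (b + c)%MM <-> D b \/ D c) -> A y -> A z -> monideal D (y * z) ->
  monideal D y \/ monideal D z.
Proof.
move=> hD hy hz hyz; apply: contrapT => /not_orP [hny hnz]; have hI := monideal_ideal D.
have [y' [a [hy' ey ta hDa]]] := trail_mod hy hny.
have [z' [b [hz' ez tb hDb]]] := trail_mod hz hnz.
have h : monideal D (y' * z').
  have -> : y' * z' = y * z - z * (y - y') - y' * (z - z') by ring.
  by apply: (idB hI); [apply: (idB hI) => //|]; apply: (idM hI).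
have := trail_monideal _ h (trailM ta tb) => /(_ _)/hD [|//|//].
by move=> b' c' h'; apply/hD; left.
Qed.

(* [monideal (involves i)] is the ideal generated by the first [i] parameters. *)
Definition involves (i : nat) : 'X_{1..d} -> Prop := fun b => exists j : 'I_d, (j < i)%N /\ (0 < b j)%N.

Lemma involves_add i b c : involves i (b + c)%MM <-> involves i b \/ involves i c.
Proof.
split=> [[j [hj]]|[[j [hj h]]|[j [hj h]]]]; last 2 first.
- by exists j; rewrite mnmDE addn_gt0 h.
- by exists j; rewrite mnmDE addn_gt0 h orbT.
by rewrite mnmDE addn_gt0 => /orP[h|h]; [left|right]; exists j.
Qed.

Lemma param_prime i y z : A y -> A z -> monideal (involves i) (y * z) ->
  monideal (involves i) y \/ monideal (involves i) z.
Proof. exact: (monideal_prime (involves_add i)). Qed.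

Lemma param_proper i : ~ monideal (involves i) 1.
Proof.
move=> h; have t1 : trail 1 0%MM.
  exists 1; rewrite mon0 mulr1 subrr; split; [exact: sr1|exact: (notin_m1 hA)|exact: (id0 (monfil_ideal _))].
have [|j [_]] := trail_monideal _ h t1; last by rewrite mnm0E.
by move=> b c hb; apply/involves_add; left.
Qed.

Lemma param_primeX i y k : A y -> ~ monideal (involves i) y -> ~ monideal (involves i) (y ^+ k).
Proof.
move=> hy hn; elim: k => [|k IH]; first by rewrite expr0; apply: param_proper.
by rewrite exprS => /param_prime [//||//|//]; apply: srX.
Qed.

Lemma param_next (i : 'I_d) z : A z ->
  monideal (involves i.+1) z <-> exists c : F, A c /\ monideal (involves i) (z - g i * c).
Proof.
have hI := monideal_ideal (involves i).
have hgiA : A (g i) by case: (hg i).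
move=> hz; split=> [|[c [hc h]]].
  move=> h; have [] : adjoin_elt A (monideal (involves i)) (g i) z.
    apply: monideal_ind h; first exact: (adjoin_elt_ideal hA).
    move=> b [j [hj hbj]]; move: hj; rewrite ltnS leq_eqVlt => /orP[/eqP e|hj].
      have hb : (U_(i) <= b)%MM by rewrite lep1mP -lt0n -(val_inj e).
      exists 0, (mon (b - U_(i))%MM); split; [exact: (id0 hI)|exact: monA|].
      by rewrite add0r -{1}(submK hb) monD mon1.
    by apply: (adjoin_eltl hA); apply: monideal_mon; exists j.
  by move=> w [c [hw hc ->]]; exists c; split=> //; rewrite [c * _]mulrC addrK.
have hI' := monideal_ideal (involves i.+1).
rewrite -(subrK (g i * c) z); apply: (idD hI').
  by apply: monideal_mono h => b [j [hj hb]]; exists j; rewrite ltnW.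
rewrite mulrC; apply: (idM hI') => //; rewrite -mon1; apply: monideal_mon.
by exists i; rewrite ltnSn mnm1E eqxx.
Qed.

Lemma param_nextg (i : 'I_d) : ~ monideal (involves i) (g i).
Proof.
move=> h; have t1 : trail (g i) U_(i)%MM.
  exists 1; rewrite mon1 mul1r subrr; split; [exact: sr1|exact: (notin_m1 hA)|exact: (id0 (monfil_ideal _))].
have [|j [hj]] := trail_monideal _ h t1.
  by move=> b c hb; apply/involves_add; left.
by rewrite mnm1E; case: eqP => // e; rewrite e ltnn in hj.
Qed.

Lemma congM I x x' y y' : ideal A I -> A x' -> A y ->
  I (x - x') -> I (y - y') -> I (x * y - x' * y').
Proof.
move=> hI hx hy h1 h2.
have -> : x * y - x' * y' = y * (x - x') + x' * (y - y') by ring.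
by apply: (idD hI); apply: (idM hI).
Qed.

Lemma congX I x x' k : ideal A I -> A x -> A x' -> I (x - x') -> I (x ^+ k - x' ^+ k).
Proof.
move=> hI hx hx' h; elim: k => [|k IH]; first by rewrite !expr0 subrr; apply: id0 hI.
by rewrite !exprS; apply: (congM hI hx' _ h IH); apply: (srX hA).
Qed.

Lemma congT I x y z : ideal A I -> I (x - y) -> I (y - z) -> I (x - z).
Proof.
move=> hI h1 h2; have -> : x - z = (x - y) + (y - z) by ring.
exact: (idD hI).
Qed.

Lemma congS I x y : ideal A I -> I (x - y) -> I (y - x).
Proof. by move=> hI h; rewrite -opprB; apply: (idN hI). Qed.

(* Complete integral closedness of [A / (g_1, ..., g_i)]. *)
Definition cic_mod i := forall x y t, A x -> A y -> A t -> ~ monideal (involves i) y -> ~ monideal (involves i) t ->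
  (forall k, exists c : F, A c /\ monideal (involves i) (t * x ^+ k - y ^+ k * c)) ->
  exists c : F, A c /\ monideal (involves i) (x - y * c).

(** * Complete integral closedness with one parameter fewer factored out *)

Section CicStep.
Variable i : 'I_d.
Hypothesis IHi : cic_mod i.+1.
Local Notation I0 := (monideal (involves i)).
Local Notation I1 := (monideal (involves i.+1)).
Local Notation G := (g i).

Let hI0 : ideal A I0. Proof. exact: monideal_ideal. Qed.
Let hGA : A G. Proof. by case: (hg i). Qed.
Let hGX k : A (G ^+ k). Proof. exact: srX. Qed.

Lemma param_sub z : I0 z -> I1 z.
Proof. by apply: monideal_mono => b [j [hj hb]]; exists j; rewrite ltnW. Qed.

Lemma param_cancel f w : A w -> I0 (G ^+ f * w) -> I0 w.
Proof.
move=> hw /param_prime [//|//|h|//].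
by case: (param_primeX (k := f) hGA (@param_nextg i)).
Qed.

Lemma param_adic z : A z -> ~ I0 z ->
  exists e z', [/\ A z', ~ I1 z' & I0 (z - G ^+ e * z')].
Proof.
move=> hz hn; have [||e [[z' [hz' h]] he]] :=
  @nat_switch (fun e => exists z', A z' /\ I0 (z - G ^+ e * z')).
- by exists z; rewrite expr0 mul1r subrr; split=> //; apply: id0 hI0.
- move=> h; apply: hn; apply: (krull_closed hI0 hz) => M.
  have [z' [hz' hz'M]] := h M.
  exists (z - G ^+ M * z'), (G ^+ M * z'); split=> //; last by rewrite subrK.
  rewrite mulrC; apply: (idM (mpow_ideal M)) => //.
  have -> : G ^+ M = mon (U_(i) *+ M)%MM.
    elim: M {h hz'M} => [|M IH]; first by rewrite mulm0n mon0 expr0.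
    by rewrite mulmS monD mon1 exprS IH.
  by apply: monideal_mon; rewrite mdegMn mdeg1 mul1n.
exists e, z'; split=> // /(param_next i hz') [c [hc hcz]]; apply: he; exists c; split=> //.
apply: (congT hI0 h); rewrite exprSr -mulrA; rewrite -mulrBr; exact: (idM hI0).
Qed.

Section Pair.
Variables y t : F.
Hypotheses (hy : A y) (ht : A t) (hny : ~ I1 y) (hnt : ~ I1 t).

Definition almost_int x := forall k, exists c : F, A c /\ I0 (t * x ^+ k - y ^+ k * c).

(** [G] is a prime element modulo [I0] that does not divide [y], so it divides [c] and cancels, one
    factor at a time. *)
Lemma almost_cancel f w k : A w -> (exists c : F, A c /\ I0 (G ^+ f * w - y ^+ k * c)) ->
  exists c : F, A c /\ I0 (w - y ^+ k * c).
Proof.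
move=> hw; elim: f => [|f IH] [c [hc h]]; first by exists c; rewrite expr0 mul1r in h.
have hyk : A (y ^+ k) by exact: srX.
have : I1 (y ^+ k * c).
  apply/(param_next i (srM hA hyk hc)); exists (G ^+ f * w); split; first exact: srM.
  by rewrite mulrA -exprS; apply: (congS hI0).
case/param_prime => // [h'|]; first by case: (param_primeX (k := k) hy hny).
move/(param_next i hc) => [c1 [hc1 h1]]; apply: IH; exists c1; split=> //.
apply: (@param_cancel 1%N); first by apply: (srB hA); apply: (srM hA) => //; apply: (srX hA).
rewrite expr1 mulrBr mulrA -exprS; apply: (congT hI0 h).
rewrite mulrCA -mulrBr; exact: (idM hI0).
Qed.

(** The same [t] serves: in the binomial expansion of $t(x-yc)^k$, the term in $x^{k-j}$ is
    divisible by $y^{k-j}y^j$ modulo [I0]. *)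
Lemma almost_int_sub x (c : F) : A x -> A c -> almost_int x -> almost_int (x - y * c).
Proof.
move=> hx hc /choice [f hf] k.
exists (\sum_(j < k.+1) ((-1) ^+ j * f (k - j)%N * c ^+ j) *+ 'C(k, j)).
have hterm (j : nat) : A ((-1) ^+ j * f (k - j)%N * c ^+ j).
  apply: (srM hA); last exact: srX.
  apply: (srM hA); last by case: (hf (k - j)%N).
  by apply: (srX hA); apply: (srN hA); apply: sr1.
have srMn z n : A z -> A (z *+ n).
  by move=> hz; elim: n => [|n IH]; rewrite ?mulr0n ?mulrS; [apply: sr0|apply: srD].
split; first by apply: (sr_sum hA) => j _; apply: srMn.
rewrite exprBn !mulr_sumr -sumrB; apply: (id_sum hI0) => -[j hj] _ /=.
have -> : t * ((-1) ^+ j * x ^+ (k - j) * (y * c) ^+ j *+ 'C(k, j)) -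
    y ^+ k * ((-1) ^+ j * f (k - j)%N * c ^+ j *+ 'C(k, j)) =
    ((-1) ^+ j * (y ^+ j * c ^+ j) *+ 'C(k, j)) * (t * x ^+ (k - j) - y ^+ (k - j) * f (k - j)%N).
  have {1}-> : y ^+ k = y ^+ j * y ^+ (k - j) by rewrite -exprD subnKC.
  by rewrite exprMn; ring.
apply: (idM hI0); last by case: (hf (k - j)%N).
apply: srMn; apply: (srM hA); first by apply: (srX hA); apply: (srN hA); apply: sr1.
by apply: (srM hA); apply: srX.
Qed.

(** Successive approximation: [IHi] divides modulo [G], and the error divided by [G] is again
    [almost_int] because [G] cancels. So [x] lies in $I_0+yA$ up to every power of [G], and this
    ideal is closed by Krull's theorem. *)
Lemma almost_int_div x : A x -> almost_int x -> exists c : F, A c /\ I0 (x - y * c).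
Proof.
move=> hx hax.
have H n : exists (c : F) w, [/\ A c, A w, I0 (x - y * c - G ^+ n * w) & almost_int w].
  elim: n => [|n [c [w [hc hw h haw]]]].
    exists 0, x; rewrite mulr0 subr0 expr0 mul1r subrr; split=> //; [exact: sr0|exact: id0 hI0].
  have [|c1 [hc1 h1]] := IHi hw hy ht hny hnt.
    move=> k; have [c' [hc' h']] := haw k; exists c'; split=> //; exact: param_sub.
  have hwc : A (w - y * c1) by apply: (srB hA) => //; apply: srM.
  move/(param_next i hwc): h1 => [w1 [hw1 h1]].
  exists (c + G ^+ n * c1), w1; split=> //.
  - by apply: (srD hA) => //; apply: srM.
  - have -> : x - y * (c + G ^+ n * c1) - G ^+ n.+1 * w1 =
      (x - y * c - G ^+ n * w) + G ^+ n * (w - y * c1 - G * w1) by rewrite exprS; ring.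
    by apply: (idD hI0) => //; apply: (idM hI0).
  - move=> k; have [c' [hc' h']] := almost_int_sub hw hc1 haw k.
    apply: (@almost_cancel k); first by apply: (srM hA) => //; apply: srX.
    exists c'; split=> //; apply: (congT hI0 _ h').
    rewrite mulrCA -exprMn -mulrBr; apply: (idM hI0) => //.
    by apply: (congX _ hI0) => //; [apply: srM|apply: (congS hI0)].
have [] : adjoin_elt A I0 y x.
  apply: (krull_closed (adjoin_elt_ideal hA hI0 hy) hx) => M.
  have [c [w [hc hw h _]]] := H M.
  exists (x - G ^+ M * w), (G ^+ M * w); split; last by rewrite subrK.
    exists (x - y * c - G ^+ M * w), c; split=> //; by ring.
  rewrite mulrC; apply: (idM (mpow_ideal M)) => //.
  have hGM : mpow M (G ^+ M).
    elim: M {h} => [|M IH]; first by rewrite expr0; apply: mpow0; apply: sr1.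
    by rewrite exprS -add1n; apply: mpowM => //; apply/mpow1; apply: hg.
  exact: hGM.
by move=> j [c [hj hc ->]]; exists c; split=> //; rewrite [c * y]mulrC addrK.
Qed.

End Pair.

Lemma cic_step : cic_mod i.
Proof.
move=> x y t hx hy ht hny hnt hint.
case: (EM (I0 x)) => [h|hnx]; first by exists 0; rewrite mulr0 subr0; split=> //; apply: sr0.
have [e [y' [hy' hny' ey]]] := param_adic hy hny.
have [f [t' [ht' hnt' et]]] := param_adic ht hnt.
have [h [x' [hx' hnx' ex]]] := param_adic hx hnx.
have hrel k : exists c : F, A c /\ I0 (G ^+ f * t' * (G ^+ h * x') ^+ k - (G ^+ e * y') ^+ k * c).
  have [c [hc hk]] := hint k; exists c; split=> //.
  have hyG : A (G ^+ e * y') by exact: srM.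
  have hxG : A (G ^+ h * x') by exact: srM.
  have htG : A (G ^+ f * t') by exact: srM.
  apply: (congT hI0 (y := t * x ^+ k)).
    by apply: (congM hI0) => //; [exact: srX|exact: (congS hI0)|apply: (congX _ hI0) => //; exact: (congS hI0)].
  apply: (congT hI0 hk); apply: (congM hI0) => //; [exact: srX|exact: (congX _ hI0)|].
  by rewrite subrr; apply: id0 hI0.
(* If $h<e$, then $f+hk<ek$ for $k=f+1$. Cancelling $G^{f+hk}$ leaves [G] dividing $t'x'^k$,
   although neither $t'$ nor $x'$ lies in the prime [I1]. *)
have hhe : (e <= h)%N.
  rewrite leqNgt; apply/negP => hlt; have [c [hc]] := hrel f.+1.
  set k := f.+1; have hle : (f + h * k < e * k)%N.
    by rewrite /k; have := leq_mul hlt (leqnn f.+1); rewrite mulSn; lia.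
  have -> : G ^+ f * t' * (G ^+ h * x') ^+ k - (G ^+ e * y') ^+ k * c =
      G ^+ (f + h * k) * (t' * x' ^+ k - G * (G ^+ (e * k - (f + h * k)).-1 * y' ^+ k * c)).
    rewrite mulrBr [G * _]mulrA [G * _]mulrA -exprS prednK ?subn_gt0 //.
    rewrite !mulrA -exprD subnKC 1?ltnW // !exprMn -!exprM exprD; ring.
  have htx : A (t' * x' ^+ k) by apply: (srM hA) => //; apply: srX.
  have hc' : A (G ^+ (e * k - (f + h * k)).-1 * y' ^+ k * c).
    by do 2!apply: (srM hA) => //; apply: srX.
  move/param_cancel => /(_ _)/[dup] H.
  have : I1 (t' * x' ^+ k).
    apply/(param_next i htx); eexists; split; last by apply: H; apply: (srB hA) => //; apply: srM.
    exact: hc'.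
  case/param_prime => //; first by apply: srX.
  by move/(param_primeX hx' hnx').
pose x2 := G ^+ (h - e) * x'.
have hx2 : A x2 by exact: srM.
have ex2 : G ^+ h * x' = G ^+ e * x2 by rewrite /x2 mulrA -exprD subnKC.
have hax : almost_int y' t' x2.
  move=> k; have [c [hc hk]] := hrel k.
  have htx : A (t' * x2 ^+ k) by apply: (srM hA) => //; apply: srX.
  apply: (@almost_cancel y' hy' hny' f) => //; exists c; split=> //.
  apply: (@param_cancel (e * k)).
    by apply: (srB hA); [exact: srM|apply: (srM hA) => //; apply: srX].
  have <- : G ^+ f * t' * (G ^+ h * x') ^+ k - (G ^+ e * y') ^+ k * c =
    G ^+ (e * k) * (G ^+ f * (t' * x2 ^+ k) - y' ^+ k * c) by rewrite ex2 !exprMn -!exprM; ring.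
  by [].
have [c [hc hxc]] := almost_int_div hy' ht' hny' hnt' hx2 hax.
exists c; split=> //; apply: (congT hI0 ex); rewrite ex2.
apply: (congT hI0 (y := G ^+ e * (y' * c))); first by rewrite -mulrBr; apply: (idM hI0).
rewrite mulrA -mulrBl mulrC; apply: (idM hI0) => //; exact: (congS hI0).
Qed.

End CicStep.

(** Descending induction on the number of parameters factored out: with all [d] the quotient is the
    residue field, where [y] is invertible; with none it is [A]. *)
Lemma regular_cic x y t : A x -> A y -> A t -> y != 0 -> t != 0 ->
  (forall k, exists c : F, A c /\ t * x ^+ k = y ^+ k * c) -> exists c : F, A c /\ x = y * c.
Proof.
have hcic j : (j <= d)%N -> cic_mod (d - j).
  elim: j => [|j IH] hj.
    rewrite subn0 => {}x {}y {}t hx hy ht hny hnt _.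
    have hnm : ~ m y.
      move=> hmy; apply: hny; have := monideal_m_mon hmy (Q := involves d) (b := 0%MM).
      by rewrite mon0 mulr1; apply=> i; exists i; rewrite add0m mnm1E eqxx.
    have [y0 hyV] := unit_of_notin hy hnm.
    exists (y^-1 * x); split; first exact: srM.
    by rewrite mulVKf // subrr; apply: id0 (monideal_ideal _).
  have hlt : (d - j.+1 < d)%N by lia.
  have := @cic_step (Ordinal hlt); rewrite /= -subSn // subSS; apply; exact: IH (ltnW hj).
move=> hx hy ht y0 t0 hk.
have hI : forall z, monideal (involves 0) z <-> z = 0.
  move=> z; split=> [|->]; last exact: id0 (monideal_ideal _).
  by apply: (monideal_ind (ideal_zero hA)) => b [j []].
have := hcic d (leqnn d) x y t hx hy ht; rewrite subnn.
case=> [|||c [hc /hI h]]; [by move/hI/eqP; apply/negP|by move/hI/eqP; apply/negP| |].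
  by move=> k; have [c [hc e]] := hk k; exists c; split=> //; apply/hI; rewrite e subrr.
by exists c; split=> //; apply/eqP; rewrite -subr_eq0 h.
Qed.

(** * Forms and their values at the parameters *)

Definition coef_in (J : F -> Prop) (p : {mpoly F[d]}) := forall b, J p@_b.

Lemma coef_in_zero J B : ideal B J -> coef_in J 0.
Proof. by move=> hJ b; rewrite mcoeff0; apply: id0 hJ. Qed.

Lemma coef_inB J B p q : ideal B J -> coef_in J p -> coef_in J q -> coef_in J (p - q).
Proof. by move=> hJ hp hq b; rewrite mcoeffB; apply: (idB hJ). Qed.

Lemma coef_in_sum J B (T : Type) (r : seq T) (f : T -> {mpoly F[d]}) : ideal B J ->
  (forall i, coef_in J (f i)) -> coef_in J (\sum_(i <- r) f i).
Proof.
move=> hJ hf b; elim/big_ind: _ => [|p q hp hq|i _]; first by rewrite mcoeff0; apply: id0 hJ.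
  by rewrite mcoeffD; apply: (idD hJ).
exact: hf.
Qed.

Lemma coef_inM J B p q : ideal B J -> coef_in J p -> coef_in B q -> coef_in J (p * q).
Proof.
by move=> hJ hp hq b; rewrite mcoeffM; apply: (id_sum hJ) => k _; apply: (idMr hJ).
Qed.

Lemma coef_inX B b : subring B -> coef_in B 'X_[b].
Proof. by move=> hB c; rewrite mcoeffX; case: eqP => _; [apply: sr1|apply: sr0]. Qed.

Lemma coef_inC B u : subring B -> B u -> coef_in B (u%:MP).
Proof.
by move=> hB hu c; rewrite mcoeffC; apply: (srM hB) => //; case: eqP => _; [apply: sr1|apply: sr0].
Qed.

Lemma coef_in_exp B p k : subring B -> coef_in B p -> coef_in B (p ^+ k).
Proof.
move=> hB hp; elim: k => [|k IH].
  by rewrite expr0 -mpolyC1; apply: coef_inC => //; apply: sr1.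
by rewrite exprS; apply: coef_inM hp IH; apply: ideal_self.
Qed.

Lemma mpow_form k z : mpow k z ->
  exists p : {mpoly F[d]}, [/\ p \is k.-homog, coef_in A p & z = p.@[g]].
Proof.
have hAA := ideal_self hA.
move/mpow_exact; apply: (@monideal_ind _ (fun z => exists p : {mpoly F[d]},
  [/\ p \is k.-homog, coef_in A p & z = p.@[g]])).
  split.
  - move=> _ [p [_ hp ->]]; rewrite mevalE; apply: (sr_sum hA) => b _.
    by apply: (srM hA) => //; apply: monA.
  - by exists 0; rewrite meval0; split=> //; [apply: rpred0|apply: coef_in_zero hAA].
  - move=> _ _ [p [hp cp ->]] [q [hq cq ->]]; exists (p - q); rewrite mevalB.
    by split=> //; [apply: rpredB|apply: coef_inB hAA cp cq].
  - move=> r _ hr [p [hp cp ->]]; exists (r *: p); rewrite mevalZ; split=> //.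
      exact: rpredZ.
    by move=> b; rewrite mcoeffZ; apply: srM.
move=> b hb; exists 'X_[b]; split; [by rewrite dhomogX; apply/eqP|exact: coef_inX|by rewrite mevalX].
Qed.

(** A coefficient outside the maximal ideal, taken at least rank, would express its monomial through
    later ones, against [hG]. *)
Lemma form_independent k p : p \is k.-homog -> coef_in A p -> mpow k.+1 p.@[g] -> coef_in m p.
Proof.
move=> hp cp hpg b; move: {2}(rank b).+1 (ltnSn (rank b)) => r; elim: r b => // r IH b.
rewrite ltnS => hb; apply: contrapT => hn.
have [u0 huV] := unit_of_notin (cp b) hn.
have hbs : b \in msupp p by rewrite mcoeff_msupp.
have hdeg c : c \in msupp p -> mdeg c = k by move/dhomogP: hp; apply.
have hE := monfil_ideal (rank b).+1.
apply: (hG (a := b)); rewrite -(mulKf u0 (mon b)); apply: (idM hE) => //.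
have -> : p@_b * mon b = p.@[g] - \sum_(c <- rem b (msupp p)) p@_c * mon c.
  by rewrite mevalE (big_rem b hbs) /= addrK.
apply: (idB hE); first by apply: mpow_monfil hpg; rewrite (hdeg b).
rewrite big_seq; apply: (id_sum hE) => c; rewrite (mem_rem_uniq _ (msupp_uniq p)) inE.
move=> /andP[hcb hc]; case: (ltngtP (rank c) (rank b)) => h.
- apply: (@mpow_monfil k.+1); first by rewrite hdeg.
  apply: monideal_m_mon => [|i]; first by apply: IH; apply: leq_trans h hb.
  by rewrite mdegD mdeg1 addn1 (hdeg c).
- by apply: (idM hE) => //; apply: monideal_mon.
- by case/eqP: hcb; apply: rank_inj.
Qed.

(** * Multiplicity of a form at a point of the exceptional fibre *)

Section OrderDrop.
Variables (B : F -> Prop) (i0 : 'I_d).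
Local Notation y := (g i0).
Local Notation mB := (nonunits B).
Hypotheses (hB : subring B) (hmB : ideal B mB) (hAB : subset_of A B).
Hypotheses (hmm : subset_of m mB) (y0 : y != 0) (hu : forall i, B (g i / y)).
Hypothesis hrep : forall z, B z -> exists k (c b : F),
  [/\ mpow k c, mpow k b, z * (b / y ^+ k) = c / y ^+ k & ~ mB (b / y ^+ k)].

(** The point of the chart $y\ne0$ picked out by [B], with coordinate $1$ at [i0]. Moving it to the
    origin by [shift] turns vanishing order into a condition on coefficients of low degree. *)
Let u (i : 'I_d) : F := g i / y.
Let shift (p : {mpoly F[d]}) : {mpoly F[d]} := p \mPo [tuple 'X_i + (u i)%:MP | i < d].

Lemma shift_mon b : shift 'X_[b] = \prod_i ('X_i + (u i)%:MP) ^+ b i.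
Proof. by rewrite /shift comp_mpolyX; apply: eq_bigr => i _; rewrite tnth_mktuple. Qed.

Lemma shiftE p : shift p = \sum_(b <- msupp p) p@_b *: shift 'X_[b].
Proof. exact: comp_mpolyEX. Qed.

Lemma shift_coef_mon b : coef_in B (shift 'X_[b]).
Proof.
rewrite shift_mon; elim/big_ind: _ => [|p q hp hq|i _].
- by rewrite -mpolyC1; apply: coef_inC => //; apply: sr1.
- by apply: coef_inM hp hq; apply: ideal_self.
- apply: coef_in_exp => // c; rewrite mcoeffD; apply: (srD hB).
    exact: coef_inX.
  by apply: coef_inC => //; apply: hu.
Qed.

Lemma shift_coef J p : ideal B J -> coef_in J p -> coef_in J (shift p).
Proof.
move=> hJ hp; rewrite shiftE; apply: (coef_in_sum _ hJ) => b c.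
by rewrite mcoeffZ mulrC; apply: (idM hJ) => //; apply: shift_coef_mon.
Qed.

Lemma shift_coef0 p : (shift p)@_0 = p.@[u].
Proof.
rewrite shiftE raddf_sum mevalE; apply: eq_bigr => b _; rewrite /= mcoeffZ shift_mon.
congr (_ * _); rewrite rmorph_prod; apply: eq_bigr => i _.
by rewrite rmorphXn /= mcoeffD mcoeffX mnm1_eq0 add0r mcoeffC eqxx mulr1.
Qed.

(** Translation changes a monomial only by terms of smaller degree. *)
Lemma shift_coef_top k p b : p \is k.-homog -> mdeg b = k -> (shift p)@_b = p@_b.
Proof.
move=> hp hb.
have H c : exists q : {mpoly F[d]}, shift 'X_[c] = 'X_[c] + q /\ (msize q <= mdeg c)%N.
  pose P (s : {mpoly F[d]}) (a : 'X_{1..d}) :=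
    exists q : {mpoly F[d]}, s = 'X_[a] + q /\ (msize q <= mdeg a)%N.
  have PM s a s' a' : P s a -> P s' a' -> P (s * s') (a + a')%MM.
    move=> [q [-> hq]] [q' [-> hq']]; exists ('X_[a] * q' + q * 'X_[a'] + q * q').
    split; first by rewrite mpolyXD; ring.
    have szM (p1 p2 : {mpoly F[d]}) n1 n2 : (msize p1 <= n1)%N -> (msize p2 <= n2)%N ->
        (msize (p1 * p2) <= (n1 + n2).-1)%N.
      case: (eqVneq p1 0) => [->|h1]; first by rewrite mul0r msize0.
      case: (eqVneq p2 0) => [->|h2]; first by rewrite mulr0 msize0.
      by move=> k1 k2; rewrite msizeM // -!subn1 leq_sub2r // leq_add.
    have h1 := szM _ _ _ _ (_ : (msize ('X_[a] : {mpoly F[d]}) <= (mdeg a).+1)%N) hq'.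
    have h2 := szM _ _ _ _ hq (_ : (msize ('X_[a'] : {mpoly F[d]}) <= (mdeg a').+1)%N).
    have h3 := szM _ _ _ _ hq hq'.
    rewrite !msizeX in h1 h2; move: (h1 (leqnn _)) (h2 (leqnn _)) h3; rewrite mdegD => {}h1 {}h2 h3.
    apply: leq_trans (msizeD_le _ _) _; rewrite geq_max; apply/andP; split; last by lia.
    by apply: leq_trans (msizeD_le _ _) _; rewrite geq_max; apply/andP; split; lia.
  have P1 : P 1 0%MM.
    by exists 0; rewrite mpolyX0 addr0 msize0.
  suff : P (shift 'X_[c]) c by [].
  rewrite shift_mon {2}[c]multinomUE_id.
  elim/big_ind2: _ => [|s a s' a' h h'|i _]; [exact: P1|exact: PM|].
  elim: (c i) => [|j IH]; first by rewrite expr0 mulm0n.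
  rewrite exprS mulmS; apply: PM => //; exists (u i)%:MP; split=> //.
  by rewrite msizeC mdeg1; case: eqP.
rewrite shiftE [in RHS](mpolyE p) !raddf_sum /= !big_seq; apply: eq_bigr => c hc.
have [q [-> hq]] := H c; rewrite !mcoeffZ mcoeffD.
have hcdeg : mdeg c = k by move/dhomogP: hp; apply.
suff -> : q@_b = 0 by rewrite addr0.
by apply: memN_msupp_eq0; apply: msize_mdeg_ge; rewrite hb -hcdeg.
Qed.

Lemma meval_shrink k p : p \is k.-homog -> p.@[u] = p.@[g] / y ^+ k.
Proof.
move=> hp; rewrite !mevalE mulr_suml !big_seq; apply: eq_bigr => b hb.
rewrite -mulrA; congr (_ * _).
have <- : mdeg b = k by move/dhomogP: hp; apply.
rewrite mdegE.
have -> : y ^+ (\sum_i b i) = \prod_i y ^+ b i by rewrite prodrXr.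
by rewrite -prodf_div; apply: eq_bigr => i _; rewrite expr_div_n.
Qed.

(* [z] is a quotient of forms whose numerator vanishes to order [k] at the point [u] of
   the residue field of [B]. *)
Definition vanishes k z := exists n p q,
  [/\ [/\ p \is n.-homog, q \is n.-homog, coef_in A p & coef_in A q],
      z * q.@[u] = p.@[u], ~ mB q.@[u] & forall b, (mdeg b < k)%N -> mB (shift p)@_b].

Let coefAB p : coef_in A p -> coef_in B (shift p).
Proof. by move=> hp; apply: (shift_coef (ideal_self hB)) => b; apply: hAB. Qed.

Lemma vanishes_rep z : B z -> vanishes 0 z /\ (mB z -> vanishes 1 z).
Proof.
move=> hz; have [k [c [b [/mpow_form [p [hp cp ec]] /mpow_form [q [hq cq eb]] e hn]]]] := hrep hz.
have e' : z * q.@[u] = p.@[u] by rewrite (meval_shrink hp) (meval_shrink hq) -ec -eb.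
have hn' : ~ mB q.@[u] by rewrite (meval_shrink hq) -eb.
split; first by exists k, p, q.
move=> hzm; exists k, p, q; split=> // a; rewrite ltnS leqn0 mdeg_eq0 => /eqP->.
rewrite shift_coef0 -e' mulrC; apply: (idM hmB) => //.
by rewrite -shift_coef0; apply: coefAB.
Qed.

Lemma vanish_coefM k l p q : coef_in B p -> coef_in B q ->
  (forall b, (mdeg b < k)%N -> mB p@_b) -> (forall b, (mdeg b < l)%N -> mB q@_b) ->
  forall b, (mdeg b < k + l)%N -> mB (p * q)@_b.
Proof.
move=> hp hq vp vq b hb; rewrite mcoeffM; apply: (id_sum hmB) => -[b1 b2] /= /eqP e.
case: (ltnP (mdeg b1) k) => h1; first by apply: (idMr hmB) => //; apply: vp.
apply: (idM hmB) => //; apply: vq; have := congr1 mdeg e; rewrite mdegD; lia.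
Qed.

Let notmBM (a b : F) : B a -> B b -> ~ mB a -> ~ mB b -> ~ mB (a * b).
Proof.
move=> ha hb na nb; have [a0 haV] := unit_of_notin ha na; have [b0 hbV] := unit_of_notin hb nb.
case=> _ [/eqP|]; first by rewrite mulf_eq0 (negPf a0) (negPf b0).
by rewrite invfM; case; apply: srM.
Qed.

Let evalB p : coef_in A p -> B p.@[u].
Proof. by move=> hp; rewrite -shift_coef0; apply: coefAB. Qed.

Let shiftB p q : shift (p - q) = shift p - shift q.
Proof. exact: raddfB. Qed.

Let shiftM p q : shift (p * q) = shift p * shift q.
Proof. exact: rmorphM. Qed.

Lemma vanishesM k l z w : vanishes k z -> vanishes l w -> vanishes (k + l) (z * w).
Proof.
move=> [n [p [q [[hp hq cp cq] e hn v]]]] [n' [p' [q' [[hp' hq' cp' cq'] e' hn' v']]]].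
have hAA := ideal_self hA.
exists (n + n')%N, (p * p'), (q * q'); split.
- by split; [apply: dhomogM|apply: dhomogM|apply: coef_inM hAA cp cp'|apply: coef_inM hAA cq cq'].
- by rewrite !mevalM -e -e'; ring.
- by rewrite mevalM; apply: notmBM => //; apply: evalB.
- by rewrite shiftM; apply: vanish_coefM => //; apply: coefAB.
Qed.

Lemma vanishesB k z w : vanishes k z -> vanishes k w -> vanishes k (z - w).
Proof.
move=> [n [p [q [[hp hq cp cq] e hn v]]]] [n' [p' [q' [[hp' hq' cp' cq'] e' hn' v']]]].
have hAA := ideal_self hA.
exists (n + n')%N, (p * q' - p' * q), (q * q'); split.
- split.
  + by apply: rpredB; [apply: dhomogM|rewrite addnC; apply: dhomogM].
  + exact: dhomogM.
  + by apply: (coef_inB hAA); apply: coef_inM hAA _ _.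
  + exact: coef_inM hAA cq cq'.
- by rewrite mevalB !mevalM -e -e'; ring.
- by rewrite mevalM; apply: notmBM => //; apply: evalB.
- move=> b hb; rewrite shiftB mcoeffB; apply: (idB hmB); rewrite shiftM.
    by apply: (@vanish_coefM k 0) => //; rewrite ?addn0 //; apply: coefAB.
  by apply: (@vanish_coefM k 0) => //; rewrite ?addn0 //; apply: coefAB.
Qed.

(** Vanishing orders add under products, and the elements of [B] vanishing to order [k] form an
    ideal; so order one on the maximal ideal is enough. *)
Lemma ideal_pow_vanishes k z : ideal_pow B mB k z -> vanishes k z.
Proof.
suff hI : ideal B (fun z => B z /\ vanishes k z).
  move=> /(_ _ hI) [] // _ [s [<- hs ->]]; elim: s hs {hI} => [|w s IH] hs.
    rewrite big_nil; split; first exact: sr1.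
    by have [] := vanishes_rep (sr1 hB).
  rewrite big_cons; have [|h1 h2] := IH; first by move=> t ht; apply: hs; rewrite inE ht orbT.
  have hw : mB w by apply: hs; rewrite mem_head.
  have hwB : B w by case: hw.
  split; first exact: srM.
  by rewrite -[size _]add1n; apply: vanishesM => //; have [_] := vanishes_rep hwB; apply.
split.
- by move=> ? [].
- split; first exact: sr0.
  have hAA := ideal_self hA.
  exists 0%N, 0, 1; split.
  + split; [exact: rpred0|exact: dhomog1|exact: (coef_in_zero hAA)|].
    by rewrite -mpolyC1; apply: coef_inC => //; apply: sr1.
  + by rewrite mul0r meval0.
  + by rewrite meval1; apply: (notin_m1 hB).
  + by move=> b _; rewrite /shift comp_mpoly0 mcoeff0; apply: id0 hmB.
- by move=> a b [ha va] [hb vb]; split; [apply: srB|apply: vanishesB].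
- move=> r a hr [ha va]; split; first exact: srM.
  by rewrite -[k]add0n; apply: vanishesM => //; have [] := vanishes_rep hr.
Qed.

(** Let [f] be the value of a form [h] of degree [r], and suppose $h(u)q(u)=p(u)$ with [p] vanishing
    to order $r+1$. The form $hq-X_{i_0}^rp$ vanishes at [u], hence at [g], so its coefficients lie
    in the maximal ideal. Modulo the maximal ideal of [B], the translate of $hq$ then starts in
    degree $r+1$; as $q(u)$ is a unit, so does that of [h], whose top coefficients are those of [h].
    This contradicts the order of [f]. *)
Lemma order_drop r f : mpow r f -> ~ mpow r.+1 f -> ~ ideal_pow B mB r.+1 (f / y ^+ r).
Proof.
move=> /mpow_form [h [hh ch ->]] hn /ideal_pow_vanishes [n [p [q [[hp hq cp cq] e hnq v]]]].
apply: hn.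
have hAA := ideal_self hA.
have cX : coef_in A ('X_i0 ^+ r) by apply: coef_in_exp => //; apply: coef_inX.
have hX : ('X_i0 ^+ r : {mpoly F[d]}) \is r.-homog.
  by rewrite -[r in r.-homog]mul1n; apply: dhomogMn; rewrite dhomogX; apply/eqP; apply: mdeg1.
(* The factor $X_{i_0}^r$ is $1$ at [u] and makes both terms homogeneous of degree $r+n$. *)
pose D := h * q - 'X_i0 ^+ r * p.
have hD : D \is (r + n).-homog by apply: rpredB; apply: dhomogM.
have cD : coef_in A D by apply: (coef_inB hAA); apply: coef_inM hAA _ _.
have cmD : coef_in m D.
  apply: (form_independent hD cD).
  suff -> : D.@[g] = 0 by apply: id0 (mpow_ideal _).
  have hDu : D.@[u] = 0.
    rewrite mevalB !mevalM (meval_shrink hh) e rmorphXn /= mevalXU /u divff // expr1n mul1r.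
    exact: subrr.
  move: hDu; rewrite (meval_shrink hD) => /eqP; rewrite mulf_eq0 invr_eq0 expf_eq0 (negPf y0) andbF orbF.
  by move/eqP.
have cmD' : coef_in mB (shift D) by apply: (shift_coef hmB) => b; apply: hmm.
have hvan b : (mdeg b <= r)%N -> mB (shift h * shift q)@_b.
  move=> hb; have -> : shift h * shift q = shift D + shift ('X_i0 ^+ r) * shift p.
    by rewrite shiftB !shiftM subrK.
  rewrite mcoeffD; apply: (idD hmB) => //.
  by apply: (@vanish_coefM 0 r.+1) => //; apply: coefAB.
have hcoef k : forall b, (mdeg b < k)%N -> (mdeg b <= r)%N -> mB (shift h)@_b.
  elim: k => // k IH b hbk hbr.
  have := hvan b hbr; rewrite mcoeffM.
  have hb1 : (mdeg b < (mdeg b).+1)%N by [].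
  have h01 : (mdeg (0%MM : 'X_{1..d}) < (mdeg b).+1)%N by rewrite mdeg0.
  rewrite (bigD1 (BMultinom hb1, BMultinom h01)) /=; last by rewrite addm0.
  rewrite shift_coef0 => hs.
  have hB' := evalB cq; have [q0 hqV] := unit_of_notin hB' hnq.
  suff hrest : mB ((shift h)@_b * q.@[u]).
    by rewrite -(mulfK q0 (shift h)@_b) mulrC; apply: (idM hmB).
  move: hs; set rest := \sum_(_ | _) _ => hs.
  have -> : (shift h)@_b * q.@[u] = ((shift h)@_b * q.@[u] + rest) - rest by rewrite addrK.
  apply: (idB hmB) => //; apply: (id_sum hmB) => -[b1 b2] /= /andP[/eqP eb hne].
  apply: (idMr hmB); first exact: coefAB.
  have hb2 : (0 < mdeg b2)%N.
    rewrite lt0n mdeg_eq0; apply/eqP => e2; case/eqP: hne.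
    by congr (_, _); apply: val_inj => //=; apply: esym; apply: (etrans eb); rewrite e2 addm0.
  by have := congr1 mdeg eb; rewrite mdegD => hd; apply: IH; lia.
have chm : coef_in m h.
  move=> b; case: (eqVneq (mdeg b) r) => [hb|hb]; last first.
    by rewrite (dhomog_nemf_coeff hh hb); apply: id0 hm.
  have := hcoef r.+1 b; rewrite hb => /(_ (ltnSn r) (leqnn r)).
  rewrite (shift_coef_top hh hb) => hmb; apply: contrapT => hnm.
  have [h0 hV] := unit_of_notin (ch b) hnm.
  by case: hmb => _ [/eqP|]; [rewrite (negPf h0)|case; apply: hAB].
rewrite mevalE big_seq; apply: (id_sum (mpow_ideal _)) => b hb; apply: monideal_m_mon => // i.
by rewrite mdegD mdeg1 addn1; move/dhomogP: hh => ->.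
Qed.

End OrderDrop.
End Independent.

End MonomialFiltration.

(** * Order valuations and local quadratic transforms *)

Section Order.
Variable F : fieldType.
Implicit Types (A B C Q : F -> Prop) (v : F -> int).

Definition params A d (g : 'I_d -> F) :=
  (forall i, nonunits A (g i)) /\
  (forall z, nonunits A z ->
     exists a : 'I_d -> F, (forall i, A (a i)) /\ z = \sum_i a i * g i).

(** As $y\notin\mathfrak m^2$, some coefficient of [y] in the given generators is a unit, so [y] can
    replace that generator without changing their number. *)
Lemma regular_params A y : regular_local A -> nonunits A y ->
  ~ ideal_pow A (nonunits A) 2 y ->
  exists d (g : 'I_d -> F) (i0 : 'I_d), [/\ params A g, g i0 = y & prime_chain A d].
Proof.
move=> [[hA hm] hN [d [[hch _] [gs [hs hgs hgen]]]]] hy hy2.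
pose g0 (i : 'I_d) := gs`_i.
have hg0 i : nonunits A (g0 i) by apply: hgs; rewrite mem_nth // hs.
have hgen0 z : nonunits A z ->
    exists a : 'I_d -> F, (forall i, A (a i)) /\ z = \sum_i a i * g0 i.
  move=> /hgen [cs [hcs hc ->]]; exists (fun i => cs`_i); split.
    by move=> i; apply: hc; rewrite mem_nth // hcs hs.
  by rewrite hs.
have [c [hc ey]] := hgen0 y hy.
have [i0 hi0] : exists i, ~ nonunits A (c i).
  apply: contrapT => hn; apply: hy2; rewrite ey => J hJ hGJ; apply: (id_sum hJ) => i _.
  apply: hGJ; exists [:: c i; g0 i]; split=> //; last by rewrite !big_cons big_nil mulr1.
  move=> z; rewrite !inE => /orP[] /eqP-> //.
  by apply: contrapT => h; apply: hn; exists i.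
have [c0 hcV] := unit_of_notin (hc i0) hi0.
pose g i := if i == i0 then y else g0 i.
exists d, g, i0; split=> //; last by rewrite /g eqxx.
split=> [i|z /hgen0 [a [ha ->]]]; first by rewrite /g; case: eqP.
pose e := a i0 / c i0.
exists (fun i => if i == i0 then e else a i - e * c i); split.
  have he : A e by apply: (srM hA).
  by move=> i; case: eqP => // _; apply: (srB hA) => //; apply: (srM hA).
rewrite [LHS](bigD1 i0) //= [RHS](bigD1 i0) //= /g eqxx.
rewrite [X in _ = _ + X](eq_bigr (fun i => a i * g0 i - e * (c i * g0 i))); last first.
  by move=> i /negPf ->; ring.
rewrite sumrB -mulr_sumr ey [\sum_i c i * g0 i](bigD1 i0) //= /e.
set s1 := \sum_(i | _) _; set s2 := \sum_(i | _) _.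
by field.
Qed.

(** The value at $0$ is left unspecified; hence the nonvanishing hypotheses below and the predicate
    [vge]. *)
Definition is_ord A v :=
  (forall q r, q != 0 -> r != 0 -> v (q * r) = v q + v r) /\
  (forall a n, A a -> a != 0 -> (ideal_pow A (nonunits A) n a <-> (n%:Z <= v a)%R)).

Section Regular.
Variables (A : F -> Prop) (d : nat) (g : 'I_d -> F).
Hypotheses (hreg : regular_local A) (hF : quotient_field_is_F A).
Hypotheses (hpar : params A g) (hch : prime_chain A d) (hd : (0 < d)%N).

Let hA : subring A. Proof. by case: hreg => -[]. Qed.
Let hm : ideal A (nonunits A). Proof. by case: hreg => -[]. Qed.
Let hN : noetherian A. Proof. by case: hreg. Qed.
Let hg := hpar.1.
Let hgen := hpar.2.

Lemma regular_independent a : ~ monfil A g (rank a).+1 (mon g a).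
Proof. exact: (monomial_independent hA hm hN hg hgen hd hch). Qed.

Let hG := regular_independent.
Local Notation mpw := (mpow A g).

Lemma ord_exists_regular : exists v, is_ord A v.
Proof.
pose oa a r := mpw r a /\ ~ mpw r.+1 a.
have oex a : A a -> a != 0 -> exists r, oa a r by apply: (order_exists hA hm hN hg hgen hG).
have oM a b r s : A a -> A b -> oa a r -> oa b s -> oa (a * b) (r + s)%N.
  move=> ha hb [h1 h2] [h3 h4]; split; first exact: (mpowM hA hg).
  exact: (orderM hA hm hN hg hgen hG).
have oU a r s : oa a r -> oa a s -> r = s.
  by move=> [h1 h2] [h3 h4]; apply: (order_unique hA hg h1 h2 h3 h4).
have hex q : exists n : int, q != 0 ->
    exists a b r s, [/\ [/\ A a, A b & b != 0], q * b = a, oa a r, oa b s & n = r%:Z - s%:Z].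
  case: (eqVneq q 0) => [_|q0]; first by exists 0.
  have [a [b [ha hb b0 e]]] := hF q.
  have a0 : a != 0 by apply/eqP => e0; rewrite e e0 mul0r eqxx in q0.
  have [r hr] := oex a ha a0; have [s hs] := oex b hb b0.
  by exists (r%:Z - s%:Z) => _; exists a, b, r, s; rewrite e divfK.
have [v hv] := choice hex; exists v; split.
  move=> q q' q0 q0'.
  have [a [b [r [s [[ha hb b0] e hr hs ->]]]]] := hv q q0.
  have [a' [b' [r' [s' [[ha' hb' b0'] e' hr' hs' ->]]]]] := hv q' q0'.
  have [a2 [b2 [r2 [s2 [[ha2 hb2 b02] e2 hr2 hs2 ->]]]]] := hv (q * q') (mulf_neq0 q0 q0').
  have h1 := oM _ _ _ _ (srM hA ha ha') hb2 (oM _ _ _ _ ha ha' hr hr') hs2.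
  have h2 := oM _ _ _ _ ha2 (srM hA hb hb') hr2 (oM _ _ _ _ hb hb' hs hs').
  have E : a * a' * b2 = a2 * (b * b') by rewrite -e -e' -e2; ring.
  by rewrite E in h1; have := oU _ _ _ h1 h2; lia.
move=> a n ha a0; have [b [c [r [s [[hb hc c0] e hr hs ->]]]]] := hv a a0.
have [t ht] := oex a ha a0.
have h1 := oM _ _ _ _ ha hc ht hs; rewrite e in h1.
have -> : (r%:Z - s%:Z = t%:Z)%R by have := oU _ _ _ h1 hr; lia.
rewrite (ideal_pow_mpow hA hm hg hgen) lez_nat; case: ht => ht1 ht2; split=> [hn|hn].
  by rewrite leqNgt; apply/negP => h; apply: ht2; apply: (mpow_mono hA hg h).
exact: (mpow_mono hA hg hn).
Qed.

Lemma cic_regular q t : A t -> t != 0 -> (forall k, A (t * q ^+ k)) -> A q.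
Proof.
move=> ht t0 h; have [a [b [ha hb b0 e]]] := hF q.
have [|c [hc ec]] := regular_cic hA hm hN hg hgen hG ha hb ht b0 t0.
  move=> k; exists (t * q ^+ k); split=> //.
  by rewrite e expr_div_n mulrCA; congr (_ * _); rewrite mulrC divfK // expf_neq0.
by rewrite e ec mulrAC divff // mul1r.
Qed.

(** * Elements of a local quadratic transform as fractions *)

Section Transform.
Variables (v : F -> int) (i0 : 'I_d) (Q B : F -> Prop).
Local Notation y := (g i0).
Local Notation C := (blowup A y).
Hypotheses (hv : is_ord A v) (hQ : prime_ideal C Q) (hmQ : subset_of (nonunits A) Q).
Hypotheses (hBQ : set_eq B (loc_at C Q)) (hBl : local_ring B) (y0 : y != 0).

Let hB : subring B. Proof. by case: hBl. Qed.
Let hmB : ideal B (nonunits B). Proof. by case: hBl. Qed.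

Lemma gen_ring_subring (G : F -> Prop) : subring (gen_ring G).
Proof.
split=> [D hD _|D hD _|a b ha hb D hD hG'|a b ha hb D hD hG']; first exact: sr0.
- exact: sr1.
- by apply: (srB hD); [apply: ha|apply: hb].
- by apply: (srM hD); [apply: ha|apply: hb].
Qed.

Let hC : subring C. Proof. exact: gen_ring_subring. Qed.
Let hQI : ideal C Q. Proof. by case: hQ => -[]. Qed.
Let hQ1 : ~ Q 1. Proof. by case: hQ => -[]. Qed.

Lemma blowup_base a : A a -> C a.
Proof. by move=> ha D hD hG'; apply: hG'; left. Qed.

Lemma blowup_quot z : nonunits A z -> C (z / y).
Proof. by move=> hz D hD hG'; apply: hG'; right; exists z. Qed.

Let mpwX k : mpw k (y ^+ k).
Proof.
elim: k => [|k IH]; first by rewrite expr0; apply: (mpow0 hA hg); apply: sr1.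
by rewrite exprS -add1n; apply: (mpowM hA hg) => //; apply/(mpow1 hA hm hg hgen); apply: hg.
Qed.

Let yX k : y ^+ k != 0. Proof. exact: expf_neq0. Qed.

Lemma blowup_num c : C c -> exists a k, mpw k a /\ c = a / y ^+ k.
Proof.
move=> /(_ (fun c => exists a k, mpw k a /\ c = a / y ^+ k)); apply; last first.
  move=> q [hq|[z [hz ->]]].
    by exists q, 0%N; rewrite expr0 divr1; split=> //; apply: (mpow0 hA hg).
  by exists z, 1%N; rewrite expr1; split=> //; apply/(mpow1 hA hm hg hgen).
have hsub k l a : mpw k a -> mpw (k + l)%N (a * y ^+ l) by move=> h; apply: (mpowM hA hg).
split.
- by exists 0, 0%N; rewrite mul0r; split=> //; apply: id0 (mpow_ideal hA hg _).
- by exists 1, 0%N; rewrite expr0 divr1; split=> //; apply: (mpow0 hA hg); apply: sr1.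
- move=> _ _ [a [k [ha ->]]] [b [l [hb ->]]].
  exists (a * y ^+ l - b * y ^+ k), (k + l)%N; split.
    apply: (idB (mpow_ideal hA hg _)); first exact: hsub.
    by rewrite addnC; apply: hsub.
  by rewrite exprD; have := yX k; have := yX l => h1 h2; field; rewrite h1 h2.
- move=> _ _ [a [k [ha ->]]] [b [l [hb ->]]].
  exists (a * b), (k + l)%N; split; first exact: (mpowM hA hg).
  by rewrite exprD; have := yX k; have := yX l => h1 h2; field; rewrite h1 h2.
Qed.

Lemma blowup_div k a : mpw k a -> C (a / y ^+ k).
Proof.
move/(mpow_exact hA hg) => h.
suff [] : A a /\ C (a / y ^+ k) by [].
apply: (@monideal_ind _ _ _ g _ (fun a => A a /\ C (a / y ^+ k)) a _ _ h).
  split.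
  - by move=> ? [].
  - by rewrite mul0r; split; [apply: sr0|apply: sr0].
  - move=> a' b' [ha hCa] [hb hCb]; rewrite mulrBl; split; [exact: (srB hA)|exact: (srB hC)].
  - move=> r a' hr [ha hCa]; rewrite -mulrA; split; first exact: (srM hA).
    by apply: (srM hC) => //; apply: blowup_base.
move=> b hb; split; first exact: (monA hA hg).
rewrite -hb mdegE -prodrXr /mon -prodf_div; apply: (sr_prod hC) => i _.
by rewrite -expr_div_n; apply: (srX hC); apply: blowup_quot; apply: hg.
Qed.

Let CB c : C c -> B c.
Proof.
move=> hc; apply/hBQ; exists c, 1; rewrite divr1; split=> //; last exact: oner_neq0.
by split=> //; apply: sr1.
Qed.

Let CQV s : C s -> ~ Q s -> s != 0 -> B s^-1.
Proof.
move=> hs hn s0; apply/hBQ; exists 1, s; rewrite div1r; split=> //; apply: sr1 => //.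
Qed.

Let Qnonunit z : Q z -> nonunits B z.
Proof.
move=> hz; split; first by apply: CB; apply: (idA hQI).
case: (eqVneq z 0) => [->|z0]; [by left|right].
move/hBQ => [c [s [hc [hs hn] s0 e]]]; apply: hn.
have -> : s = c * z by rewrite -[z in RHS]invrK e invf_div mulrC divfK //; apply/eqP => c0;
  move: e => /eqP; rewrite c0 mul0r invr_eq0 (negPf z0).
exact: (idM hQI).
Qed.

Lemma transform_sub a : A a -> B a.
Proof. by move=> ha; apply: CB; apply: blowup_base. Qed.

Lemma transform_dominates a : nonunits A a -> nonunits B a.
Proof. by move/hmQ; apply: Qnonunit. Qed.

Lemma transform_div k a : mpw k a -> B (a / y ^+ k).
Proof. by move/blowup_div/CB. Qed.

Lemma transform_rep z : B z -> exists k c b, [/\ mpw k c, mpw k b & b != 0] /\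
  [/\ z * (b / y ^+ k) = c / y ^+ k, B (b / y ^+ k)^-1 & ~ mpw k.+1 b].
Proof.
move/hBQ => [c [s [/blowup_num [a [k [ha ->]]] [hs hn] s0 ->]]].
have [b [l [hb es]]] := blowup_num hs; rewrite es in hn hs s0 *.
have e : b * y ^+ k / y ^+ (k + l) = b / y ^+ l.
  by rewrite exprD; have := yX k; have := yX l => h1 h2; field; rewrite h1 h2.
exists (k + l)%N, (a * y ^+ l), (b * y ^+ k); rewrite e; split; split.
- exact: (mpowM hA hg).
- by rewrite addnC; apply: (mpowM hA hg).
- by apply: mulf_neq0 => //; apply/eqP => b0; rewrite b0 mul0r eqxx in s0.
- rewrite divfK // exprD; have := yX k; have := yX l => h1 h2; field; by rewrite h1 h2.
- exact: CQV.
(* If the numerator of [s] had order above the exponent, [s] would be a multiple of [y] in [C],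
   hence an element of [Q]. *)
- move=> h; apply: hn; rewrite -e.
  have -> : b * y ^+ k / y ^+ (k + l) = (b * y ^+ k / y ^+ (k + l).+1) * y.
    rewrite exprS; have := yX (k + l) => h1; field; by rewrite h1.
  by apply: (idM hQI); [apply: blowup_div|apply: hmQ; apply: hg].
Qed.

Let vmpow a n : A a -> a != 0 -> (mpw n a <-> (n%:Z <= v a)%R).
Proof. by move=> ha a0; rewrite -(hv.2 a n ha a0) (ideal_pow_mpow hA hm hg hgen). Qed.

Lemma ord_ge0 a : A a -> a != 0 -> (0 <= v a)%R.
Proof. by move=> ha a0; apply/(vmpow 0 ha a0); apply: (mpow0 hA hg). Qed.

Lemma ord_nat a : A a -> a != 0 -> exists n : nat, v a = n%:Z.
Proof. by move=> ha a0; have := ord_ge0 ha a0; case: (v a) => // n _; exists n. Qed.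

Lemma transform_strict a : A a -> a != 0 -> B (a * y ^ (- v a)).
Proof.
move=> ha a0; have [n en] := ord_nat ha a0; rewrite en.
by rewrite -invr_expz -exprnP; apply: transform_div; apply/(vmpow n ha a0); rewrite en.
Qed.

Lemma transform_frac q : B q -> exists c b,
  [/\ [/\ A c, A b & b != 0], q = c / b, c = 0 \/ (v b <= v c)%R & B (y ^ v b / b)].
Proof.
move/transform_rep => [k [c [b [[hc hb b0] [e hV hn]]]]].
have hAc := idA (mpow_ideal hA hg _) hc; have hAb := idA (mpow_ideal hA hg _) hb.
have hvb : v b = k%:Z.
  have [n en] := ord_nat hAb b0.
  have h1 : (k%:Z <= v b)%R by apply/(vmpow k hAb b0).
  have h2 : ~ (k.+1%:Z <= v b)%R by move/(vmpow k.+1 hAb b0).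
  by move: h1 h2; rewrite en; lia.
exists c, b; split=> //.
- apply: (mulIf (x := b / y ^+ k)); first by rewrite mulf_neq0 // invr_eq0.
  by rewrite e mulrA divfK.
- case: (eqVneq c 0) => [->|c0]; [by left|right]; rewrite hvb.
  exact/(vmpow k hAc c0).
- by rewrite hvb -exprnP -invf_div.
Qed.

Lemma transform_order w : is_ord B w -> forall a, A a -> a != 0 ->
  (w (a * y ^ (- v a)) <= v a)%R.
Proof.
move=> hw a ha a0; have [n en] := ord_nat ha a0.
have hBa := transform_strict ha a0.
have h0 : a * y ^ (- v a) != 0 by rewrite mulf_neq0 // expfz_neq0.
have hd' : ~ ideal_pow B (nonunits B) n.+1 (a / y ^+ n).
  apply: (order_drop hA hm hg hgen hG hB hmB) => //.
  - exact: transform_sub.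
  - exact: transform_dominates.
  - by move=> i; apply: CB; apply: blowup_quot; apply: hg.
  - move=> z /transform_rep [k [c [b [[hc hb b0] [e hV _]]]]]; exists k, c, b; split=> //.
    by case=> _ [/eqP|]; [rewrite mulf_eq0 (negPf b0) invr_eq0 (negPf (yX k))|].
  - by apply/(vmpow n ha a0); rewrite en.
  - by move/(vmpow n.+1 ha a0); rewrite en lez_nat ltnn.
move: hd' h0 hBa; rewrite en -invr_expz -exprnP => hd' h0 hBa.
rewrite leNgt; apply/negP => hlt; apply: hd'; apply/(hw.2 _ _ hBa h0).
by move: hlt; lia.
Qed.

Lemma ord_param : ~ ideal_pow A (nonunits A) 2 y -> v y = 1.
Proof.
move=> h2; have hyA : A y by case: (hg i0).
have [n en] := ord_nat hyA y0.
have h1 : (1%:Z <= v y)%R by apply/(vmpow 1 hyA y0); apply/(mpow1 hA hm hg hgen); apply: hg.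
have {}h2 : ~ (2%:Z <= v y)%R by move/(hv.2 _ 2 hyA y0).
by move: h1 h2; rewrite en; lia.
Qed.

End Transform.
End Regular.
End Order.

(** * Sequences of local quadratic transforms *)

Lemma ideal_pow0 (F : fieldType) (A : F -> Prop) I a : subring A -> A a -> ideal_pow A I 0 a.
Proof.
move=> hA ha J hJ hG; rewrite -(mulr1 a); apply: (idM hJ) => //; apply: hG.
by exists [::]; split=> //; rewrite big_nil.
Qed.

Lemma ideal_pow1 (F : fieldType) (A I : F -> Prop) a : ideal A I -> (ideal_pow A I 1 a <-> I a).
Proof.
move=> hI; split=> [|ha J hJ hG]; last first.
  by apply: hG; exists [:: a]; split=> // [z|]; rewrite ?inE ?big_seq1 // => /eqP->.
apply=> // _ [s [hs hz ->]]; case: s hs hz => [|z [|]] // _ hz.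
by rewrite big_seq1; apply: hz; apply: mem_head.
Qed.

Lemma ideal_pow_ideal (F : fieldType) (A I : F -> Prop) n :
  subring A -> ideal A I -> ideal A (ideal_pow A I n).
Proof.
move=> hA hI; apply: (gen_ideal_ideal hA) => _ [s [_ hs ->]].
elim: s hs => [|z s IH] hs; first by rewrite big_nil; apply: sr1.
rewrite big_cons; apply: (srM hA); first by apply: (idA hI); apply: hs; apply: mem_head.
by apply: IH => w hw; apply: hs; rewrite inE hw orbT.
Qed.

(** * Valuation calculus for an order function *)

Section Valuation.
Variables (F : fieldType) (A : F -> Prop) (v : F -> int).
Hypotheses (hl : local_ring A) (hF : quotient_field_is_F A) (hv : is_ord A v).

Let hA : subring A. Proof. by case: hl. Qed.
Let hm : ideal A (nonunits A). Proof. by case: hl. Qed.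

Lemma vM q r : q != 0 -> r != 0 -> v (q * r) = v q + v r.
Proof. exact: hv.1. Qed.

Lemma v1 : v 1 = 0.
Proof.
have e : v 1 = v 1 + v 1 by rewrite -vM ?oner_neq0 // mulr1.
by apply: (addrI (v 1)); rewrite -e addr0.
Qed.

Lemma vV q : q != 0 -> v q^-1 = - v q.
Proof. by move=> q0; have := vM q0 (invr_neq0 q0); rewrite divff // v1; lia. Qed.

Lemma vN q : v (- q) = v q.
Proof.
case: (eqVneq q 0) => [->|q0]; first by rewrite oppr0.
have n1 : (- 1 : F) != 0 by rewrite oppr_eq0 oner_neq0.
have hN1 : v (- 1) = 0 by have := vM n1 n1; rewrite mulrNN mulr1 v1; lia.
by rewrite -mulN1r vM // hN1 add0r.
Qed.

Lemma vX q k : q != 0 -> v (q ^+ k) = k%:Z * v q.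
Proof.
move=> q0; elim: k => [|k IH]; first by rewrite expr0 v1 mul0r.
by rewrite exprS vM ?expf_neq0 // IH; lia.
Qed.

Lemma v_ge0 a : A a -> a != 0 -> 0 <= v a.
Proof. by move=> ha a0; apply/(hv.2 a 0 ha a0); apply: ideal_pow0. Qed.

Lemma v_nonunit a : A a -> a != 0 -> (nonunits A a <-> 1 <= v a).
Proof. by move=> ha a0; rewrite -(ideal_pow1 a hm) (hv.2 a 1 ha a0). Qed.

Lemma v_unit a : A a -> A a^-1 -> a != 0 -> v a = 0.
Proof.
move=> ha haV a0; have h1 := v_ge0 ha a0; have := v_ge0 haV (invr_neq0 a0).
by rewrite vV //; lia.
Qed.

Lemma v_inv a : A a -> a != 0 -> v a <= 0 -> A a^-1.
Proof.
move=> ha a0 h; apply: contrapT => hn.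
have : nonunits A a by split=> //; right.
by move/(v_nonunit ha a0); lia.
Qed.

Definition vge (c : int) q := q = 0 \/ c <= v q.

Lemma vgeN c q : vge c q -> vge c (- q).
Proof. by move=> [->|h]; [left; rewrite oppr0|right; rewrite vN]. Qed.

(** After clearing denominators, this is closure of a power of the maximal ideal under addition. *)
Lemma vgeD c q r : vge c q -> vge c r -> vge c (q + r).
Proof.
move=> hq hr; case: (eqVneq q 0) => [->|q0]; first by rewrite add0r.
case: (eqVneq r 0) => [->|r0]; first by rewrite addr0.
case: (eqVneq (q + r) 0) => [->|s0]; [by left|right].
have {}hq : c <= v q by case: hq q0 => [->|//]; rewrite eqxx.
have {}hr : c <= v r by case: hr r0 => [->|//]; rewrite eqxx.
have [a [b [ha hb b0 ea]]] := hF q; have [a' [b' [ha' hb' b0' ea']]] := hF r.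
have D0 : b * b' != 0 by rewrite mulf_neq0.
have hq' : q * (b * b') = a * b' by rewrite ea mulrA divfK.
have hr' : r * (b * b') = a' * b by rewrite ea' [b * b']mulrC mulrA divfK.
have hqA : A (q * (b * b')) by rewrite hq'; apply: srM.
have hrA : A (r * (b * b')) by rewrite hr'; apply: srM.
have hsA : A ((q + r) * (b * b')) by rewrite mulrDl; apply: srD.
have vq := vM q0 D0; have vr := vM r0 D0; have vs := vM s0 D0.
have q0' := mulf_neq0 q0 D0; have r0' := mulf_neq0 r0 D0; have s0' := mulf_neq0 s0 D0.
have gs := v_ge0 hsA s0'.
case: (leP (c + v (b * b')) 0) => hc; first by move: gs; rewrite vs; lia.
pose n := (absz (c + v (b * b'))).
have en : n%:Z = c + v (b * b') by rewrite /n; lia.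
suff : (n%:Z <= v ((q + r) * (b * b'))) by rewrite vs en; lia.
apply/(hv.2 _ _ hsA s0'); rewrite mulrDl; apply: (idD (ideal_pow_ideal n hA hm)).
  by apply/(hv.2 _ _ hqA q0'); rewrite vq en; lia.
by apply/(hv.2 _ _ hrA r0'); rewrite vr en; lia.
Qed.

Lemma vgeM c c' q r : vge c q -> vge c' r -> vge (c + c') (q * r).
Proof.
move=> [->|hq]; first by rewrite mul0r; left.
move=> [->|hr]; first by rewrite mulr0; left.
case: (eqVneq q 0) => [->|q0]; first by rewrite mul0r; left.
case: (eqVneq r 0) => [->|r0]; first by rewrite mulr0; left.
by right; rewrite vM //; lia.
Qed.

Lemma vge_mono c c' q : c' <= c -> vge c q -> vge c' q.
Proof. by move=> h [->|h']; [left|right; lia]. Qed.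

Lemma vge_ring a : A a -> vge 0 a.
Proof. by move=> ha; case: (eqVneq a 0) => [->|a0]; [left|right; apply: v_ge0]. Qed.

Lemma vge_nonunit a : nonunits A a -> vge 1 a.
Proof.
move=> ha; case: (eqVneq a 0) => [->|a0]; [by left|right].
by apply/v_nonunit => //; case: ha.
Qed.

Lemma vge_sum c (T : Type) (r : seq T) (P : pred T) (f : T -> F) :
  (forall i, P i -> vge c (f i)) -> vge c (\sum_(i <- r | P i) f i).
Proof. by move=> h; elim/big_ind: _ => //; [left|apply: vgeD]. Qed.

Lemma v_dominant (q r : F) : q != 0 -> vge (v q + 1) r -> q + r != 0 /\ v (q + r) = v q.
Proof.
move=> q0 hr; have hs0 : q + r != 0.
  apply/eqP => e; have er : r = - q by rewrite -[r]add0r -[0](subrr q) addrAC e add0r.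
  by case: hr; rewrite er ?vN; [move/eqP; rewrite oppr_eq0 (negPf q0)|lia].
split=> //; have h1 : vge (v q) (q + r).
  by apply: vgeD; [right|apply: vge_mono hr; lia].
case: h1 => [e|h1]; first by rewrite e eqxx in hs0.
case: (ltP (v q) (v (q + r))) => h2; last by lia.
have : vge (v q + 1) q.
  suff h : vge (v q + 1) (q + r - r) by rewrite addrK in h.
  by apply: vgeD; [right; lia|apply: vgeN].
by case=> [e|]; [rewrite e eqxx in q0|lia].
Qed.

Lemma ord_nonnegE q : ord_nonneg A q <-> vge 0 q.
Proof.
split=> [[a [b [ha hb b0 e h]]]|].
  case: (eqVneq a 0) => [a0|a0]; [by left; rewrite e a0 mul0r|right].
  rewrite e vM ?invr_neq0 // vV //; have hb0 := v_ge0 hb b0.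
  have : ((absz (v b))%:Z <= v a).
    by apply/(hv.2 a (absz (v b)) ha a0); apply: h; apply/(hv.2 b (absz (v b)) hb b0); lia.
  lia.
case: (eqVneq q 0) => [-> _|q0 hq].
  exists 0, 1; rewrite mul0r oner_neq0; split=> //; [exact: sr0|exact: sr1|].
  by move=> n _; apply: id0 (ideal_pow_ideal n hA hm).
have [a [b [ha hb b0 e]]] := hF q; exists a, b; split=> // n /(hv.2 _ _ hb b0) hn.
have a0 : a != 0 by apply/eqP => a0; rewrite e a0 mul0r eqxx in q0.
apply/(hv.2 _ _ ha a0); case: hq => [eq0|]; first by rewrite eq0 eqxx in q0.
by rewrite e vM ?invr_neq0 // vV //; lia.
Qed.

End Valuation.

Section Sequence.
Variables (F : fieldType) (R : nat -> F -> Prop) (y : nat -> F) (v : nat -> F -> int).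
Hypotheses (hR : forall i, local_ring (R i)) (hN : forall i, noetherian (R i)).
Hypotheses (hF : forall i, quotient_field_is_F (R i)) (hv : forall i, is_ord (R i) (v i)).
Hypothesis hcic : forall i q t, R i t -> t != 0 -> (forall k, R i (t * q ^+ k)) -> R i q.
Hypotheses (hsub : forall i a, R i a -> R i.+1 a)
           (hdom : forall i a, nonunits (R i) a -> nonunits (R i.+1) a).
Hypotheses (hyN : forall i, nonunits (R i) (y i)) (hy0 : forall i, y i != 0)
           (hy1 : forall i, v i (y i) = 1).
Hypothesis hst : forall i a, R i a -> a != 0 -> R i.+1 (a * y i ^ (- v i a)).
Hypothesis hfrac : forall i q, R i.+1 q -> exists c b,
  [/\ [/\ R i c, R i b & b != 0], q = c / b, c = 0 \/ v i b <= v i c & R i.+1 (y i ^ v i b / b)].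
Hypothesis hdrop : forall i a, R i a -> a != 0 -> v i.+1 (a * y i ^ (- v i a)) <= v i a.

Local Notation S := (union_rings R).
Local Notation N := (union_max R).

Let hRs i : subring (R i). Proof. by case: (hR i). Qed.
Let hy i : R i (y i). Proof. by case: (hyN i). Qed.

Lemma R_mono i j a : (i <= j)%N -> R i a -> R j a.
Proof. by move/subnK <-; elim: (j - i)%N => // k IH /IH; apply: hsub. Qed.

Lemma m_mono i j a : (i <= j)%N -> nonunits (R i) a -> nonunits (R j) a.
Proof. by move/subnK <-; elim: (j - i)%N => // k IH /IH; apply: hdom. Qed.

Lemma S_pair a b : S a -> S b -> exists n, R n a /\ R n b.
Proof.
move=> [i ha] [j hb]; exists (maxn i j); split; [apply: R_mono ha|apply: R_mono hb].
  exact: leq_maxl.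
exact: leq_maxr.
Qed.

Lemma S_subring : subring S.
Proof.
split=> [||a b ha hb|a b ha hb]; [by exists 0%N; apply: sr0|by exists 0%N; apply: sr1| |].
- by have [n [ha' hb']] := S_pair ha hb; exists n; apply: (srB (hRs n)).
- by have [n [ha' hb']] := S_pair ha hb; exists n; apply: (srM (hRs n)).
Qed.

Lemma N_in_S a : N a -> S a.
Proof. by move=> [i [ha _]]; exists i. Qed.

Lemma N_or_unit a : S a -> N a \/ (a != 0 /\ S a^-1).
Proof.
move=> [i ha]; case: (EM (nonunits (R i) a)) => h; first by left; exists i.
by right; have [h0 hV] := unit_of_notin ha h; split=> //; exists i.
Qed.

Lemma N_not_unit a : N a -> S a^-1 -> a = 0.
Proof.
move=> [i ha] [j hb]; have hk := m_mono (leq_maxl i j) ha.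
by case: hk => _ [//|[]]; apply: R_mono hb; apply: leq_maxr.
Qed.

Lemma N_ideal : ideal S N.
Proof.
split.
- exact: N_in_S.
- by exists 0%N; split; [apply: sr0|left].
- move=> a b [i ha] [j hb]; exists (maxn i j); apply: (idB (hR _).2).
    by apply: m_mono ha; apply: leq_maxl.
  by apply: m_mono hb; apply: leq_maxr.
- move=> r a [i hr] [j ha]; exists (maxn i j); apply: (idM (hR _).2).
    by apply: R_mono hr; apply: leq_maxl.
  by apply: m_mono ha; apply: leq_maxr.
Qed.

(** * Iterated strict transforms *)

Fixpoint strict_tr (n : nat) (z : F) (k : nat) : F :=
  if k is k'.+1 then strict_tr n.+1 (z * y n ^ (- v n z)) k' else z.

Lemma strict_step_neq0 n z : z != 0 -> z * y n ^ (- v n z) != 0.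
Proof. by move=> z0; rewrite mulf_neq0 // expfz_neq0. Qed.

Lemma strict_trR n z k : R n z -> z != 0 ->
  R (n + k)%N (strict_tr n z k) /\ strict_tr n z k != 0.
Proof.
elim: k n z => [|k IH] n z hz z0 /=; first by rewrite addn0.
by rewrite addnS -addSn; apply: IH; [apply: hst|apply: strict_step_neq0].
Qed.

Lemma strict_trM n z w k : z != 0 -> w != 0 ->
  strict_tr n (z * w) k = strict_tr n z k * strict_tr n w k.
Proof.
elim: k n z w => //= k IH n z w z0 w0; rewrite -IH ?strict_step_neq0 //; congr strict_tr.
by rewrite (vM (hv n)) // opprD expfzDr //; ring.
Qed.

Lemma strict_tr1 n k : strict_tr n 1 k = 1.
Proof. by elim: k n => //= k IH n; rewrite (v1 (hv n)) oppr0 expr0z mulr1. Qed.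

Lemma strict_trX n z e k : z != 0 -> strict_tr n (z ^+ e) k = strict_tr n z k ^+ e.
Proof.
move=> z0; elim: e => [|e IH]; first by rewrite !expr0 strict_tr1.
by rewrite !exprS strict_trM ?expf_neq0 // IH.
Qed.

Lemma strict_tr_unit n z k : R n z -> R n z^-1 -> z != 0 -> strict_tr n z k = z.
Proof.
elim: k n => //= k IH n hz hV z0.
rewrite (v_unit (hR n) (hv n)) // oppr0 expr0z mulr1.
by apply: IH => //; apply: hsub.
Qed.

Lemma strict_tr_add n z k l : strict_tr n z (k + l) = strict_tr (n + k) (strict_tr n z k) l.
Proof. by elim: k n z => [|k IH] n z /=; rewrite ?addn0 // IH addSnnS. Qed.

(** For a nonzero [z] in [R n], this makes [z] a unit times a product of powers of the exceptional
    parameters met on the way. *)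
Definition resolved n z := exists k, R (n + k)%N (strict_tr n z k)^-1.

Lemma resolved_ge n z k l : R n z -> z != 0 -> (k <= l)%N ->
  R (n + k)%N (strict_tr n z k)^-1 -> R (n + l)%N (strict_tr n z l)^-1.
Proof.
move=> hz z0 hkl hk; have [h1 h2] := strict_trR k hz z0.
rewrite -(subnKC hkl) strict_tr_add strict_tr_unit // addnA.
by apply: R_mono hk; apply: leq_addr.
Qed.

Lemma resolved_step n z : R n z -> z != 0 -> resolved n z -> resolved n.+1 (y n) ->
  resolved n.+1 z.
Proof.
move=> hz z0 [k hk] [l hl].
have hyn : R n.+1 (y n) by apply: hsub.
have [c hc] : exists c : nat, v n z = c%:Z.
  by have := v_ge0 (hR n) (hv n) hz z0; case: (v n z) => // c _; exists c.
pose K := maxn k l.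
have e : z = z * y n ^ (- v n z) * y n ^+ c.
  by rewrite hc -invr_expz -exprnP divfK // expf_neq0.
exists K; rewrite e strict_trM ?strict_step_neq0 ?expf_neq0 // strict_trX // invfM.
apply: (srM (hRs _)).
  have := @resolved_ge n z k K.+1 hz z0 (leq_trans (leq_maxl k l) (leqnSn _)) hk.
  by rewrite /= addSnnS.
rewrite -exprVn; apply: (srX (hRs _)).
by apply: (resolved_ge hyn _ (leq_maxr k l) hl).
Qed.

(** * The primary element [x] and the equality $S=V\cap S[1/x]$ *)

Section Primary.
Variable x : F.
Hypothesis hxS : S x.
Hypothesis hprim : primary_to S (principal S x) N.

Lemma N_power q : N q -> exists k s, S s /\ q ^+ k = x * s.
Proof. by move/hprim.2 => [_ [k [s [hs e]]]]; exists k, s. Qed.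

Lemma x_in_N : N x.
Proof.
apply/hprim.2; split=> //; exists 1%N, 1; rewrite mulr1; split=> //.
by apply: sr1 S_subring.
Qed.

Lemma x_neq0 : x != 0.
Proof.
have [k [s [hs e]]] := N_power (ex_intro _ 0%N (hyN 0)).
by apply/eqP => x0; move/eqP: e; rewrite x0 mul0r expf_eq0 (negPf (hy0 0)) andbF.
Qed.

(* [v n] stays nonnegative on [R j], with centre generated by [g]. *)
Definition centred n j g := forall z, R j z -> z != 0 ->
  0 <= v n z /\ (1 <= v n z -> R j (z / g)).

(** In [z]$=c/b$ the strict transform of [b] is a unit of the new ring, so [z] is divisible there by
    the power $v_n(c)-v_n(b)$ of [y n]. *)
Lemma centred_init n : centred n n.+1 (y n).
Proof.
move=> z hz z0; have [c [b [[hc hb b0] e hle hV]]] := hfrac hz.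
have c0 : c != 0 by apply/eqP => h; rewrite e h mul0r eqxx in z0.
case: hle => [h|hle]; first by rewrite h eqxx in c0.
have ev : v n z = v n c - v n b by rewrite e (vM (hv n)) ?invr_neq0 // (vV (hv n)).
split; first by rewrite ev; lia.
rewrite ev => h1.
have -> : z / y n = c * y n ^ (- v n c) * y n ^ (v n c - v n b - 1) * (y n ^ v n b / b).
  rewrite e; have -> : y n ^ (v n c - v n b - 1) = y n ^ v n c * y n ^ (- v n b) * y n ^ (- 1).
    by rewrite !expfzDr.
  rewrite -!invr_expz expr1z.
  have h2 : y n ^ v n c != 0 by rewrite expfz_neq0.
  have h3 : y n ^ v n b != 0 by rewrite expfz_neq0.
  by have := hy0 n => h4; field; rewrite h2 h3 h4 b0.
have [k ek] : exists k : nat, v n c - v n b - 1 = k%:Z.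
  by exists (absz (v n c - v n b - 1)%R); lia.
rewrite ek -exprnP; apply: (srM (hRs _)) => //; apply: (srM (hRs _)); first exact: hst.
by apply: (srX (hRs _)); apply: hsub.
Qed.

(** If [y j] lay in the centre, [g] would divide it; as [y j] has order one, the strict transform of
    [g] would be a unit. Likewise a denominator [b] has value zero: a multiple of [g] has a nonunit
    strict transform. *)
Lemma centred_step n j g : R j g -> g != 0 -> nonunits (R j) g ->
  nonunits (R j.+1) (g * y j ^ (- v j g)) -> centred n j g ->
  v n (y j) = 0 /\ centred n j.+1 (g * y j ^ (- v j g)).
Proof.
move=> hg g0 hgm hgm' hc.
have hg1 : 1 <= v j g by apply/(v_nonunit (hR j) (hv j) hg g0).
have hyj : v n (y j) = 0.
  have [h1 h2] := hc _ (hy j) (hy0 j).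
  case: (leP 1 (v n (y j))) => [/h2 hq|]; last by lia.
  pose w := y j / g; have w0 : w != 0 by rewrite mulf_neq0 ?invr_neq0.
  have ew : y j = w * g by rewrite /w divfK.
  have := hy1 j; rewrite {1}ew (vM (hv j)) // => hs.
  have hw := v_ge0 (hR j) (hv j) hq w0; rewrite -/w in hw.
  have hwV : R j w^-1 by apply: (v_inv (hR j) (hv j)) => //; lia.
  have hvg : v j g = 1 by lia.
  move: hgm'; rewrite hvg -invr_expz expr1z => -[_ []].
    by move/eqP; rewrite mulf_eq0 invr_eq0 (negPf g0) (negPf (hy0 j)).
  by rewrite invf_div; case; apply: hsub.
split=> // z hz z0; have [c [b [[hcj hb b0] e hle hV]]] := hfrac hz.
have c0 : c != 0 by apply/eqP => h; rewrite e h mul0r eqxx in z0.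
case: hle => [h|hle]; first by rewrite h eqxx in c0.
have hb' : v n b = 0.
  have [h1 h2] := hc _ hb b0.
  case: (leP 1 (v n b)) => [/h2 hq|]; last by lia.
  pose w := b / g; have w0 : w != 0 by rewrite mulf_neq0 ?invr_neq0.
  have ew : b = w * g by rewrite /w divfK.
  have hmul : nonunits (R j.+1) (b * y j ^ (- v j b)).
    have -> : b * y j ^ (- v j b) = (w * y j ^ (- v j w)) * (g * y j ^ (- v j g)).
      by rewrite {2}ew (vM (hv j)) // opprD expfzDr // {1}ew; ring.
    by apply: (idM (hR j.+1).2) => //; apply: hst.
  case: hmul => _ [/eqP|]; first by rewrite mulf_eq0 (negPf b0) (negPf (expfz_neq0 _ (hy0 j))).
  by rewrite -invr_expz invf_div.
have [h1 h2] := hc _ hcj c0.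
have ev : v n z = v n c by rewrite e (vM (hv n)) ?invr_neq0 // (vV (hv n)) // hb'; lia.
rewrite ev; split=> // /h2 hq.
pose w := c / g; have w0 : w != 0 by rewrite mulf_neq0 ?invr_neq0.
have ew : c = w * g by rewrite /w divfK.
have evc : v j c = v j w + v j g by rewrite {1}ew (vM (hv j)).
have -> : z / (g * y j ^ (- v j g)) =
    w * y j ^ (- v j w) * y j ^ (v j c - v j b) * (y j ^ v j b / b).
  rewrite e evc ew !expfzDr // -!invr_expz.
  have k1 : y j ^ v j w != 0 by rewrite expfz_neq0.
  have k2 : y j ^ v j g != 0 by rewrite expfz_neq0.
  have k3 : y j ^ v j b != 0 by rewrite expfz_neq0.
  by field; rewrite k1 k2 k3 b0 g0.
have [k ek] : exists k : nat, v j c - v j b = k%:Z by exists (absz (v j c - v j b)%R); lia.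
rewrite ek -exprnP; apply: (srM (hRs _)) => //; apply: (srM (hRs _)); first exact: hst.
by apply: (srX (hRs _)); apply: hsub.
Qed.

(* Otherwise [v n] would be nonnegative on [S] and positive at [x], but zero at [y n.+1]. *)
Lemma exceptional_resolved n : nonunits (R n) x -> resolved n.+1 (y n).
Proof.
move=> hxn; apply: contrapT => hn.
have hyn : R n.+1 (y n) by apply: hsub.
have hnon k : nonunits (R (n.+1 + k)%N) (strict_tr n.+1 (y n) k).
  apply: contrapT => h; apply: hn; exists k.
  have [h1 h2] := strict_trR k hyn (hy0 n).
  by have [] := unit_of_notin h1 h.
have H k : forall j g, R j g -> g != 0 -> centred n j g ->
    (forall l, nonunits (R (j + l)%N) (strict_tr j g l)) ->
    forall z, R (j + k)%N z -> z != 0 -> 0 <= v n z.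
  elim: k => [|k IH] j g hg g0 hc hnu z.
    by rewrite addn0 => hz z0; case: (hc z hz z0).
  rewrite -addSnnS; apply: (IH _ (g * y j ^ (- v j g))); first exact: hst.
  - exact: strict_step_neq0.
  - have h0 := hnu 0%N; have h1 := hnu 1%N; rewrite addn0 in h0; rewrite addn1 in h1.
    by case: (centred_step hg g0 h0 h1 hc).
  - by move=> l; have := hnu l.+1; rewrite addnS -addSn.
have hS z : S z -> z != 0 -> 0 <= v n z.
  move=> [i hi] z0; apply: (H i _ _ hyn (hy0 n) (@centred_init n) hnon) => //.
  by apply: R_mono hi; apply: leq_addl.
have hy' : v n (y n.+1) = 0.
  have h0 := hnon 0%N; have h1 := hnon 1%N; rewrite addn0 in h0; rewrite addn1 in h1.
  by case: (centred_step hyn (hy0 n) h0 h1 (@centred_init n)).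
have [k [s [hs e]]] := N_power (ex_intro _ n.+1 (hyN n.+1)).
have s0 : s != 0.
  by apply/eqP => s0; move/eqP: e; rewrite s0 mulr0 expf_eq0 (negPf (hy0 _)) andbF.
have := vX (hv n) k (hy0 n.+1); rewrite e (vM (hv n)) ?x_neq0 // hy'.
have := hS s hs s0; have hx' : R n x by case: hxn.
by have /(v_nonunit (hR n) (hv n) hx' x_neq0) := hxn; lia.
Qed.

Lemma resolved_up n m z : (n <= m)%N -> nonunits (R n) x -> R n z -> z != 0 ->
  resolved n z -> resolved m z.
Proof.
move/subnK <-; elim: (m - n)%N => // k IH hx hz z0 hr; rewrite addSn.
apply: resolved_step => //; first by apply: R_mono hz; apply: leq_addl.
  exact: IH.
by apply: exceptional_resolved; apply: m_mono hx; apply: leq_addl.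
Qed.

(** From $y_n^k=xs$, the strict transform of [x] divides a power of that of [y n], which becomes a
    unit. *)
Lemma x_resolved : exists n, nonunits (R n) x /\ forall m, (n <= m)%N -> resolved m x.
Proof.
have [n hn] := x_in_N.
have [k [s [[i hs] e]]] := N_power (ex_intro _ n (hyN n)).
have hyk : y n ^+ k != 0 by rewrite expf_neq0.
have s0 : s != 0 by apply/eqP => s0; rewrite e s0 mulr0 eqxx in hyk.
pose l := maxn n.+1 i.
have hnl : (n <= l)%N by apply: leq_trans (leq_maxl _ _).
have hxl : nonunits (R l) x by apply: m_mono hn.
have hxR : R l x by case: hxl.
have hsl : R l s by apply: R_mono hs; apply: leq_maxr.
have hyl : R l (y n) by apply: R_mono (hy n).
have [j hj] : resolved l (y n).
  apply: (@resolved_up n.+1) => //; first exact: leq_maxl.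
  - exact: hdom.
  - exact: hsub.
  - exact: exceptional_resolved.
have hxr : resolved l x.
  exists j; have := strict_trX l k j (hy0 n); rewrite e strict_trM ?x_neq0 // => E.
  have [h1 h2] := strict_trR j hsl s0; have [h3 h4] := strict_trR j hxR x_neq0.
  have -> : (strict_tr l x j)^-1 = strict_tr l s j * (strict_tr l (y n) j)^-1 ^+ k.
    by rewrite exprVn -E invfM mulrCA divff // mulr1.
  by apply: (srM (hRs _)) => //; apply: (srX (hRs _)).
exists l; split=> // m hm; exact: (resolved_up hm hxl hxR x_neq0 hxr).
Qed.

Definition eventually_nonneg q := exists n, forall j, (n <= j)%N -> vge (v j) 0 q.

(** Replace $X=x^e$ by its successive strict transforms. The product $qX$ stays in the ring: as
    $\mathrm{ord}_j(q)\ge0$, the power of [y j] removed from [X] does not exceed the order of $qX$.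
    Once [X] has become a unit, [q] itself is in the ring. *)
Lemma nonneg_in_S q e : S (q * x ^+ e) -> eventually_nonneg q -> S q.
Proof.
move=> [i hi] [n hn]; have [l [hxl hl]] := x_resolved.
pose m := maxn i (maxn n l).
have hmi : (i <= m)%N by apply: leq_maxl.
have hmn : (n <= m)%N by apply: leq_trans (leq_maxr i _); apply: leq_maxl.
have hml : (l <= m)%N by apply: leq_trans (leq_maxr i _); apply: leq_maxr.
have hxm : R m x by have [] := m_mono hml hxl.
have [k hk] : resolved m (x ^+ e).
  have [k hk] := hl m hml; exists k; rewrite strict_trX ?x_neq0 // -exprVn.
  exact: (srX (hRs _)).
have H : forall k m X, (n <= m)%N -> R m X -> X != 0 -> R m (q * X) ->
    R (m + k)%N (strict_tr m X k)^-1 -> S q.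
  elim=> [|k' IH] m' X hm' hX X0 hqX /=.
    rewrite addn0 => hV; exists m'; rewrite -(mulfK X0 q); exact: (srM (hRs _)).
  rewrite addnS -addSn; apply: IH; [exact: leqW|exact: hst|exact: strict_step_neq0|].
  case: (eqVneq q 0) => [->|q0]; first by rewrite mul0r; apply: sr0.
  have hge : 0 <= v m' q by case: (hn m' hm') => // e0; rewrite e0 eqxx in q0.
  have [c hc] : exists c : nat, v m' q = c%:Z by exists (absz (v m' q)); lia.
  have -> : q * (X * y m' ^ (- v m' X)) = q * X * y m' ^ (- v m' (q * X)) * y m' ^+ c.
    rewrite (vM (hv m')) // opprD expfzDr // hc -!invr_expz -exprnP.
    have h1 : y m' ^+ c != 0 by rewrite expf_neq0.
    have h2 : y m' ^ v m' X != 0 by rewrite expfz_neq0.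
    by field; rewrite h1 h2.
  apply: (srM (hRs _)); first by apply: hst => //; apply: mulf_neq0.
  by apply: (srX (hRs _)); apply: hsub.
apply: (H k m (x ^+ e)) => //; [exact: (srX (hRs _))|by rewrite expf_neq0 ?x_neq0|].
exact: R_mono hi.
Qed.

(** Let [r] be the least order of a numerator or denominator in any representation $q=a/b$ at any
    stage. Dividing both by $y_j^r$ gives a representation at the next stage, where an entry of
    order [r] keeps it: the order neither rises nor falls below the minimum. If a denominator ever
    attains [r], the sign is nonnegative from then on; otherwise only numerators attain it and the
    sign is negative. *)
Lemma sign_dichotomy q : q != 0 ->
  (exists n, forall j, (n <= j)%N -> 0 <= v j q) \/ (exists n, forall j, (n <= j)%N -> v j q < 0).
Proof.
move=> q0.
pose Rep j a b := [/\ R j a, R j b, a != 0, b != 0 & q = a / b].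
pose P (r : nat) := exists j a b, Rep j a b /\ (v j a = r%:Z \/ v j b = r%:Z).
have nat_v j a : R j a -> a != 0 -> exists r : nat, v j a = r%:Z.
  by move=> ha a0; have := v_ge0 (hR j) (hv j) ha a0; exists (absz (v j a)); lia.
have [r [hr hmin]] : exists r, P r /\ forall s, P s -> (r <= s)%N.
  have hex : exists r, `[< P r >].
    have [a [b [ha hb b0 e]]] := hF 0 q.
    have a0 : a != 0 by apply/eqP => a0; rewrite e a0 mul0r eqxx in q0.
    have [r hr] := nat_v 0%N a ha a0.
    by exists r; apply/asboolP; exists 0%N, a, b; split=> //; left.
  case: (ex_minnP hex) => r /asboolP hr hm; exists r; split=> // s hs; apply: hm.
  exact/asboolP.
have hge j a b : Rep j a b -> r%:Z <= v j a /\ r%:Z <= v j b.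
  move=> hrep; have [ha hb a0 b0 _] := hrep.
  have [s hs] := nat_v j a ha a0; have [t ht] := nat_v j b hb b0; rewrite hs ht !lez_nat.
  by split; apply: hmin; exists j, a, b; split=> //; [left|right].
have hnext j a b : Rep j a b -> v j a = r%:Z \/ v j b = r%:Z ->
    exists a' b', [/\ Rep j.+1 a' b', v j.+1 a' = r%:Z \/ v j.+1 b' = r%:Z &
                      v j b = r%:Z -> v j.+1 b' = r%:Z].
  move=> hrep hmin'; have [ha hb a0 b0 e] := hrep; have [h1 h2] := hge _ _ _ hrep.
  have yr : y j ^ (- r%:Z) != 0 by rewrite expfz_neq0.
  have hdiv z : R j z -> z != 0 -> r%:Z <= v j z -> R j.+1 (z * y j ^ (- r%:Z)).
    move=> hz z0 hle.
    have -> : z * y j ^ (- r%:Z) = z * y j ^ (- v j z) * y j ^+ (absz (v j z - r%:Z)%R).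
      by rewrite exprnP -mulrA -expfzDr //; congr (_ * _ ^ _); lia.
    by apply: (srM (hRs _)); [apply: hst|apply: (srX (hRs _)); apply: hsub].
  have hrep' : Rep j.+1 (a * y j ^ (- r%:Z)) (b * y j ^ (- r%:Z)).
    split; [exact: hdiv|exact: hdiv|exact: mulf_neq0|exact: mulf_neq0|].
    by rewrite e; field; rewrite b0 yr.
  have [h1' h2'] := hge _ _ _ hrep'.
  have hpers z : R j z -> z != 0 -> v j z = r%:Z -> v j.+1 (z * y j ^ (- r%:Z)) <= r%:Z.
    by move=> hz z0 ez; have := hdrop hz z0; rewrite ez.
  have hpb : v j b = r%:Z -> v j.+1 (b * y j ^ (- r%:Z)) = r%:Z.
    by move=> eb; have := hpers b hb b0 eb; lia.
  exists (a * y j ^ (- r%:Z)), (b * y j ^ (- r%:Z)); split=> //.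
  case: hmin' => [ea|/hpb]; last by right.
  by left; have := hpers a ha a0 ea; lia.
have hvq j a b : Rep j a b -> v j q = v j a - v j b.
  by move=> [ha hb a0 b0 ->]; rewrite (vM (hv j)) ?invr_neq0 // (vV (hv j)).
case: (EM (exists j a b, Rep j a b /\ v j b = r%:Z)) => [[j [a [b [hrep hb]]]]|hno].
  left; exists j => k /subnK <-.
  have [a' [b' [hrep' hb']]] : exists a' b', Rep (k - j + j)%N a' b' /\ v (k - j + j)%N b' = r%:Z.
    elim: (k - j)%N => [|i [a' [b' [h1 h2]]]]; first by exists a, b.
    have [a2 [b2 [k1 k2 k3]]] := hnext _ _ _ h1 (or_intror h2).
    by exists a2, b2; split=> //; apply: k3.
  by rewrite (hvq _ _ _ hrep'); have [] := hge _ _ _ hrep'; lia.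
right; have [j [a [b [hrep hab]]]] := hr; exists j => k /subnK <-.
have [a' [b' [hrep' hab']]] : exists a' b', Rep (k - j + j)%N a' b' /\
    (v (k - j + j)%N a' = r%:Z \/ v (k - j + j)%N b' = r%:Z).
  elim: (k - j)%N => [|i [a' [b' [h1 h2]]]]; first by exists a, b.
  by have [a2 [b2 [k1 k2 k3]]] := hnext _ _ _ h1 h2; exists a2, b2.
have hnb : v (k - j + j)%N b' <> r%:Z by move=> h; apply: hno; exists (k - j + j)%N, a', b'.
rewrite (hvq _ _ _ hrep'); have [] := hge _ _ _ hrep'.
by case: hab' => // ->; lia.
Qed.

Lemma not_in_S_negative q e : S (q * x ^+ e) -> ~ S q ->
  exists n, forall j, (n <= j)%N -> v j q < 0.
Proof.
move=> hq hn; have q0 : q != 0 by apply/eqP => q0; apply: hn; rewrite q0; apply: sr0 S_subring.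
case: (sign_dichotomy q0) => // -[n h]; case: hn; apply: (nonneg_in_S hq).
by exists n => j hj; right; apply: h.
Qed.

(** * The ring $S[1/x]$ and almost integral elements *)

Definition in_Sx q := exists e, S (q * x ^+ e).

Let hS : subring S. Proof. exact: S_subring. Qed.
Let hSx e : S (x ^+ e). Proof. exact: srX. Qed.

Lemma in_SxS q : S q -> in_Sx q.
Proof. by exists 0%N; rewrite expr0 mulr1. Qed.

Lemma in_SxM q r : in_Sx q -> in_Sx r -> in_Sx (q * r).
Proof.
move=> [e he] [f hf]; exists (e + f)%N.
by rewrite exprD mulrACA; apply: srM.
Qed.

Lemma in_SxB q r : in_Sx q -> in_Sx r -> in_Sx (q - r).
Proof.
move=> [e he] [f hf]; exists (e + f)%N.
have -> : (q - r) * x ^+ (e + f) = q * x ^+ e * x ^+ f - r * x ^+ f * x ^+ e.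
  by rewrite exprD; ring.
by apply: (srB hS); apply: srM.
Qed.

Lemma Sx_subring : subring in_Sx.
Proof.
split; [by apply: in_SxS; apply: sr0|by apply: in_SxS; apply: sr1|exact: in_SxB|exact: in_SxM].
Qed.

Lemma in_Sx_yV i : nonunits (R i) x -> in_Sx (y i)^-1.
Proof.
move=> hx; have hxR : R i x by case: hx.
have hv1 : 1 <= v i x by apply/(v_nonunit (hR i) (hv i) hxR x_neq0).
exists 1%N; rewrite expr1; exists i.+1.
have -> : (y i)^-1 * x = x * y i ^ (- v i x) * y i ^+ (absz (v i x - 1)%R).
  have -> : y i ^+ (absz (v i x - 1)%R) = y i ^ v i x / y i.
    by rewrite exprnP gez0_abs ?subr_ge0 // expfzDr // -invr_expz expr1z.
  have h1 : y i ^ v i x != 0 by rewrite expfz_neq0.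
  by rewrite -invr_expz; have := hy0 i => h2; field; rewrite h1 h2.
apply: (srM (hRs _)); first by apply: hst => //; apply: x_neq0.
by apply: (srX (hRs _)); apply: hsub.
Qed.

(* [S[1/x]] is a localization of [R n]. *)
Lemma Sx_denominator n q : nonunits (R n) x -> in_Sx q ->
  exists u, [/\ R n u, u != 0, in_Sx u^-1 & R n (u * q)].
Proof.
move=> hxn.
have hxR : R n x by case: hxn.
suff H : forall q, S q -> exists u, [/\ R n u, u != 0, in_Sx u^-1 & R n (u * q)].
  move=> [e he]; have [u [hu u0 huV huq]] := H _ he.
  have x0 : x ^+ e != 0 by rewrite expf_neq0 // x_neq0.
  exists (u * x ^+ e); split; [by apply: (srM (hRs n)) => //; apply: (srX (hRs n))|exact: mulf_neq0| |].
    rewrite invfM; apply: in_SxM => //; exists e; rewrite mulVf //; exact: sr1.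
  by rewrite -mulrA [_ * q]mulrC.
move=> {}q [i hi].
have {}hi : R (n + i)%N q by apply: R_mono hi; apply: leq_addl.
elim: i q hi => [|i IH] q.
  rewrite addn0 => hq; exists 1; rewrite mul1r invr1 oner_neq0; split=> //; first exact: sr1.
  by apply: in_SxS; apply: sr1.
rewrite addnS => hq; have [c [b [[hc hb b0] -> _ hV]]] := hfrac hq.
have [u1 [hu1 u10 hu1V hu1c]] := IH c hc; have [u2 [hu2 u20 hu2V hu2b]] := IH b hb.
have hx' : nonunits (R (n + i)%N) x by apply: m_mono hxn; apply: leq_addr.
exists (u1 * (u2 * b)); split.
- exact: (srM (hRs n)).
- by rewrite !mulf_neq0.
- rewrite !invfM; do 2!apply: in_SxM => //.
  have [k ek] : exists k : nat, v (n + i)%N b = k%:Z.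
    by have := v_ge0 (hR _) (hv _) hb b0; exists (absz (v (n + i)%N b)); lia.
  rewrite ek -exprnP in hV.
  have -> : b^-1 = (y (n + i)%N ^+ k / b) * (y (n + i)%N)^-1 ^+ k.
    by rewrite exprVn mulrAC divff ?mul1r // expf_neq0.
  apply: in_SxM; first by apply: in_SxS; exists (n + i).+1.
  by apply: (srX Sx_subring); apply: in_Sx_yV.
- have -> : u1 * (u2 * b) * (c / b) = u2 * (u1 * c) by field.
  exact: (srM (hRs n)).
Qed.

Definition almost_integral q := exists t, [/\ S t, t != 0 & forall k, S (t * q ^+ k)].

(* [R n[q]] is a finite module after inverting [x], so [q] is integral over [S[1/x]]. *)
Lemma almost_integral_Sx q : almost_integral q -> in_Sx q.
Proof.
move=> [t [ht t0 htq]]; have [n hxn] := x_in_N.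
(* Contractions to [R n] of the $S[1/x]$-modules spanned by $t,tq,\dots,tq^{k-1}$: ideals of a
   noetherian ring, hence stationary. *)
pose J k : F -> Prop := fun r => R n r /\
  exists c : nat -> F, (forall l, in_Sx (c l)) /\ r = t * \sum_(l < k) c l * q ^+ l.
have hJ k : ideal (R n) (J k).
  split.
  - by move=> ? [].
  - split; first exact: sr0.
    exists (fun=> 0); split; first by move=> _; apply: (sr0 Sx_subring).
    by rewrite big1 ?mulr0 // => i _; rewrite mul0r.
  - move=> a b [ha [c [hc ea]]] [hb [c' [hc' eb]]]; split; first exact: (srB (hRs n)).
    exists (fun l => c l - c' l); split; first by move=> l; apply: in_SxB.
    by rewrite ea eb -mulrBr -sumrB; congr (_ * _); apply: eq_bigr => i _; rewrite mulrBl.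
  - move=> r a hr [ha [c [hc ea]]]; split; first exact: (srM (hRs n)).
    exists (fun l => r * c l); split.
      by move=> l; apply: in_SxM => //; apply: in_SxS; exists n.
    rewrite ea mulrCA mulr_sumr; congr (_ * _); apply: eq_bigr => i _; exact: mulrA.
have hinc k : subset_of (J k) (J k.+1).
  move=> r [hr [c [hc e]]]; split=> //; exists (fun l => if (l < k)%N then c l else 0); split.
    by move=> l; case: ifP => // _; apply: (sr0 Sx_subring).
  rewrite big_ord_recr /= ltnn mul0r addr0 e; congr (_ * _); apply: eq_bigr => i _.
  by rewrite ltn_ord.
have [k hk] := noetherian_acc (@hN n) hJ hinc.
have [u [hu u0 huV hut]] := Sx_denominator hxn (in_SxS (htq k)).
have [|_ [c [hc e]]] := hk k.+1 (u * (t * q ^+ k)).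
  split=> //; exists (fun l => if l == k then u else 0); split.
    move=> l; case: eqP => _; [by apply: in_SxS; exists n|exact: (sr0 Sx_subring)].
  rewrite big_ord_recr /= eqxx big1 ?add0r; first by rewrite mulrCA.
  by move=> i _; rewrite (ltn_eqF (ltn_ord i)) mul0r.
pose f l := u^-1 * c l.
have hf l : in_Sx (f l) by apply: in_SxM.
have eqk : q ^+ k = \sum_(l < k) f l * q ^+ l.
  apply: (mulfI u0); apply: (mulfI t0); rewrite mulrCA e; congr (_ * _).
  by rewrite mulr_sumr; apply: eq_bigr => i _; rewrite /f mulrA mulVKf.
have [w [hw w0 hwV hwf]] : exists w, [/\ R n w, w != 0, in_Sx w^-1 &
    forall l, (l < k)%N -> R n (w * f l)].
  elim: k {hk hut e eqk} => [|k' [w [hw w0 hwV hwf]]].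
    exists 1; rewrite oner_neq0 invr1; split=> //; first exact: sr1.
    exact: (sr1 Sx_subring).
  have [w' [hw' w0' hwV' hwf']] := Sx_denominator hxn (hf k').
  exists (w * w'); split; [exact: (srM (hRs n))|exact: mulf_neq0|by rewrite invfM; apply: in_SxM|].
  move=> l; rewrite ltnS leq_eqVlt => /orP[/eqP->|hl].
    by rewrite -mulrA; apply: (srM (hRs n)).
  by rewrite mulrAC; apply: (srM (hRs n)) => //; apply: hwf.
(* Clearing denominators in the equation for $q^k$ makes [p] integral over [R n]. With [b] a
   denominator of [p], all $b^kp^l$ lie in [R n], so [hcic] applies. *)
pose p := w * q.
have hp : p ^+ k = \sum_(l < k) (w ^+ (k - l.+1) * (w * f l)) * p ^+ l.
  rewrite /p exprMn eqk mulr_sumr; apply: eq_bigr => i _; rewrite exprMn.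
  have -> : w ^+ k = w ^+ (k - i.+1) * w * w ^+ i.
    by rewrite -exprSr -exprD; congr (_ ^+ _); have := ltn_ord i; lia.
  by ring.
have [a [b [ha hb b0 ep]]] := hF n p.
have hR' : R n p.
  apply: (hcic (t := b ^+ k)); [exact: (srX (hRs n))|by rewrite expf_neq0|].
  elim/ltn_ind => l IH; case: (ltnP l k) => hl.
    have -> : b ^+ k * p ^+ l = b ^+ (k - l) * a ^+ l.
      by rewrite -(subnK (ltnW hl)) exprD -mulrA -exprMn ep subnK 1?ltnW // [b * _]mulrC divfK.
    by apply: (srM (hRs n)); apply: (srX (hRs n)).
  rewrite -(subnK hl) exprD hp mulr_sumr mulr_sumr; apply: (sr_sum (hRs n)) => i _.
  have hi := ltn_ord i.
  have -> : b ^+ k * (p ^+ (l - k) * (w ^+ (k - i.+1) * (w * f i) * p ^+ i)) =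
      w ^+ (k - i.+1) * (w * f i) * (b ^+ k * p ^+ (l - k + i)) by rewrite exprD; ring.
  apply: (srM (hRs n)); last by apply: IH; lia.
  by apply: (srM (hRs n)); [apply: (srX (hRs n))|apply: hwf].
have -> : q = w^-1 * p by rewrite /p mulKf.
by apply: in_SxM => //; apply: in_SxS; exists n.
Qed.

Hypothesis harch : archimedean S.

Lemma almost_integralM q s : almost_integral q -> S s -> almost_integral (q * s).
Proof.
move=> [t [ht t0 h]] hs; exists t; split=> // k; rewrite exprMn mulrA.
by apply: srM => //; apply: srX.
Qed.

Lemma almost_integral_negative q : almost_integral q -> ~ S q ->
  exists n, forall j, (n <= j)%N -> v j q < 0.
Proof. by move/almost_integral_Sx => [e he]; apply: (not_in_S_negative he). Qed.

(** The archimedean property gives [M] with $t/x^M\notin S$, and an element of $S[1/x]$ outside [S]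
    is eventually negative. *)
Lemma archimedean_bound t : S t -> t != 0 ->
  exists M n, forall j, (n <= j)%N -> v j t < M%:Z * v j x.
Proof.
move=> ht t0.
have hxm : nonunits S x.
  split=> //; right => hV; have := N_not_unit x_in_N hV.
  by apply/eqP; apply: x_neq0.
have [M hM] : exists M, ~ S (t / x ^+ M).
  apply: contrapT => hn; case/eqP: t0; apply: (harch hxm) => M.
  exists (t / x ^+ M); split; last by rewrite mulrCA divff ?mulr1 // expf_neq0 // x_neq0.
  by apply: contrapT => h; apply: hn; exists M.
have xM : x ^+ M != 0 by rewrite expf_neq0 // x_neq0.
have [|n hn] := @not_in_S_negative (t / x ^+ M) M _ hM; first by rewrite divfK.
exists M, n => j hj; have := hn j hj.
rewrite (vM (hv j)) ?invr_neq0 // (vV (hv j)) // (vX (hv j)) ?x_neq0 //; lia.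
Qed.

(* In the limit [v j / v j x] is bounded on [t] and bounded below on [N], so multiplying
   an almost integral element by an element of [N] makes its values positive. *)
Lemma N_almost_integral q s : almost_integral q -> N s -> N (s * q).
Proof.
move=> hq hs; case: (eqVneq q 0) => [->|q0].
  by rewrite mulr0; apply: id0 N_ideal.
case: (eqVneq s 0) => [->|s0]; first by rewrite mul0r; apply: id0 N_ideal.
have hsq : almost_integral (s * q).
  by rewrite mulrC; apply: almost_integralM => //; apply: N_in_S.
have [t [ht t0 htq]] := hq.
have [M [n1 hM]] := archimedean_bound ht t0.
have [k [w [[n2 hw] ew]]] := N_power hs.
have w0 : w != 0.
  by apply/eqP => w0; move/eqP: ew; rewrite w0 mulr0 expf_eq0 (negPf s0) andbF.
(* With this exponent, $0\le v_j(t)+Mk\,v_j(q)<M\,v_j(x)+Mk\,v_j(q)\le Mk(v_j(s)+v_j(q))$; the last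
   inequality uses $s^k=xw$. *)
have [n3 hn3] := htq (M * k)%N.
have [n4 hn4] := hs.
pose n := maxn (maxn n1 n2) (maxn n3 n4).
have hpos j : (n <= j)%N -> 0 < v j (s * q).
  rewrite !geq_max => /andP[/andP[h1 h2] /andP[h3 h4]].
  have hwj := v_ge0 (hR j) (hv j) (R_mono h2 hw) w0.
  have hk := vX (hv j) k s0; rewrite ew (vM (hv j)) ?x_neq0 // in hk.
  have htj := v_ge0 (hR j) (hv j) (R_mono h3 hn3) (mulf_neq0 t0 (expf_neq0 _ q0)).
  rewrite (vM (hv j)) ?expf_neq0 // (vX (hv j)) // in htj.
  have hMj := hM j h1.
  rewrite (vM (hv j)) //.
  have hx1 : v j x <= k%:Z * v j s by lia.
  have : 0 < (M * k)%N%:Z * (v j s + v j q).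
    rewrite mulrDr; have : M%:Z * v j x <= (M * k)%N%:Z * v j s.
      by rewrite PoszM -mulrA ler_wpM2l.
    lia.
  case: (posnP (M * k)) => [->|hMk]; first by rewrite mul0r ltxx.
  by rewrite pmulr_rgt0 // ltz_nat.
have hS' : S (s * q).
  have [e he] := almost_integral_Sx hsq; apply: (nonneg_in_S he).
  by exists n => j hj; right; apply: ltW; apply: hpos.
case: (N_or_unit hS') => // -[h0 [i hi]]; have [i' hi'] := hS'.
pose j := maxn n (maxn i i').
have := hpos j (leq_maxl _ _).
rewrite (v_unit (hR j) (hv j)) ?ltxx //.
  by apply: R_mono hi'; apply: leq_trans (leq_maxr n _); apply: leq_maxr.
by apply: R_mono hi; apply: leq_trans (leq_maxr n _); apply: leq_maxl.
Qed.

Lemma adjoin_subring A t : subring (@adjoin F A t).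
Proof. exact: gen_ring_subring. Qed.

Lemma adjoin_base (A : F -> Prop) t a : A a -> adjoin A t a.
Proof. by move=> ha D _ hD; apply: hD; left. Qed.

Lemma adjoin_gen (A : F -> Prop) t : adjoin A t t.
Proof. by move=> D _ hD; apply: hD; right. Qed.

Definition over (A : F -> Prop) (p : {poly F}) := forall i, A p`_i.

Lemma adjoin_poly t a : adjoin S t a -> exists p, over S p /\ a = p.[t].
Proof.
move=> /(_ (fun a => exists p, over S p /\ a = p.[t])); apply.
  split.
  - by exists 0; rewrite horner0; split=> // i; rewrite coef0; apply: sr0.
  - exists 1; rewrite hornerC; split=> // i; rewrite coef1.
    by case: eqP => _; [apply: sr1|apply: sr0].
  - move=> _ _ [p [hp ->]] [q [hq ->]]; exists (p - q); rewrite hornerD hornerN; split=> // i.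
    by rewrite coefB; apply: srB.
  - move=> _ _ [p [hp ->]] [q [hq ->]]; exists (p * q); rewrite hornerM; split=> // i.
    by rewrite coefM; apply: (sr_sum hS) => j _; apply: srM.
move=> a' [ha| ->].
  exists a'%:P; rewrite hornerC; split=> // i; rewrite coefC.
  by case: eqP => _ //; apply: sr0.
by exists 'X; rewrite hornerX; split=> // i; rewrite coefX; case: eqP => _; [apply: sr1|apply: sr0].
Qed.

Lemma over_common p : over S p -> exists n, over (R n) p.
Proof.
move=> hp; have [n hn] : exists n, forall i, (i < size p)%N -> R n p`_i.
  elim: (size p) => [|k [n hn]]; first by exists 0%N.
  have [l hl] := hp k; exists (maxn n l) => i; rewrite ltnS leq_eqVlt => /orP[/eqP->|hi].
    by apply: R_mono hl; apply: leq_maxr.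
  by apply: R_mono (hn i hi); apply: leq_maxl.
exists n => i; case: (ltnP i (size p)) => [/hn //|hi].
by rewrite nth_default //; apply: sr0.
Qed.

Lemma boundary_valE q : boundary_val R q <-> eventually_nonneg q.
Proof.
by split=> -[n h]; exists n => j /h; rewrite (ord_nonnegE (hR j) (@hF j) (hv j)).
Qed.

(** * The boundary ring through eventual signs *)

Local Notation V := (boundary_val R).

Lemma V_subring : subring V.
Proof.
split.
- by apply/boundary_valE; exists 0%N => j _; left.
- apply/boundary_valE; exists 0%N => j _; apply: (vge_ring (hR j) (hv j)); exact: sr1.
- move=> a b /boundary_valE [n hn] /boundary_valE [n' hn']; apply/boundary_valE.
  exists (maxn n n') => j; rewrite geq_max => /andP[h1 h2].
  apply: (vgeD (hR j) (@hF j) (hv j)); first exact: hn.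
  by apply: (vgeN (hv j)); apply: hn'.
- move=> a b /boundary_valE [n hn] /boundary_valE [n' hn']; apply/boundary_valE.
  exists (maxn n n') => j; rewrite geq_max => /andP[h1 h2].
  by rewrite -[0]addr0; apply: (vgeM (hv j)); [apply: hn|apply: hn'].
Qed.

Lemma S_in_V a : S a -> V a.
Proof.
move=> [n ha]; apply/boundary_valE; exists n => j hj; apply: (vge_ring (hR j) (hv j)).
exact: R_mono ha.
Qed.

Lemma notin_V q : ~ V q -> exists n, forall j, (n <= j)%N -> v j q < 0.
Proof.
move=> hn; have q0 : q != 0.
  by apply/eqP => q0; apply: hn; rewrite q0; apply: sr0 V_subring.
case: (sign_dichotomy q0) => // -[n h]; case: hn; apply/boundary_valE.
by exists n => j hj; right; apply: h.
Qed.

Lemma V_not_negative q n : q != 0 -> V q -> ~ (forall j, (n <= j)%N -> v j q < 0).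
Proof.
move=> q0 /boundary_valE [k hk] h; have h1 := hk _ (leq_maxr n k); have := h _ (leq_maxl n k).
by case: h1 => [e|]; [rewrite e eqxx in q0|lia].
Qed.

(** * Polynomials in $\theta$ and their values *)

Section Theta.
Variable theta : F.
Hypotheses (hth : complete_int_closure S theta) (hnS : ~ S theta).
Local Notation A := (adjoin S theta).
Local Notation D := (adjoin S theta^-1).

Lemma cic_almost_integral q : complete_int_closure S q -> almost_integral q.
Proof.
move=> [t [ht t0 h]]; exists t; split=> // k; apply: h.
by apply: (srX (adjoin_subring _ _)); apply: adjoin_gen.
Qed.

Lemma adjoin_cic a : A a -> complete_int_closure S a.
Proof.
move: hth => [t [ht t0 h]] ha; exists t; split=> // q hq; apply: h; apply: hq.
  exact: adjoin_subring.
by move=> z [hz| ->] //; apply: adjoin_base.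
Qed.

Lemma theta_neq0 : theta != 0.
Proof. by apply/eqP => h; apply: hnS; rewrite h; apply: sr0. Qed.

Let thX k : theta ^+ k != 0. Proof. by rewrite expf_neq0 // theta_neq0. Qed.
Let hA : subring A. Proof. exact: adjoin_subring. Qed.
Let hD : subring D. Proof. exact: adjoin_subring. Qed.
Let hAt : A theta. Proof. exact: adjoin_gen. Qed.
Let hDt : D theta^-1. Proof. exact: adjoin_gen. Qed.

Lemma theta_negative : exists n, forall j, (n <= j)%N -> v j theta < 0.
Proof. by apply: almost_integral_negative => //; apply: cic_almost_integral. Qed.

Lemma N_adjoin s a : N s -> A a -> N (s * a).
Proof.
by move=> hs ha; apply: N_almost_integral => //; apply: cic_almost_integral; apply: adjoin_cic.
Qed.

Definition unit_lead (p : {poly F}) := [/\ over S p, p != 0 & S (lead_coef p)^-1].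

(* Modulo [N], every element of [S[theta]] is zero or a polynomial in [theta] over the
   residue field of [S]. *)
Lemma adjoin_mod_N a : A a -> N a \/ exists p, unit_lead p /\ N (a - p.[theta]).
Proof.
move=> /adjoin_poly [p [hp ->]].
have [n] := ubnP (size p); elim: n => // n IH in p hp *; rewrite ltnS => hsz.
case: (eqVneq p 0) => [->|p0]; first by left; rewrite horner0; apply: id0 N_ideal.
case: (N_or_unit (hp (size p).-1)) => [hl|[l0 hl]]; last first.
  right; exists p; split; first by split.
  by rewrite subrr; apply: id0 N_ideal.
pose m := (size p).-1.
pose c : {poly F} := lead_coef p *: 'X^m.
have hc : N c.[theta] by rewrite /c hornerZ hornerXn; apply: N_adjoin => //; apply: (srX hA).
have ov : over S (p - c).
  move=> i; rewrite coefB coefZ coefXn; apply: (srB hS) => //; apply: (srM hS).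
    exact: (hp m).
  by case: eqP => _; [apply: sr1|apply: sr0].
have hs : (size (p - c)%R < n)%N.
  have sp : (0 < size p)%N by rewrite size_poly_gt0.
  apply: leq_trans (_ : (size p <= n)%N) => //; rewrite -(prednK sp) ltnS; apply/leq_sizeP => j hj.
  rewrite coefB coefZ coefXn; case: eqP => [->|hne]; first by rewrite mulr1 subrr.
  rewrite mulr0 subr0 nth_default // -(prednK sp) ltn_neqAle hj andbT eq_sym.
  exact/eqP.
case: (IH _ ov hs) => [|[q [hq]]]; rewrite hornerD hornerN => h.
  by left; rewrite -(subrK c.[theta] p.[theta]); apply: (idD N_ideal).
right; exists q; split=> //.
have -> : p.[theta] - q.[theta] = (p.[theta] - c.[theta] - q.[theta]) + c.[theta] by ring.
exact: (idD N_ideal).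
Qed.

Lemma poly_value p k n : over (R n) p -> (size p <= k)%N -> forall j, (n <= j)%N ->
  v j theta < 0 -> vge (v j) ((k.-1)%:Z * v j theta) p.[theta].
Proof.
move=> hp hk j hj ht; rewrite horner_coef.
apply: (vge_sum (hR j) (@hF j) (hv j)) => i _.
have h1 : vge (v j) 0 p`_i by apply: (vge_ring (hR j) (hv j)); apply: R_mono (hp i).
have h2 : vge (v j) (i%:Z * v j theta) (theta ^+ i).
  by right; rewrite (vX (hv j)) // theta_neq0.
apply: (vge_mono _ (vgeM (hv j) h1 h2)); rewrite add0r.
by have := ltn_ord i; nia.
Qed.

(** The leading coefficient has value zero and $\theta$ negative value, so the leading term is
    strictly the most negative. The error in [N] is positive and is harmless even for constant
    [p]. *)
Lemma unit_lead_value p s : unit_lead p -> N (s - p.[theta]) ->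
  exists n, forall j, (n <= j)%N -> s != 0 /\ v j s = ((size p).-1)%:Z * v j theta.
Proof.
move=> [hp p0 [n1 hl]] [n2 hN'].
have [n3 hov] := over_common hp; have [n4 hneg] := theta_negative.
exists (maxn (maxn n1 n2) (maxn n3 n4)) => j.
rewrite !geq_max => /andP[/andP[h1 h2] /andP[h3 h4]].
have ht := hneg j h4.
pose m := (size p).-1; have sp : size p = m.+1 by rewrite prednK // size_poly_gt0.
pose q := lead_coef p * theta ^+ m.
have l0 : lead_coef p != 0 by rewrite lead_coef_eq0.
have q0 : q != 0 by rewrite mulf_neq0.
have hlc : v j (lead_coef p) = 0.
  apply: (v_unit (hR j) (hv j)) => //; last exact: R_mono hl.
  by apply: R_mono (hov m).
have vq : v j q = m%:Z * v j theta.
  by rewrite (vM (hv j)) // hlc add0r (vX (hv j)) // theta_neq0.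
pose p' := \poly_(i < m) p`_i.
have ep : p.[theta] = q + p'.[theta].
  rewrite horner_coef sp big_ord_recr /= addrC; congr (_ + _).
  by rewrite horner_poly.
have hov' : over (R n3) p' by move=> i; rewrite coef_poly; case: ifP => // _; apply: sr0.
have es : s = q + (p'.[theta] + (s - p.[theta])) by rewrite ep; ring.
have [|s0 vs] := v_dominant (hR j) (@hF j) (hv j) (r := p'.[theta] + (s - p.[theta])) q0.
  apply: (vgeD (hR j) (@hF j) (hv j)).
    case: (posnP m) => [m0|mp].
      by rewrite /p' m0 poly_def big_ord0 horner0; left.
    apply: (vge_mono _ (poly_value hov' (size_poly _ _) h3 ht)); rewrite vq.
    by move: mp; case: (m) => // m' _ /=; nia.
  apply: (vge_mono _ (vge_nonunit (hR j) (hv j) (m_mono h2 hN'))); rewrite vq; nia.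
by rewrite -es in s0 vs; rewrite vs vq.
Qed.

Lemma adjoin_inv_split s : D s -> exists s0 w, [/\ S s0, D w & s = s0 + theta^-1 * w].
Proof.
move=> /(_ (fun s => exists s0 w, [/\ S s0, D w & s = s0 + theta^-1 * w])); apply.
  split.
  - by exists 0, 0; rewrite mulr0 addr0; split=> //; apply: sr0.
  - by exists 1, 0; rewrite mulr0 addr0; split=> //; [apply: sr1|apply: sr0].
  - move=> _ _ [a [w [ha hw ->]]] [b [w' [hb hw' ->]]]; exists (a - b), (w - w').
    by split; [apply: srB|apply: (srB hD)|ring].
  - move=> _ _ [a [w [ha hw ->]]] [b [w' [hb hw' ->]]].
    exists (a * b), (a * w' + b * w + theta^-1 * (w * w')); split; [exact: srM| |by ring].
    have ha' : D a by exact: adjoin_base.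
    have hb' : D b by exact: adjoin_base.
    by apply: (srD hD); [apply: (srD hD)|]; apply: (srM hD) => //; apply: (srM hD).
move=> a [ha| ->]; first by exists a, 0; rewrite mulr0 addr0; split=> //; apply: sr0.
by exists 0, 1; rewrite mulr1 add0r; split=> //; [apply: sr0|apply: sr1].
Qed.

Lemma thetaV_in_V : V theta^-1.
Proof.
have [n hn] := theta_negative; apply/boundary_valE; exists n => j hj; right.
by rewrite (vV (hv j)) ?theta_neq0 //; have := hn j hj; lia.
Qed.

Lemma D_in_V a : D a -> V a.
Proof.
by apply; [exact: V_subring|move=> z [|->]; [apply: S_in_V|apply: thetaV_in_V]].
Qed.

Lemma principal_positive s : principal D theta^-1 s ->
  exists n, forall j, (n <= j)%N -> vge (v j) 1 s.
Proof.
move=> [w [/D_in_V/boundary_valE [n hw] ->]]; have [n' hn] := theta_negative.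
exists (maxn n n') => j; rewrite geq_max => /andP[h1 h2].
rewrite -[1]addr0; apply: (vgeM (hv j)); last exact: hw.
by right; rewrite (vV (hv j)) ?theta_neq0 //; have := hn j h2; lia.
Qed.

(** A constant term in [N] would be absorbed: $s_0=\theta^{-1}(s_0\theta)$ with $s_0\theta\in N$. *)
Lemma unit_part s : D s -> ~ principal D theta^-1 s ->
  exists s0 w, [/\ S s0, s0 != 0, S s0^-1, D w & s = s0 + theta^-1 * w].
Proof.
move=> /adjoin_inv_split [s0 [w [hs0 hw ->]]] hn; exists s0, w.
case: (N_or_unit hs0) => [hN0|[h0 hV]]; last by split.
case: hn; exists (s0 * theta + w); split; last by rewrite mulrDr mulrCA mulVf ?theta_neq0 // mulr1.
by apply: (srD hD) => //; apply: adjoin_base; apply: N_in_S; apply: N_adjoin.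
Qed.

(** Every element outside the ideal is congruent to a unit of [S]; the ideal is proper since its
    elements eventually have positive value. *)
Lemma principal_maximal : maximal_ideal D (principal D theta^-1).
Proof.
have hI : ideal D (principal D theta^-1).
  split.
  - by move=> _ [w [hw ->]]; apply: (srM hD).
  - by exists 0; rewrite mulr0; split=> //; apply: sr0.
  - move=> _ _ [w [hw ->]] [w' [hw' ->]]; exists (w - w'); rewrite mulrBr; split=> //.
    exact: (srB hD).
  - by move=> r _ hr [w [hw ->]]; exists (r * w); rewrite mulrCA; split=> //; apply: (srM hD).
split.
  split=> // /principal_positive [n hn]; case: (hn n (leqnn n)) => [/eqP|].
    by rewrite oner_eq0.
  by rewrite (v1 (hv n)).
move=> J hJ hIJ; case: (EM (exists s, J s /\ ~ principal D theta^-1 s)) => [[s [hs hn]]|hn].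
  right=> q; split=> [|hq]; first exact: (idA hJ).
  have [s0 [w [h0 hne hV hw es]]] := unit_part (idA hJ hs) hn.
  have hJ0 : J s0.
    have -> : s0 = s - theta^-1 * w by rewrite es addrK.
    by apply: (idB hJ) => //; apply: hIJ; exists w.
  rewrite -(mulr1 q) -(mulVf hne) mulrA; apply: (idM hJ) => //; apply: (srM hD) => //.
  exact: adjoin_base.
left=> q; split=> [hq|]; last exact: hIJ.
by apply: contrapT => h; apply: hn; exists q.
Qed.

Lemma adjoin_shrink p m : over S p -> (size p <= m.+1)%N -> D (p.[theta] / theta ^+ m).
Proof.
move=> hp hs; rewrite horner_coef mulr_suml; apply: (sr_sum hD) => i _.
have hi : (i <= m)%N by rewrite -ltnS; apply: leq_trans hs.
have -> : p`_i * theta ^+ i / theta ^+ m = p`_i * theta^-1 ^+ (m - i).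
  rewrite -{1}(subnK hi) exprD exprVn; have h1 := thX i; have h2 := thX (m - i)%N.
  by field; rewrite h1 h2.
apply: (srM hD); [by apply: adjoin_base; apply: hp|exact: (srX hD)].
Qed.

Lemma adjoin_shrink_mod p a m : over S p -> (size p <= m.+1)%N -> N (a - p.[theta]) ->
  D (a / theta ^+ m).
Proof.
move=> hp hs hN'; have -> : a / theta ^+ m =
    p.[theta] / theta ^+ m + (a - p.[theta]) * theta^-1 ^+ m.
  by rewrite exprVn -mulrDl addrC subrK.
apply: (srD hD); first exact: adjoin_shrink.
by apply: (srM hD); [apply: adjoin_base; apply: N_in_S|apply: (srX hD)].
Qed.

(** * Consequences of identifying [W] with $S[\theta]_N$ *)

Section WithW.
Variables (W P : F -> Prop).
Hypotheses (hP : height_one_prime V P) (hW : set_eq W (loc_at V P)).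
Hypothesis hloc : set_eq (loc_at A N) W.

Let hPI : ideal V P. Proof. by case: hP => -[[]]. Qed.
Let hP1 : ~ P 1. Proof. by case: hP => -[[]]. Qed.
Let hV : subring V. Proof. exact: V_subring. Qed.

(** Write $q=a/s$ in $S[\theta]_N$ and divide both by $\theta^m$, where [m] is the degree of [s]
    modulo [N]. Nonnegativity of [q] bounds the degree of [a] by [m], so both quotients lie in
    $S[\theta^{-1}]$. Conversely, denominators outside the ideal have value zero. *)
Lemma V_localization : set_eq V (loc_at D (principal D theta^-1)).
Proof.
move=> q; split=> [hq|[a [s [ha [hs hn] s0 ->]]]]; last first.
  have [u [w [hu u0 hu' hw es]]] := unit_part hs hn.
  have [n1 h1] : principal D theta^-1 (theta^-1 * w) by exists w.
  have [n2 hn2] := principal_positive (ex_intro _ n1 h1).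
  have [n3 hn3] := hu; have [n4 hn4] := hu'.
  move: (D_in_V ha) => /boundary_valE [n5 hn5]; apply/boundary_valE.
  exists (maxn n2 (maxn (maxn n3 n4) n5)) => j.
  rewrite !geq_max => /andP[k2 /andP[/andP[k3 k4] k5]].
  have vu : v j u = 0.
    by apply: (v_unit (hR j) (hv j)) => //; [apply: R_mono hn3|apply: R_mono hn4].
  have [|_ vs] := v_dominant (hR j) (@hF j) (hv j) (r := theta^-1 * w) u0.
    by rewrite vu add0r; apply: hn2.
  rewrite -es vu in vs.
  rewrite -[0]addr0; apply: (vgeM (hv j)); first exact: hn5.
  by right; rewrite (vV (hv j)) // vs.
case: (eqVneq q 0) => [->|q0].
  exists 0, 1; rewrite mul0r oner_neq0; split=> //; first exact: sr0.
  by split; [apply: sr1|case: principal_maximal => -[]].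
have : W q.
  apply/hW; exists q, 1; rewrite divr1 oner_neq0; split=> //.
  by split=> //; apply: sr1.
move/hloc => [a [s [ha [hs hns] s0 e]]].
case: (adjoin_mod_N hs) => // -[ps [hps hNs]].
have [n hn] := unit_lead_value hps hNs.
pose m := (size ps).-1.
have sps : (size ps <= m.+1)%N by rewrite /m; lia.
have hsD : D (s / theta ^+ m) by apply: (adjoin_shrink_mod _ sps hNs); case: hps.
exists (a / theta ^+ m), (s / theta ^+ m); split.
- case: (adjoin_mod_N ha) => [hNa|[pa [hpa hNa]]].
    rewrite -exprVn; apply: (srM hD); last exact: (srX hD).
    by apply: adjoin_base; apply: N_in_S.
  apply: (adjoin_shrink_mod _ _ hNa); first by case: hpa.
  have [n' hn'] := unit_lead_value hpa hNa.
  have [k hk] := theta_negative; move/boundary_valE: hq => [l hl].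
  pose j := maxn (maxn n n') (maxn k l).
  have h1 : (n <= j)%N by rewrite !leq_max leqnn.
  have h2 : (n' <= j)%N by rewrite !leq_max leqnn !orbT.
  have h3 : (k <= j)%N by rewrite !leq_max leqnn !orbT.
  have h4 : (l <= j)%N by rewrite !leq_max leqnn !orbT.
  have [_ vs] := hn j h1; have [a0 va] := hn' j h2; have tn := hk j h3.
  case: (hl j h4) => [e0|]; first by rewrite e0 eqxx in q0.
  rewrite e (vM (hv j)) ?invr_neq0 // (vV (hv j)) // vs va -/m => hge.
  have : ((size pa).-1 <= m)%N by rewrite -lez_nat; nia.
  by lia.
- split=> // /principal_positive [k hk].
  have [h1 h2] := hn _ (leq_maxl n k); have := hk _ (leq_maxr n k).
  case=> [/eqP|]; first by rewrite mulf_eq0 invr_eq0 (negPf s0) (negPf (thX m)).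
  rewrite (vM (hv _)) ?invr_neq0 // (vV (hv _)) // (vX (hv _)) ?theta_neq0 // h2; lia.
- by rewrite mulf_neq0 ?invr_neq0.
- by rewrite e; have h1 := thX m; field; rewrite h1 s0.
Qed.

(* If [q^-1] lay in [P], the prime of all [z] with [z q^k] in [V] for every [k] would be
   nonzero and properly contained in [P]. *)
Lemma cic_in_W q : complete_int_closure S q -> W q.
Proof.
move=> hq; have hai := cic_almost_integral hq; apply/hW.
case: (EM (S q)) => [hSq|hnq].
  exists q, 1; rewrite divr1 oner_neq0; split=> //; first exact: S_in_V.
  by split=> //; apply: sr1.
have [n hn] := almost_integral_negative hai hnq.
have q0 : q != 0 by apply/eqP => e; apply: hnq; rewrite e; apply: sr0.
have hnV : ~ V q by move=> h; apply: (V_not_negative q0 h hn).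
have hqV : V q^-1.
  apply/boundary_valE; exists n => j hj; right; rewrite (vV (hv j)) //.
  by have := hn j hj; lia.
exists 1, q^-1; rewrite div1r invrK invr_neq0 //; split=> //; first exact: sr1.
split=> // hPq.
pose Q z := V z /\ forall k, V (z * q ^+ k).
have hQI : ideal V Q.
  split.
  - by move=> z [].
  - by split=> [|k]; rewrite ?mul0r; apply: sr0.
  - move=> a b [ha ha'] [hb hb']; split=> [|k]; first exact: (srB hV).
    by rewrite mulrBl; apply: (srB hV).
  - move=> r a hr [ha ha']; split=> [|k]; first exact: (srM hV).
    by rewrite -mulrA; apply: (srM hV).
have hQp : prime_ideal V Q.
  split.
    by split=> // -[_ /(_ 1%N)]; rewrite mul1r expr1.
  move=> a b ha hb [_ hab]; apply: contrapT => /not_orP [hna hnb].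
  have hex z : V z -> ~ Q z -> exists k, ~ V (z * q ^+ k).
    move=> hz hnz; apply: contrapT => h; apply: hnz; split=> // k.
    by apply: contrapT => h'; apply: h; exists k.
  have [k hk] := hex a ha hna; have [l hl] := hex b hb hnb.
  have [n1 hn1] := notin_V hk; have [n2 hn2] := notin_V hl.
  have nz z i : ~ V (z * q ^+ i) -> z * q ^+ i != 0.
    by move=> h; apply/eqP => e; apply: h; rewrite e; apply: sr0.
  have z1 := nz _ _ hk; have z2 := nz _ _ hl.
  have e : a * b * q ^+ (k + l) = (a * q ^+ k) * (b * q ^+ l) by rewrite exprD; ring.
  have := hab (k + l)%N; rewrite e => h.
  apply: (V_not_negative (n := maxn n1 n2) (mulf_neq0 z1 z2) h) => j.
  rewrite geq_max => /andP[h1 h2]; rewrite (vM (hv j)) //.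
  by have := hn1 j h1; have := hn2 j h2; lia.
have hQP : subset_of Q P.
  move=> z [hz /(_ 1%N)]; rewrite expr1 => hzq.
  by rewrite -(mulfK q0 z); apply: (idM hPI).
case: hP => _ _ /(_ Q hQp hQP) [h0|hPQ].
  have [t [ht t0 htq]] := hai.
  have : Q t by split=> [|k]; apply: S_in_V.
  by move/h0/eqP; rewrite (negPf t0).
(* The exponent $2$ shows that $q^{-1}$ is not in [Q]: $q^{-1}q^2=q$ is not in [V]. *)
have [_ /(_ 2%N)] := (hPQ _).2 hPq.
by rewrite expr2 mulKf.
Qed.

(** Euclidean division by [ps], possible because its leading coefficient is a unit of [S]. Using [s]
    instead of the value of [ps] costs a multiple of an element of [N], which stays in [N]. *)
Lemma adjoin_divide s ps p : A s -> unit_lead ps -> N (s - ps.[theta]) -> over S p ->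
  exists c r, [/\ A c, over S r, (size r < size ps)%N & N (p.[theta] - c * s - r.[theta])].
Proof.
move=> hs hps hNs; have [hov ps0 hl] := hps.
have [n] := ubnP (size p); elim: n => // n IH in p *; rewrite ltnS => hsz hp.
case: (ltnP (size p) (size ps)) => hlt.
  exists 0, p; rewrite mul0r subr0 subrr; split=> //; [exact: sr0|exact: id0 N_ideal].
have sp : (0 < size ps)%N by rewrite size_poly_gt0.
pose e := (size p - size ps)%N; pose b := lead_coef p / lead_coef ps.
have hb : S b by apply: srM => //; apply: (hp (size p).-1).
pose p' := p - b *: ('X^e * ps).
have l0 : lead_coef ps != 0 by rewrite lead_coef_eq0.
have hp' : over S p'.
  move=> i; rewrite coefB coefZ coefXnM; apply: (srB hS) => //; apply: srM => //.
  by case: ifP => // _; apply: sr0.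
have hs' : (size p' < n)%N.
  have sp' : (0 < size p)%N by apply: leq_trans hlt.
  apply: leq_trans (_ : (size p <= n)%N) => //; rewrite -(prednK sp') ltnS; apply/leq_sizeP => j hj.
  rewrite coefB coefZ coefXnM; have -> : (j < e)%N = false by apply/negP; rewrite /e; lia.
  case: (eqVneq j (size p).-1) => [->|hne].
    have -> : ((size p).-1 - e)%N = (size ps).-1 by rewrite /e; lia.
    by rewrite /b -!lead_coefE divfK // subrr.
  have hj' : (size p <= j)%N by rewrite -(prednK sp') ltn_neqAle eq_sym hne.
  rewrite !nth_default ?mulr0 ?subrr // leq_subRL; first by rewrite /e subnK.
  exact: leq_trans (leq_subr _ _) hj'.
have [c [r [hc hr hsr hN']]] := IH _ hs' hp'.
have hc1 : A (b * theta ^+ e) by apply: (srM hA); [apply: adjoin_base|apply: (srX hA)].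
exists (b * theta ^+ e + c), r; split=> //; first exact: (srD hA).
have -> : p.[theta] - (b * theta ^+ e + c) * s - r.[theta] =
    (p'.[theta] - c * s - r.[theta]) - (s - ps.[theta]) * (b * theta ^+ e).
  by rewrite /p' hornerD hornerN hornerZ hornerM hornerXn; ring.
by apply: (idB N_ideal) => //; apply: N_adjoin.
Qed.

(** Dividing the numerator of $q=a/s$ by [s] leaves $q-c=r/s$ up to an error from [N]; as [r] has
    smaller degree than [s], this is eventually nonnegative. It also lies in $S[1/x]$, hence in
    [S]. *)
Lemma cic_in_adjoin q : complete_int_closure S q -> A q.
Proof.
move=> hq; have /hloc [a [s [ha [hs hns] s0 e]]] := cic_in_W hq.
case: (adjoin_mod_N hs) => // -[ps [hps hNs]].
have [pa [hpa epa]] := adjoin_poly ha.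
have [c [r [hc hr hsr hN']]] := adjoin_divide hs hps hNs hpa.
suff h : S (q - c) by rewrite -(subrK c q); apply: (srD hA) => //; apply: adjoin_base.
have [k hk] : in_Sx (q - c).
  by apply: in_SxB; apply: almost_integral_Sx; apply: cic_almost_integral => //; apply: adjoin_cic.
apply: (nonneg_in_S hk).
have [n1 hn1] := unit_lead_value hps hNs; have [n2 hn2] := theta_negative.
have [n3 hn3] := over_common hr; have [n4 hn4] := hN'.
exists (maxn (maxn n1 n2) (maxn n3 n4)) => j.
rewrite !geq_max => /andP[/andP[h1 h2] /andP[h3 h4]].
have [_ vs] := hn1 j h1; have ht := hn2 j h2.
pose m := (size ps).-1.
have eqc : q - c = (r.[theta] + (pa.[theta] - c * s - r.[theta])) / s.
  by rewrite e epa; field.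
rewrite eqc -(subrr (v j s)); apply: (vgeM (hv j)); last by right; rewrite (vV (hv j)).
rewrite vs -/m; apply: (vgeD (hR j) (@hF j) (hv j)).
  have hrm : (size r <= m.+1)%N by rewrite /m; lia.
  exact: (poly_value hn3 hrm h3 ht).
by apply: (vge_mono _ (vge_nonunit (hR j) (hv j) (m_mono h4 hn4))); nia.
Qed.

End WithW.
End Theta.
End Primary.
End Sequence.

(** Collects what the argument along the sequence uses about one step, in terms of [y] and the two
    order functions alone. *)
Lemma transform_step (F : fieldType) (A B : F -> Prop) (v w : F -> int) :
  regular_local A -> quotient_field_is_F A -> is_ord A v ->
  local_ring B -> is_ord B w -> local_quadratic_transform A B ->
  exists y, [/\ nonunits A y, y != 0, v y = 1, subset_of (nonunits A) (nonunits B) &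
    [/\ (forall a, A a -> a != 0 -> B (a * y ^ (- v a))),
        (forall q, B q -> exists c b, [/\ [/\ A c, A b & b != 0], q = c / b,
           c = 0 \/ v b <= v c & B (y ^ v b / b)]) &
        (forall a, A a -> a != 0 -> w (a * y ^ (- v a)) <= v a)]].
Proof.
move=> hreg hF hv hB hw [y [hy hy2 [Q [hQ hmQ hBQ]]]].
have [d [g [i0 [hpar egy hch]]]] := regular_params hreg hy hy2; subst y.
have hd : (0 < d)%N by apply: leq_ltn_trans (ltn_ord i0).
have [hAl _ _] := hreg; have [hA hm] := hAl.
have y0 : g i0 != 0.
  by apply/eqP => e; apply: hy2; rewrite e; apply: id0 (ideal_pow_ideal 2 hA hm).
exists (g i0); split=> //.
- exact: (ord_param hreg hpar hd hv y0 hy2).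
- move=> a; exact: (transform_dominates hQ hmQ hBQ).
- split.
  + exact: (transform_strict hreg hpar hv hQ hBQ).
  + exact: (transform_frac hreg hpar hd hv hQ hmQ hBQ y0).
  + exact: (transform_order hreg hpar hch hd hv hQ hmQ hBQ hB y0 hw).
Qed.

Theorem theorem7p3 (F : fieldType) (Rs : nat -> F -> Prop) (x theta : F) (W : F -> Prop)
  (hR : regular_local (Rs 0%N)) (hRF : quotient_field_is_F (Rs 0%N))
  (hRdim : dim_ge (Rs 0%N) 2)
  (hseq : forall i : nat, [/\ local_quadratic_transform (Rs i) (Rs i.+1),
            strict_subset (Rs i) (Rs i.+1), regular_local (Rs i.+1) &
            dim_ge (Rs i.+1) 2])
  (hx : union_rings Rs x /\
        primary_to (union_rings Rs) (principal (union_rings Rs) x) (union_max Rs))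
  (hT : is_localization_of (Rs 0%N) (noetherian_hull (union_rings Rs)))
  (harch : archimedean (union_rings Rs))
  (hnotDVR : ~ DVR (union_rings Rs))
  (hW : exists P, height_one_prime (boundary_val Rs) P /\
                  set_eq W (loc_at (boundary_val Rs) P))
  (htheta : complete_int_closure (union_rings Rs) theta /\ ~ union_rings Rs theta)
  (hloc : set_eq (loc_at (adjoin (union_rings Rs) theta) (union_max Rs)) W) :
  [/\ set_eq (complete_int_closure (union_rings Rs)) (adjoin (union_rings Rs) theta),
      maximal_ideal (adjoin (union_rings Rs) theta^-1)
        (principal (adjoin (union_rings Rs) theta^-1) theta^-1) &
      set_eq (boundary_val Rs)
        (loc_at (adjoin (union_rings Rs) theta^-1)
                (principal (adjoin (union_rings Rs) theta^-1) theta^-1))].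
Proof.
have hreg i : regular_local (Rs i) by case: i => // i; case: (hseq i).
have hl i : local_ring (Rs i) by case: (hreg i).
have hsub i : subset_of (Rs i) (Rs i.+1) by case: (hseq i) => _ [].
have hF i : quotient_field_is_F (Rs i).
  move=> q; have [a [b [ha hb b0 e]]] := hRF q; exists a, b; split=> //.
    by elim: i => // i; apply: hsub.
  by elim: i => // i; apply: hsub.
have hpar i : exists d (g : 'I_d -> F), [/\ params (Rs i) g, prime_chain (Rs i) d & (0 < d)%N].
  have [[y [hy hy2 _]] _ _ _] := hseq i.
  have [d [g [i0 [hp _ hch]]]] := regular_params (hreg i) hy hy2.
  by exists d, g; split=> //; apply: leq_ltn_trans (ltn_ord i0).
have hex i : exists v, is_ord (Rs i) v.
  have [d [g [hp hch hd]]] := hpar i.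
  exact: (ord_exists_regular (hreg i) (@hF i) hp hch hd).
have [v hv] := choice hex.
have hcic i q t : Rs i t -> t != 0 -> (forall k, Rs i (t * q ^+ k)) -> Rs i q.
  have [d [g [hp hch hd]]] := hpar i.
  exact: (cic_regular (hreg i) (@hF i) hp hch hd).
have hN i : noetherian (Rs i) by case: (hreg i).
have [y hy] := choice (fun i => transform_step (hreg i) (@hF i) (hv i) (hl i.+1) (hv i.+1)
  (let: And4 h _ _ _ := hseq i in h)).
have hyN i : nonunits (Rs i) (y i) by case: (hy i).
have hy0 i : y i != 0 by case: (hy i).
have hy1 i : v i (y i) = 1 by case: (hy i).
have hdom i : subset_of (nonunits (Rs i)) (nonunits (Rs i.+1)) by case: (hy i).
have hst i a : Rs i a -> a != 0 -> Rs i.+1 (a * y i ^ (- v i a)).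
  by case: (hy i) => _ _ _ _ [h _ _]; apply: h.
have hfr i q : Rs i.+1 q -> exists c b, [/\ [/\ Rs i c, Rs i b & b != 0], q = c / b,
    c = 0 \/ v i b <= v i c & Rs i.+1 (y i ^ v i b / b)].
  by case: (hy i) => _ _ _ _ [_ h _]; apply: h.
have hdrop i a : Rs i a -> a != 0 -> v i.+1 (a * y i ^ (- v i a)) <= v i a.
  by case: (hy i) => _ _ _ _ [_ _ h]; apply: h.
have [hxS hprim] := hx; have [hth hnS] := htheta; have [P [hP hWP]] := hW.
split.
- move=> q; split; last by apply: (adjoin_cic hth).
  apply: (cic_in_adjoin hl hN hF hv hcic hsub hdom hyN hy0 hy1 hst hfr hdrop hxS hprim harch
    hth hnS hP hWP hloc).
- exact: (principal_maximal hl hN hF hv hcic hsub hdom hyN hy0 hy1 hst hfr hdrop hxS hprim harch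
    hth hnS).
- exact: (V_localization hl hN hF hv hcic hsub hdom hyN hy0 hy1 hst hfr hdrop hxS hprim harch
    hth hnS hP hWP hloc).
Qed.
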